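(* Let $p_1,p_2\ge1$, $\alpha_1,\alpha_2>0$, $\mathbb{Q}\in\{\mathbb{T},\mathbb{H}\}$, $\beta=(\beta_1,\beta_2)\in\mathbb{R}^2$, $\gamma\ge0$ and $\nu>0$ be fixed, and let $n_2=\nu n_1$ with $n_1\to\infty$. Consider the matrices (nested case) $$A_{\mathbf n,\mathbf p}=\frac1\nu\,M^{\mathbb{Q}_{\alpha_2}}_{n_2,p_2}\otimes K^{\mathbb{Q}_{\alpha_1}}_{n_1,p_1}+\nu\,K^{\mathbb{Q}_{\alpha_2}}_{n_2,p_2}\otimes M^{\mathbb{Q}_{\alpha_1}}_{n_1,p_1}+\frac{\beta_1}{\nu n_1}\,M^{\mathbb{Q}_{\alpha_2}}_{n_2,p_2}\otimes H^{\mathbb{Q}_{\alpha_1}}_{n_1,p_1}+\frac{\beta_2}{n_1}\,H^{\mathbb{Q}_{\alpha_2}}_{n_2,p_2}\otimes M^{\mathbb{Q}_{\alpha_1}}_{n_1,p_1}+\frac{\gamma}{\nu n_1^2}\,M^{\mathbb{Q}_{\alpha_2}}_{n_2,p_2}\otimes M^{\mathbb{Q}_{\alpha_1}}_{n_1,p_1}.$$ Then the sequence $\{A_{\mathbf n,\mathbf p}\}_{n_1}$ is distributed in the sense of the eigenvalues like the function $g_{p_1,p_2}:[-\pi,\pi]^2\to\mathbb{R}$, $$g_{p_1,p_2}(\theta_1,\theta_2)=\frac1\nu\,h_{p_2}(\theta_1)f_{p_1}(\theta_2)+\nu\,f_{p_2}(\theta_1)h_{p_1}(\theta_2).$$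
   Context: GB-splines: For $\mu>0$ and $p\ge1$ let $\mathbb{P}^{\mathbb{T}_\mu}_p=\mathrm{span}\{1,x,\dots,x^{p-2},\cos(\mu x),\sin(\mu x)\}$ and $\mathbb{P}^{\mathbb{H}_\mu}_p=\mathrm{span}\{1,x,\dots,x^{p-2},\cosh(\mu x),\sinh(\mu x)\}$ (for $p=1$ only the two transcendental functions). For $n\ge2$ take the open uniform knots $s_1=\dots=s_{p+1}=0$, $s_{p+i+1}=i/n$ ($i=0,\dots,n$), $s_{n+p+1}=\dots=s_{n+2p+1}=1$. The GB-spline space consists of $C^{p-1}$ functions on $[0,1]$ whose restriction to each $[i/n,(i+1)/n]$ lies in $\mathbb{P}^{\mathbb{Q}_\mu}_p$; $N^{\mathbb{Q}_\mu}_{i,p}$, $i=1,\dots,n+p$, is its B-spline-type basis (nonnegative, $N^{\mathbb{Q}_\mu}_{i,p}$ supported on $[s_i,s_{i+p+1}]$, partition of unity). In the trigonometric case $\mu/n<\pi$ is assumed. With indices $i,j=1,\dots,n+p-2$: $K^{\mathbb{Q}_\mu}_{n,p}=[\frac1n\int_0^1(N^{\mathbb{Q}_\mu}_{j+1,p})'(N^{\mathbb{Q}_\mu}_{i+1,p})'dx]$, $H^{\mathbb{Q}_\mu}_{n,p}=[\int_0^1(N^{\mathbb{Q}_\mu}_{j+1,p})'N^{\mathbb{Q}_\mu}_{i+1,p}dx]$, $M^{\mathbb{Q}_\mu}_{n,p}=[n\int_0^1N^{\mathbb{Q}_\mu}_{j+1,p}N^{\mathbb{Q}_\mu}_{i+1,p}dx]$.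 In the nested case the phase parameter $\alpha_k$ is fixed independently of $n_k$. The matrix $A_{\mathbf n,\mathbf p}$ equals the Galerkin matrix $[a(\varphi_j,\varphi_i)]$ for $-\Delta u+\beta\cdot\nabla u+\gamma u=f$ on $(0,1)^2$ with $u=0$ on the boundary, $a(u,v)=\int\nabla u\cdot\nabla v+\int(\beta\cdot\nabla u)v+\gamma\int uv$, using the basis $\varphi_{(n_1+p_1-2)(j-1)+i}(x,y)=N^{\mathbb{Q}_{\alpha_1}}_{i+1,p_1}(x)N^{\mathbb{Q}_{\alpha_2}}_{j+1,p_2}(y)$ built on $n_1$ intervals in $x$ and $n_2$ in $y$; its size is $d=(n_1+p_1-2)(n_2+p_2-2)$. ($n_2$ is taken as the integer best approximating $\nu n_1$.) Symbols: let $\phi_q$ be the cardinal polynomial B-spline of degree $q$ with knots $0,1,\dots,q+1$ ($\phi_0=\mathbf 1_{[0,1)}$, $\phi_q(t)=\frac tq\phi_{q-1}(t)+\frac{q+1-t}{q}\phi_{q-1}(t-1)$); $h_p(\theta)=\phi_{2p+1}(p+1)+2\sum_{k=1}^p\phi_{2p+1}(p+1-k)\cos(k\theta)$ and $f_p(\theta)=-\phi''_{2p+1}(p+1)-2\sum_{k=1}^p\phi''_{2p+1}(p+1-k)\cos(k\theta)$. Eigenvalue distribution: a sequence $\{X_{n_1}\}$ of matrices of size $d_{n_1}\to\infty$ with eigenvalues $\lambda_j(X_{n_1})$ is distributed like $g:[-\pi,\pi]^2\to\mathbb{R}$ if for every continuous compactly supported $F:\mathbb{C}\to\mathbb{C}$,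 $\lim_{n_1\to\infty}\frac1{d_{n_1}}\sum_{j=1}^{d_{n_1}}F(\lambda_j(X_{n_1}))=\frac1{4\pi^2}\int_{[-\pi,\pi]^2}F(g(\theta_1,\theta_2))\,d\theta_1d\theta_2$. *)

(* Defs.v *)
From Stdlib Require Import Reals.
From Coquelicot Require Import Coquelicot.
From HB Require Import structures.
From mathcomp Require Import all_boot all_order all_algebra.
From mathcomp Require Import Rstruct.
From mathcomp.real_closed Require Import complex mxtens.

Set Implicit Arguments.
Unset Strict Implicit.
Unset Printing Implicit Defensive.

Import Order.TTheory GRing.Theory Num.Theory.
Local Open Scope ring_scope.

Inductive gbkind := Trig | Hyp.

Definition tfun (Q : gbkind) (x : R) : R :=
  match Q with Trig => sin x | Hyp => sinh x end.

(* open uniform knots (1-based index k):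
   s_1 = ... = s_{p+1} = 0, s_{p+i+1} = i/n (0<=i<=n), s_{n+p+1} = ... = 1 *)
Definition knot (n p k : nat) : R :=
  if (k <= p.+1)%N then 0
  else if (k <= n + p + 1)%N then (k - p.+1)%N%:R / n%:R
  else 1.

(* GB-splines of degree 1 (space span{cos(mu x), sin(mu x)} resp.
   span{cosh(mu x), sinh(mu x)}), index i (1-based) *)
Definition GB1 (Q : gbkind) (mu : R) (n p i : nat) (x : R) : R :=
  let a := knot n p i in
  let b := knot n p i.+1 in
  let c := knot n p i.+2 in
  if [&& a < b, a <= x & x < b] then
    tfun Q (mu * (x - a)) / tfun Q (mu * (b - a))
  else if [&& b < c, b <= x & x < c] then
    tfun Q (mu * (c - x)) / tfun Q (mu * (c - b))
  else 0.

(* GBaux Q mu n p q i = N_{i,q+1} on the knot sequence of degree p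
   (integral recurrence
     N_{i,q+1}(x) = delta_{i,q} int_{-oo}^x N_{i,q} - delta_{i+1,q} int_{-oo}^x N_{i+1,q},
     delta_{i,q} = (int N_{i,q})^{-1};
   when the support [s_i, s_{i+q+1}] of N_{i,q} is degenerate the normalized
   function delta_{i,q} N_{i,q} is the Dirac mass at s_i, whose primitive is
   the Heaviside step at s_i). *)
Fixpoint GBaux (Q : gbkind) (mu : R) (n p q : nat) : nat -> R -> R :=
  match q with
  | 0%N => GB1 Q mu n p
  | q'.+1 =>
      let prev := GBaux Q mu n p q' in
      let I := fun (i : nat) (x : R) =>
        if knot n p (i + q'.+1 + 1) <= knot n p i then
          (if knot n p i <= x then 1 else 0)
        else RInt (prev i) 0 x / RInt (prev i) 0 1 in
      fun i x => I i x - I i.+1 x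
  end.

(* N^{Q_mu}_{i,p} on [0,1] with n intervals, i = 1..n+p *)
Definition GBspline (Q : gbkind) (mu : R) (n p i : nat) : R -> R :=
  GBaux Q mu n p (p.-1) i.

Definition mdim (n p : nat) : nat := (n + p - 2)%N.

(* Row i, column j (0-based here; 1-based i+1, j+1 in the paper, which use
   the basis functions N_{i+2}, N_{j+2}). *)
Definition Kmx (Q : gbkind) (mu : R) (n p : nat) : 'M[R]_(mdim n p) :=
  \matrix_(i, j) ((n%:R)^-1 *
     RInt (fun x => Derive (GBspline Q mu n p (j.+2)) x
                    * Derive (GBspline Q mu n p (i.+2)) x) 0 1).

Definition Hmx (Q : gbkind) (mu : R) (n p : nat) : 'M[R]_(mdim n p) :=
  \matrix_(i, j)
     RInt (fun x => Derive (GBspline Q mu n p (j.+2)) x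
                    * GBspline Q mu n p (i.+2) x) 0 1.

Definition Mmx (Q : gbkind) (mu : R) (n p : nat) : 'M[R]_(mdim n p) :=
  \matrix_(i, j) (n%:R *
     RInt (fun x => GBspline Q mu n p (j.+2) x
                    * GBspline Q mu n p (i.+2) x) 0 1).

(* n_2 = the integer nearest to nu * n_1 (floor (nu n_1 + 1/2)) *)
Definition n2of (nu : R) (n1 : nat) : nat :=
  Z.to_nat (Z.sub (up (nu * n1%:R + 2^-1)) (Zpos xH)).

Definition Adim (nu : R) (p1 p2 n1 : nat) : nat :=
  (mdim (n2of nu n1) p2 * mdim n1 p1)%N.

Definition Amx (Q : gbkind) (p1 p2 : nat) (a1 a2 b1 b2 g nu : R) (n1 : nat)
  : 'M[R]_(Adim nu p1 p2 n1) :=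
  let n2 := n2of nu n1 in
  let K1 := Kmx Q a1 n1 p1 in let H1 := Hmx Q a1 n1 p1 in
  let M1 := Mmx Q a1 n1 p1 in
  let K2 := Kmx Q a2 n2 p2 in let H2 := Hmx Q a2 n2 p2 in
  let M2 := Mmx Q a2 n2 p2 in
  nu^-1 *: (M2 *t K1) + nu *: (K2 *t M1)
  + (b1 / (nu * n1%:R)) *: (M2 *t H1) + (b2 / n1%:R) *: (H2 *t M1)
  + (g / (nu * n1%:R ^+ 2)) *: (M2 *t M1).

(* cardinal polynomial B-spline phi_q of degree q with knots 0,1,...,q+1:
   phi_0 = 1_[0,1), phi_q(t) = t/q phi_{q-1}(t) + (q+1-t)/q phi_{q-1}(t-1) *)
Fixpoint cardB (q : nat) : R -> R :=
  match q with
  | 0%N => fun t => if (0 <= t) && (t < 1) then 1 else 0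
  | q'.+1 => fun t =>
      t / q'.+1%:R * cardB q' t + (q'.+2%:R - t) / q'.+1%:R * cardB q' (t - 1)
  end.

Definition hsym (p : nat) (th : R) : R :=
  cardB (2 * p + 1) (p.+1%:R)
  + 2 * \sum_(1 <= k < p.+1) cardB (2 * p + 1) ((p.+1 - k)%N%:R) * cos (k%:R * th).

Definition fsym (p : nat) (th : R) : R :=
  - Derive_n (cardB (2 * p + 1)) 2 (p.+1%:R)
  - 2 * \sum_(1 <= k < p.+1)
          Derive_n (cardB (2 * p + 1)) 2 ((p.+1 - k)%N%:R) * cos (k%:R * th).

Definition gsym (p1 p2 : nat) (nu : R) (th1 th2 : R) : R :=
  nu^-1 * hsym p2 th1 * fsym p1 th2 + nu * fsym p2 th1 * hsym p1 th2.

Definition cabs (z : R[i]) : R := sqrt (complex.Re z ^+ 2 + complex.Im z ^+ 2).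

Definition ccontinuous (F : R[i] -> R[i]) : Prop :=
  forall (z : R[i]) (e : R), 0 < e ->
    exists d : R, 0 < d /\ forall w : R[i], cabs (w - z) < d -> cabs (F w - F z) < e.

Definition compact_support (F : R[i] -> R[i]) : Prop :=
  exists M : R, forall z : R[i], M < cabs z -> F z = 0.

Definition eigenvalue_list (d : nat) (A : 'M[R]_d) (s : seq R[i]) : Prop :=
  map_poly (fun x : R => @Complex R x 0) (char_poly A)
  = \prod_(z <- s) ('X - z%:P).

Definition eig_distributed (dim : nat -> nat) (X : forall n, 'M[R]_(dim n))
    (g : R -> R -> R) : Prop :=
  forall lam : nat -> seq R[i], (forall n, eigenvalue_list (X n) (lam n)) ->
  forall F : R[i] -> R[i], ccontinuous F -> compact_support F ->
    is_lim_seq (fun n => (dim n)%:R^-1 * \sum_(z <- lam n) complex.Re (F z))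
      ((4 * PI ^+ 2)^-1 *
         RInt (fun t1 => RInt (fun t2 => complex.Re (F (@Complex R (g t1 t2) 0))) (- PI) PI)
           (- PI) PI)
    /\
    is_lim_seq (fun n => (dim n)%:R^-1 * \sum_(z <- lam n) complex.Im (F z))
      ((4 * PI ^+ 2)^-1 *
         RInt (fun t1 => RInt (fun t2 => complex.Im (F (@Complex R (g t1 t2) 0))) (- PI) PI)
           (- PI) PI).

(* Main.v *)
(** As n grows, mu/n tends to 0 and the degree 1 GB-splines approach the hat functions in the
    uniform norm (relatively for derivatives). The integral recurrence preserves closeness because
    the integrals by which it divides are bounded below: the polynomial B-spline of degree q has
    integral (s_{i+q+1} - s_i)/(q+1), a fact read off from its moments, which are complete
    homogeneous symmetric polynomials of the knots. So the entries of M, K and H are, uniformly,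
    close to their polynomial counterparts; away from the boundary these are the values and second
    derivatives of cardinal B-splines at integers, i.e. the Fourier coefficients of h_p and f_p.

    The Galerkin matrices are thus banded with bounded row sums, and their interior rows act
    approximately like convolution by the Fourier coefficients of the symbol g. This property is
    stable under products, so tr(A^k)/d tends to the mean of g^k. The eigenvalues are bounded by
    the row sums and, since only the vanishing advection terms break the symmetry, have imaginary
    parts tending to 0; Bernstein approximation passes from powers to continuous functions. *)
Require Import Defs.
From Stdlib Require Import Reals Lra ZArith FunctionalExtensionality.
From Coquelicot Require Import Coquelicot.
From mathcomp Require Import all_boot all_order all_algebra.
From mathcomp Require Import Rstruct zify.
From mathcomp.real_closed Require Import complex mxtens.
Set Implicit Arguments.
Unset Strict Implicit.
Unset Printing Implicit Defensive.
Delimit Scope Z_scope with stdZ.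
Delimit Scope R_scope with coqR.
Local Open Scope R_scope.

(** * Piecewise continuous functions *)

(** The recurrence divides by integrals of order 1/n, so a uniform error e survives it only because
    supports also have width O(1/n): an error O(e/n) on a primitive is divided by a quantity of
    order 1/n. Derivatives need no recurrence of their own, since the derivative of one stage is a
    difference of normalized splines of the previous stage; closeness there costs a factor n, which
    the scaling of K and H absorbs. All of this holds for large n only, when mu/n is small. No
    Toeplitz matrix is formed and no spectrum of one is used. A symbol is tested by letting interior
    rows act on the exponentials of every frequency; averaging over the frequencies returns the
    diagonal entry. The rows near the boundary are O(n) among order n^2 and disappear from the
    averaged trace. The matrices are not symmetric and perhaps not diagonalizable, so no variational
    comparison of eigenvalues is available. Traces of powers yield sums of Re(z^k), while the
    approximating polynomial must be evaluated at Re z; the smallness of the imaginary parts bridges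
    the two. *)

Definition pc (n : nat) (f : R -> R) : Prop :=
  forall k : Z, exists2 g : R -> R, (forall x, continuous g x) &
    forall x, IZR k < INR n * x < IZR k + 1 -> f x = g x.

(** All knots lie on the grid of mesh 1/n. [pc] leaves values at grid points free, so identities are
    only claimed off the grid, and one-sided conventions at knots, jumps and missing derivatives
    never enter an integral. *)
Definition off (n : nat) (x : R) : Prop := forall k : Z, INR n * x <> IZR k.

Lemma off_cell n x : off n x ->
  exists k : Z, IZR k < INR n * x < IZR k + 1.
Proof.
move=> ox; exists (up (INR n * x) - 1)%stdZ.
have [u1 u2] := archimed (INR n * x).
have := ox (up (INR n * x) - 1)%stdZ; rewrite minus_IZR => ne; lra.
Qed.

Lemma cell_off n x k : IZR k < INR n * x < IZR k + 1 -> off n x.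
Proof.
move=> [h1 h2] j hj; rewrite hj in h1 h2.
have := lt_IZR _ _ h1; rewrite -plus_IZR in h2; have := lt_IZR _ _ h2; lia.
Qed.

Lemma locally_cell n x k : IZR k < INR n * x < IZR k + 1 ->
  locally x (fun y => IZR k < INR n * y < IZR k + 1).
Proof.
move=> [h1 h2]; have nn := pos_INR n.
have n1 : 0 < INR n + 1 by lra.
have e0 : 0 < Rmin (INR n * x - IZR k) (IZR k + 1 - INR n * x) / (INR n + 1).
  by apply: Rdiv_lt_0_compat n1; apply: Rmin_pos; lra.
exists (mkposreal _ e0) => y /= hy.
have {}hy : Rabs (y - x) < Rmin (INR n * x - IZR k) (IZR k + 1 - INR n * x) / (INR n + 1) by [].
have h3 : (INR n + 1) * Rabs (y - x) < Rmin (INR n * x - IZR k) (IZR k + 1 - INR n * x).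
  have := Rmult_lt_compat_l _ _ _ n1 hy.
  have -> : (INR n + 1) * (Rmin (INR n * x - IZR k) (IZR k + 1 - INR n * x) / (INR n + 1)) = Rmin (INR n * x - IZR k) (IZR k + 1 - INR n * x) by field; lra.
  by [].
have m1 := Rmin_l (INR n * x - IZR k) (IZR k + 1 - INR n * x).
have m2 := Rmin_r (INR n * x - IZR k) (IZR k + 1 - INR n * x).
have a0 := Rabs_pos (y - x).
have h4 : Rabs (INR n * (y - x)) <= INR n * Rabs (y - x).
  by rewrite Rabs_mult (Rabs_pos_eq _ nn); lra.
have [h5 h6] := Rabs_def2 (INR n * (y - x)) (Rmin (INR n * x - IZR k) (IZR k + 1 - INR n * x)) ltac:(lra).
split; nra.
Qed.

Lemma pc_continuous n f x : pc n f -> off n x -> continuous f x.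
Proof.
move=> pf /off_cell[k hk]; have [g cg fg] := pf k.
apply: (continuous_ext_loc _ g); last exact: cg.
have := locally_cell hk; apply: filter_imp => y hy; by rewrite fg.
Qed.

Lemma pc_of_continuous n f : (forall x, continuous f x) -> pc n f.
Proof. by move=> cf k; exists f. Qed.

Lemma pc_ext n f g : (forall x, off n x -> f x = g x) -> pc n f -> pc n g.
Proof.
move=> fg pf k; have [h ch fh] := pf k; exists h => // x hx.
by rewrite -fg ?fh //; apply: cell_off hx.
Qed.

Lemma pc_const n c : pc n (fun=> c).
Proof. by apply: pc_of_continuous => x; apply: continuous_const. Qed.

Lemma pc_plus n f g : pc n f -> pc n g -> pc n (fun x => f x + g x).
Proof.
move=> pf pg k; have [f' cf hf] := pf k; have [g' cg hg] := pg k.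
exists (fun x => f' x + g' x) => [x|x hx]; first exact: continuous_plus.
by rewrite hf ?hg.
Qed.

Lemma pc_mult n f g : pc n f -> pc n g -> pc n (fun x => f x * g x).
Proof.
move=> pf pg k; have [f' cf hf] := pf k; have [g' cg hg] := pg k.
exists (fun x => f' x * g' x) => [x|x hx]; first exact: continuous_mult.
by rewrite hf ?hg.
Qed.

Lemma pc_scal n c f : pc n f -> pc n (fun x => c * f x).
Proof. by move=> pf; apply: pc_mult => //; apply: pc_const. Qed.

Lemma pc_minus n f g : pc n f -> pc n g -> pc n (fun x => f x - g x).
Proof.
move=> pf pg; apply: (@pc_ext _ (fun x => f x + (-1) * g x)); first by move=> x _; lra.
by apply: pc_plus => //; apply: pc_scal.
Qed.

Lemma pc_div n f c : pc n f -> pc n (fun x => f x / c).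
Proof.
by move=> pf; apply: pc_mult => //; apply: pc_const.
Qed.

Lemma pc_abs n f : pc n f -> pc n (fun x => Rabs (f x)).
Proof.
move=> pf k; have [f' cf hf] := pf k.
exists (fun x => Rabs (f' x)) => [x|x hx]; last by rewrite hf.
exact: (continuous_comp f' Rabs x (cf x) (continuous_Rabs _)).
Qed.

Lemma pc_comp_shift n f (j : Z) : (0 < n)%N -> pc n f ->
  pc n (fun x => f (x + IZR j / INR n)).
Proof.
move=> n0 pf k; have nn : 0 < INR n by apply: lt_0_INR; apply/ltP.
have [g cg hg] := pf (k + j)%stdZ.
exists (fun x => g (x + IZR j / INR n)) => [x|x hx].
  apply: (continuous_comp (fun x => x + IZR j / INR n) g); last exact: cg.
  by apply: continuous_plus; [apply: continuous_id|apply: continuous_const].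
rewrite hg // plus_IZR.
have -> : INR n * (x + IZR j / INR n) = INR n * x + IZR j by field; lra.
lra.
Qed.

Section pc_integral.
Variables (n : nat) (n0 : (0 < n)%N).

Let nn : 0 < INR n. Proof. by apply: lt_0_INR; apply/ltP. Qed.

Lemma pc_ex_RInt f a b : pc n f -> ex_RInt f a b.
Proof.
move=> pf.
have cell k : ex_RInt f (IZR k / INR n) ((IZR k + 1) / INR n).
  have [g cg fg] := pf k.
  have lt : IZR k / INR n < (IZR k + 1) / INR n.
    by apply: Rmult_lt_compat_r; [apply: Rinv_0_lt_compat|lra].
  apply: (ex_RInt_ext g).
    move=> x; rewrite Rmin_left ?Rmax_right; [|lra..] => -[h1 h2]; rewrite fg //; split.
      have := Rmult_lt_compat_l _ _ _ nn h1.
      by have -> : INR n * (IZR k / INR n) = IZR k by field; lra.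
    have := Rmult_lt_compat_l _ _ _ nn h2.
    by have -> : INR n * ((IZR k + 1) / INR n) = IZR k + 1 by field; lra.
  exact: ex_RInt_continuous.
have cells k r : ex_RInt f (IZR k / INR n) ((IZR k + INR r) / INR n).
  elim: r => [|r IH]; first by rewrite Rplus_0_r; apply: ex_RInt_point.
  apply: (ex_RInt_Chasles _ _ _ _ IH).
  have := cell (k + Z.of_nat r)%stdZ; rewrite plus_IZR -INR_IZR_INZ S_INR.
  by rewrite Rplus_assoc.
have wl u v : u <= v -> ex_RInt f u v.
  move=> uv; pose k := (up (INR n * u) - 1)%stdZ.
  have [u1 u2] := archimed (INR n * u).
  have [v1 v2] := archimed (INR n * v).
  have hk : IZR k / INR n <= u.
    apply/Rle_div_l => //; rewrite /k minus_IZR; lra.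
  pose r := Z.to_nat (up (INR n * v) - k).
  have hr : v <= (IZR k + INR r) / INR n.
    apply/Rle_div_r => //; rewrite /r (INR_IZR_INZ (Z.to_nat _)).
    have : (up (INR n * v) - k <= Z.of_nat (Z.to_nat (up (INR n * v) - k)))%stdZ by lia.
    move=> /IZR_le; rewrite minus_IZR; lra.
  have := cells k r => h.
  have h1 : ex_RInt f u ((IZR k + INR r) / INR n).
    exact: (ex_RInt_Chasles_2 f (IZR k / INR n) u _ (conj hk (Rle_trans _ _ _ uv hr)) h).
  exact: (ex_RInt_Chasles_1 f u v _ (conj uv hr) h1).
case: (Rle_dec a b) => [|h]; first exact: wl.
by apply: ex_RInt_swap; apply: wl; lra.
Qed.

Lemma pc_continuous_RInt f a x : pc n f -> continuous (fun y => RInt f a y) x.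
Proof.
move=> pf; apply: (continuous_RInt_1 f a x (fun y => RInt f a y)).
by apply: filter_forall => y; apply: RInt_correct; apply: pc_ex_RInt.
Qed.

Lemma pc_derive_RInt f a x : pc n f -> off n x ->
  is_derive (fun y => RInt f a y) x (f x).
Proof.
move=> pf ox; apply: (is_derive_RInt f _ a x); last exact: pc_continuous ox.
by apply: filter_forall => y; apply: RInt_correct; apply: pc_ex_RInt.
Qed.

(** By continuity the mean value theorem applies on each closed cell; a walk along the grid points
    then links every point to 0. *)
Lemma pc_derive0_const (D : R -> R) :
  (forall x, continuous D x) -> (forall x, off n x -> is_derive D x 0) ->
  forall x y, D x = D y.
Proof.
move=> cD dD.
have seg u v k : IZR k <= INR n * u -> u <= v -> INR n * v <= IZR k + 1 -> D u = D v.
  move=> ku uv vk.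
  have [] := MVT_gen D u v (fun=> 0).
  - move=> x; rewrite Rmin_left ?Rmax_right // => -[h1 h2]; apply: dD.
    by apply: (@cell_off _ _ k); split; nra.
  - by move=> x _; apply/continuity_pt_filterlim; apply: cD.
  - by move=> c [_]; lra.
have grid k r : D (IZR k / INR n) = D ((IZR k + INR r) / INR n).
  elim: r => [|r ->]; first by rewrite Rplus_0_r.
  have e : IZR (k + Z.of_nat r) = IZR k + INR r by rewrite plus_IZR -INR_IZR_INZ.
  apply: (@seg _ _ (k + Z.of_nat r)%stdZ); rewrite ?e ?S_INR.
  - by right; field; lra.
  - by apply: Rmult_le_compat_r; [apply/Rlt_le/Rinv_0_lt_compat|lra].
  - by right; field; lra.
have to0 x : D x = D 0.
  pose k := (up (INR n * x) - 1)%stdZ.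
  have [u1 u2] := archimed (INR n * x).
  have -> : D x = D (IZR k / INR n).
    apply/esym; apply: (@seg _ _ k).
    - by right; field; lra.
    - by apply/Rle_div_l => //; rewrite /k minus_IZR; lra.
    - by rewrite /k minus_IZR; lra.
  have -> : D 0 = D (0 / INR n) by rewrite /Rdiv Rmult_0_l.
  case: (Z_le_gt_dec 0 k) => hk.
    rewrite (grid 0%stdZ (Z.to_nat k)); congr D; congr Rdiv.
    by rewrite INR_IZR_INZ Z2Nat.id //; lra.
  rewrite (grid k (Z.to_nat (- k))); congr D; congr Rdiv.
  rewrite INR_IZR_INZ Z2Nat.id; last lia.
  by rewrite opp_IZR; lra.
by move=> x y; rewrite to0 (to0 y).
Qed.

(** The form used for every integration by parts below: the primitive may have kinks at the
    knots. *)
Lemma pc_FTC f F a b : pc n f -> (forall x, continuous F x) ->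
  (forall x, off n x -> is_derive F x (f x)) -> RInt f a b = F b - F a.
Proof.
move=> pf cF dF.
have := @pc_derive0_const (fun x => F x - RInt f a x) _ _ b a.
rewrite RInt_point /= => h.
suff : F b - RInt f a b = F a - 0 by lra.
apply: h => [x|x ox].
  by apply: continuous_minus => //; apply: pc_continuous_RInt.
have := is_derive_minus _ _ _ _ _ (dF x ox) (pc_derive_RInt a pf ox).
by rewrite minus_eq_zero.
Qed.

Lemma pc_RInt_ext f g a b : pc n f -> (forall x, off n x -> f x = g x) ->
  RInt f a b = RInt g a b.
Proof.
move=> pf fg.
rewrite (@pc_FTC f (fun x => RInt g a x) a b pf).
- by rewrite RInt_point /zero /=; lra.
- by move=> x; apply: pc_continuous_RInt; apply: pc_ext pf.
- by move=> x ox; rewrite fg //; apply: pc_derive_RInt => //; apply: pc_ext pf.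
Qed.

Lemma pc_RInt_plus f g a b : pc n f -> pc n g ->
  RInt (fun x => f x + g x) a b = RInt f a b + RInt g a b.
Proof. by move=> pf pg; apply: RInt_plus; apply: pc_ex_RInt. Qed.

Lemma pc_RInt_minus f g a b : pc n f -> pc n g ->
  RInt (fun x => f x - g x) a b = RInt f a b - RInt g a b.
Proof. by move=> pf pg; apply: RInt_minus; apply: pc_ex_RInt. Qed.

Lemma pc_RInt_scal c f a b : pc n f ->
  RInt (fun x => c * f x) a b = c * RInt f a b.
Proof. by move=> pf; apply: RInt_scal; apply: pc_ex_RInt. Qed.

Lemma pc_RInt_Chasles f a b c : pc n f -> RInt f a b + RInt f b c = RInt f a c.
Proof. by move=> pf; apply: RInt_Chasles; apply: pc_ex_RInt. Qed.

Lemma pc_RInt_le f g a b : pc n f -> pc n g -> a <= b ->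
  (forall x, off n x -> a < x < b -> f x <= g x) -> RInt f a b <= RInt g a b.
Proof.
move=> pf pg ab fg.
(* [z] is [f] off the grid and [g] on it, so that the inequality holds at every point, as [RInt_le]
   asks. The test succeeds exactly when n x is an integer. *)
pose z x := if Req_EM_T (INR n * x) (IZR (up (INR n * x) - 1)) then g x else f x.
have fz x : off n x -> f x = z x by rewrite /z; case: Req_EM_T => // h /(_ _ h).
rewrite (@pc_RInt_ext f z) //; apply: RInt_le => //.
- by apply: pc_ex_RInt; apply: pc_ext pf.
- exact: pc_ex_RInt.
move=> x hx; rewrite /z; case: Req_EM_T => [e|h]; first exact: Rle_refl.
apply: fg => // k hk; apply: h.
have [u1 u2] := archimed (INR n * x); rewrite hk in u1 u2 *.
have h1 := lt_IZR _ _ u1.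
have : IZR (up (IZR k)) <= IZR (k + 1) by rewrite plus_IZR; lra.
by move=> /le_IZR h2; congr IZR; lia.
Qed.

Lemma pc_RInt_abs_le f a b : pc n f -> a <= b ->
  Rabs (RInt f a b) <= RInt (fun x => Rabs (f x)) a b.
Proof.
move=> pf ab; have pa := pc_abs pf.
apply: Rabs_le; split.
  have -> : - RInt (fun x => Rabs (f x)) a b = RInt (fun x => -1 * Rabs (f x)) a b.
    by rewrite pc_RInt_scal //; lra.
  apply: pc_RInt_le => //; first exact: pc_scal.
  by move=> x _ _; have := Rle_abs (- f x); rewrite Rabs_Ropp; lra.
by apply: pc_RInt_le => // x _ _; exact: Rle_abs.
Qed.

Lemma pc_RInt_ext_open f g a b : pc n f -> pc n g -> a <= b ->
  (forall x, off n x -> a < x < b -> f x = g x) -> RInt f a b = RInt g a b.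
Proof.
move=> pf pg ab fg.
by apply: Rle_antisym; apply: pc_RInt_le => // x ox hx; rewrite fg //; lra.
Qed.

Lemma pc_RInt_swap f a b : pc n f -> RInt f b a = - RInt f a b.
Proof. by move=> pf; rewrite -(opp_RInt_swap f) //; apply: pc_ex_RInt. Qed.

Lemma pc_RInt_eq0 f a b : pc n f -> a <= b ->
  (forall x, off n x -> a < x < b -> f x = 0) -> RInt f a b = 0.
Proof.
move=> pf ab f0; rewrite (@pc_RInt_ext_open f (fun=> 0) a b) //; last exact: pc_const.
by rewrite RInt_const /scal /= /mult /=; ring.
Qed.

Lemma pc_RInt_support f a b u v : pc n f -> a <= u -> u <= v -> v <= b ->
  (forall x, off n x -> a < x < u -> f x = 0) ->
  (forall x, off n x -> v < x < b -> f x = 0) -> RInt f a b = RInt f u v.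
Proof.
move=> pf au uv vb fu fv.
rewrite -(@pc_RInt_Chasles f a u b) // -(@pc_RInt_Chasles f u v b) //.
rewrite (@pc_RInt_eq0 f a u) // (@pc_RInt_eq0 f v b) //; lra.
Qed.

(** The bound involves the width of the support, not of the interval: this is the source of the
    factors 1/n. *)
Lemma pc_RInt_bound f M a b u v y : pc n f -> a <= u -> u <= v -> v <= b ->
  (forall x, off n x -> a < x < u -> f x = 0) ->
  (forall x, off n x -> v < x < b -> f x = 0) ->
  (forall x, off n x -> a < x < b -> Rabs (f x) <= M) ->
  a <= y <= b -> Rabs (RInt f a y) <= M * (v - u).
Proof.
move=> pf au uv vb fu fv fM hy; have pa := pc_abs pf.
apply: Rle_trans (pc_RInt_abs_le pf _) _; first lra.
have h0 : 0 <= RInt (fun x => Rabs (f x)) y b.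
  have -> : 0 = RInt (fun=> 0) y b by rewrite RInt_const /scal /= /mult /=; lra.
  by apply: pc_RInt_le (pc_const _ _) _ _ _ => // [|x _ _]; [lra|apply: Rabs_pos].
have <- : RInt (fun=> M) u v = M * (v - u).
  by rewrite RInt_const /scal /= /mult /=; lra.
have := @pc_RInt_Chasles _ a y b pa.
rewrite (@pc_RInt_support _ a b u v pa) //; last first.
- by move=> x ox hx; rewrite fv // Rabs_R0.
- by move=> x ox hx; rewrite fu // Rabs_R0.
have : RInt (fun x => Rabs (f x)) u v <= RInt (fun=> M) u v.
  by apply: pc_RInt_le (pc_const _ _) _ _ => // x ox hx; apply: fM => //; lra.
lra.
Qed.

End pc_integral.

Local Arguments cardB : simpl never.

(** * Cardinal B-splines *)

Ltac ringR := match goal with |- @eq _ ?a ?b => change (@eq R a b) end; ring.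
Ltac fieldR := match goal with |- @eq _ ?a ?b => change (@eq R a b) end; field.

Lemma pc_comp_reflect f (j : Z) : pc 1 f -> pc 1 (fun x => f (IZR j - x)).
Proof.
move=> pf k; have [g cg hg] := pf (j - k - 1)%stdZ.
exists (fun x => g (IZR j - x)) => [x|x hx].
  apply: (continuous_comp (fun x => IZR j - x) g); last exact: cg.
  by apply: continuous_minus; [apply: continuous_const|apply: continuous_id].
rewrite hg // !minus_IZR; simpl in hx; simpl; lra.
Qed.

Lemma RInt_shift f a b v : pc 1 f -> RInt (fun x => f (x + v)) a b = RInt f (a + v) (b + v).
Proof.
move=> pf; have := @RInt_comp_lin _ f 1 v a b.
rewrite !Rmult_1_l => <-; last exact: (pc_ex_RInt (n := 1)).
by apply: RInt_ext => x _; rewrite /scal /= /mult /= !Rmult_1_l.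
Qed.

Lemma off_shift (j : Z) x : off 1 x -> off 1 (x + IZR j).
Proof. by move=> ox k hk; apply: (ox (k - j)%stdZ); rewrite minus_IZR -hk /=; lra. Qed.

Lemma off_shift1 x : off 1 x -> off 1 (x - 1).
Proof. exact: (@off_shift (-1)%stdZ). Qed.

Lemma off_reflect (j : Z) x : off 1 x -> off 1 (IZR j - x).
Proof. by move=> ox k hk; apply: (ox (j - k)%stdZ); rewrite minus_IZR -hk /=; lra. Qed.

Lemma cardB0E t : cardB 0 t = if Rle_dec 0 t then if Rlt_dec t 1 then 1 else 0 else 0.
Proof.
rewrite /cardB; case: Rle_dec => h /=; last by case: RleP => [/h|].
move/RleP: (h) => ->; case: Rlt_dec => h1 /=; first by move/RltP: (h1) => ->.
by case: RltP => [/h1|].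
Qed.

Lemma cardBS q t : cardB q.+1 t =
  (t * cardB q t + (INR q + 2 - t) * cardB q (t - 1)) / (INR q + 1).
Proof.
have h : 0 < INR q + 1 by have := pos_INR q; lra.
have -> : cardB q.+1 t = t / INR q.+1 * cardB q t
   + (INR q.+2 - t) / INR q.+1 * cardB q (t - 1) by rewrite !INRE.
rewrite !S_INR; field; lra.
Qed.

Lemma cardB_lt0 q t : t < 0 -> cardB q t = 0.
Proof.
elim: q t => [|q IH] t h; first by rewrite cardB0E; case: Rle_dec => // ?; lra.
by rewrite cardBS !IH; [rewrite /Rdiv; ring|lra|lra].
Qed.

Lemma cardB_le0 q t : t <= 0 -> cardB q.+1 t = 0.
Proof.
move=> h; rewrite cardBS [cardB q (t - 1)]cardB_lt0; last lra.
case: (Req_dec t 0) => [->|?]; first by rewrite /Rdiv; ring.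
by rewrite cardB_lt0; [rewrite /Rdiv; ring|lra].
Qed.

Lemma cardB_pc q : pc 1 (cardB q).
Proof.
elim: q => [|q IH].
  move=> k; exists (fun=> if Z.eq_dec k 0 then 1 else 0) => [x|x [h1 h2]].
    exact: continuous_const.
  simpl INR in h1, h2; rewrite cardB0E; case: Z.eq_dec => hk /=.
    rewrite hk in h1 h2; by case: Rle_dec => ? /=; try case: Rlt_dec => ? /=; lra.
  case: Rle_dec => // h3; case: Rlt_dec => // h4; case: hk.
  have a1 : IZR k < 1 by lra.
  have a2 : 0 < IZR (k + 1) by rewrite plus_IZR; lra.
  have := lt_IZR _ _ a1; have := lt_IZR _ _ a2; lia.
apply: (@pc_ext _ (fun t => (t * cardB q t + (INR q + 2 - t) * cardB q (t - 1)) / (INR q + 1))).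
  by move=> x _; rewrite cardBS.
apply: pc_div; apply: pc_plus; apply: pc_mult.
- by apply: pc_of_continuous => x; apply: continuous_id.
- exact: IH.
- apply: pc_of_continuous => x; apply: continuous_minus; last exact: continuous_id.
  exact: continuous_const.
- apply: (@pc_ext _ (fun t => cardB q (t + IZR (-1) / INR 1))).
    by move=> x _; congr (cardB q); simpl; lra.
  exact: pc_comp_shift.
Qed.

Lemma cardB1E t : cardB 1 t = Rmax 0 (Rmin t (2 - t)).
Proof.
have e : INR 0 + 1 = 1 by simpl; ring.
rewrite cardBS !cardB0E e Rdiv_1_r /=.
rewrite /Rmin; case: (Rle_dec t (2 - t)) => ? /=; rewrite /Rmax; repeat (case: Rle_dec => ? /=); repeat (case: Rlt_dec => ? /=); lra.
Qed.

Lemma continuous_Rmax2 (f g : R -> R) x :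
  continuous f x -> continuous g x -> continuous (fun y => Rmax (f y) (g y)) x.
Proof.
move=> cf cg.
apply: (continuous_ext (fun y => (f y + g y + Rabs (f y - g y)) / 2)).
  by move=> y; rewrite /Rmax; case: Rle_dec => h /=; [rewrite Rabs_left1|rewrite Rabs_pos_eq]; lra.
apply: (@continuous_mult _ _ (fun y => f y + g y + Rabs (f y - g y)) (fun=> / 2)); last exact: continuous_const.
apply: continuous_plus; first exact: continuous_plus.
apply: (continuous_comp (fun y => f y - g y) Rabs); last exact: continuous_Rabs.
exact: continuous_minus.
Qed.

Lemma continuous_Rmin2 (f g : R -> R) x :
  continuous f x -> continuous g x -> continuous (fun y => Rmin (f y) (g y)) x.
Proof.
move=> cf cg.
apply: (continuous_ext (fun y => - Rmax (- f y) (- g y))).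
  by move=> y; rewrite -Ropp_Rmin Ropp_involutive.
by apply: continuous_opp; apply: continuous_Rmax2; apply: continuous_opp.
Qed.

Lemma cardB_continuous q t : continuous (cardB q.+1) t.
Proof.
elim: q t => [|q IH] t.
  apply: (continuous_ext (fun t => Rmax 0 (Rmin t (2 - t)))) => [x|]; first by rewrite cardB1E.
  apply: continuous_Rmax2; first exact: continuous_const.
  apply: continuous_Rmin2; first exact: continuous_id.
  by apply: continuous_minus; [apply: continuous_const|apply: continuous_id].
apply: (continuous_ext (fun t => (t * cardB q.+1 t + (INR q.+1 + 2 - t) * cardB q.+1 (t - 1)) / (INR q.+1 + 1))).
  by move=> x; rewrite [RHS]cardBS.
apply: (@continuous_mult _ _ (fun t => t * cardB q.+1 t + (INR q.+1 + 2 - t) * cardB q.+1 (t - 1)) (fun=> / (INR q.+1 + 1))); last exact: continuous_const.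
apply: continuous_plus; apply: continuous_mult.
- exact: continuous_id.
- exact: IH.
- by apply: continuous_minus; [apply: continuous_const|apply: continuous_id].
- apply: (continuous_comp (fun t => t - 1)); last exact: IH.
  by apply: continuous_minus; [apply: continuous_id|apply: continuous_const].
Qed.

Lemma is_derive_eq (f : R -> R) (x l l' : R) : is_derive f x l -> l = l' -> is_derive f x l'.
Proof. by move=> ? <-. Qed.

Lemma is_derive_de_boor (f : R -> R) c t l1 l2 :
  is_derive f t l1 -> is_derive f (t - 1) l2 ->
  is_derive (fun s => s * f s + (c - s) * f (s - 1)) t
    (f t + t * l1 - f (t - 1) + (c - t) * l2).
Proof.
move=> e1 e2; auto_derive.
  by repeat split; eexists; first [exact: e1|exact: e2].
have u1 := is_derive_unique _ _ _ e1; have u2 := is_derive_unique _ _ _ e2.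
rewrite /Rminus in u2 *; rewrite u1 u2; ring.
Qed.

(** Differentiating the recursion leaves degree q splines at t, t - 1 and t - 2, which the recursion
    one degree lower recombines. The jumps of degree 0 confine the statement to non-integers. *)
Lemma cardB_derive_off q t : off 1 t ->
  is_derive (cardB q.+1) t (cardB q t - cardB q (t - 1)).
Proof.
elim: q t => [|q IH] t ot.
  have d0 s : off 1 s -> is_derive (cardB 0) s 0.
    move=> os; have [k hk] := off_cell os.
    apply: (is_derive_ext_loc (fun=> cardB 0 s)); last exact: is_derive_const.
    have := locally_cell hk; apply: filter_imp => y hy.
    have lt0 (u : R) : IZR k < INR 1 * u < IZR k + 1 -> cardB 0 u = if Z.eq_dec k 0 then 1 else 0.
      move=> [h1 h2]; simpl in h1, h2; rewrite cardB0E; case: Z.eq_dec => hk0 /=.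
        by rewrite hk0 in h1 h2; case: Rle_dec => ? /=; try case: Rlt_dec => ? /=; lra.
      case: Rle_dec => // h3; case: Rlt_dec => // h4; case: hk0.
      have a1 : IZR k < 1 by lra.
      have a2 : 0 < IZR (k + 1) by rewrite plus_IZR; lra.
      have := lt_IZR _ _ a1; have := lt_IZR _ _ a2; lia.
    by rewrite !lt0.
  apply: (is_derive_ext (fun t => (t * cardB 0 t + (2 - t) * cardB 0 (t - 1)))).
    by move=> x; rewrite [RHS]cardBS /=; field.
  have e1 := d0 t ot; have e2 := d0 (t - 1) (off_shift1 ot).
  refine (is_derive_eq (is_derive_de_boor 2 e1 e2) _); ring.
apply: (is_derive_ext (fun t => (t * cardB q.+1 t + (INR q.+1 + 2 - t) * cardB q.+1 (t - 1)) / (INR q.+1 + 1))).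
  by move=> x; rewrite [RHS]cardBS.
have e1 := IH t ot; have e2 := IH (t - 1) (off_shift1 ot).
have h := pos_INR q.
apply: (is_derive_ext (fun t => / (INR q.+1 + 1) * (t * cardB q.+1 t + (INR q.+1 + 2 - t) * cardB q.+1 (t - 1)))).
  by move=> s; rewrite /Rdiv Rmult_comm.
refine (is_derive_eq (is_derive_scal _ _ (/ (INR q.+1 + 1)) _ (is_derive_de_boor (INR q.+1 + 2) e1 e2)) _).
by rewrite !(cardBS q) S_INR; field; lra.
Qed.

Lemma RInt_cardB_le0 q y : y <= 0 -> RInt (cardB q) 0 y = 0.
Proof.
move=> hy; have pq := cardB_pc q.
rewrite (pc_RInt_swap (n := 1) isT y 0 pq) (@pc_RInt_eq0 1) //; first ringR.
by move=> x _ hx; rewrite cardB_lt0 //; lra.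
Qed.

(** The integral form of the recursion; the spline recurrence reduces to it on interior knots. *)
Lemma cardB_RInt q t : cardB q.+1 t = RInt (cardB q) 0 t - RInt (cardB q) 0 (t - 1).
Proof.
have pq := cardB_pc q.
have ps : pc 1 (fun t => cardB q (t + -1)).
  apply: (@pc_ext _ (fun t => cardB q (t + IZR (-1) / INR 1))).
    by move=> x _; congr (cardB q); simpl; lra.
  exact: pc_comp_shift.
have := @pc_FTC 1 isT (fun t => cardB q t - cardB q (t + -1)) (cardB q.+1) 0 t.
rewrite (@cardB_le0 q 0) ?Rminus_0_r; last lra.
move=> <-; last first.
- exact: cardB_derive_off.
- exact: cardB_continuous.
- exact: pc_minus.
rewrite (pc_RInt_minus (n := 1)) //; congr (_ - _).
rewrite (RInt_shift _ _ _ pq).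
rewrite -(@pc_RInt_Chasles 1 isT _ (0 + -1) 0 (t + -1) pq).
rewrite (pc_RInt_swap (n := 1) isT 0 (0 + -1) pq).
rewrite (@RInt_cardB_le0 q (0 + -1)) ; last lra.
rewrite Ropp_0 Rplus_0_l; congr (RInt _ 0 _); lra.
Qed.

(** From degree 2 on the integrand in [cardB_RInt] is continuous, so integers are no longer
    excluded. *)
Lemma cardB_derive q t :
  is_derive (cardB q.+2) t (cardB q.+1 t - cardB q.+1 (t - 1)).
Proof.
have pq := cardB_pc q.+1.
have d s : is_derive (fun y => RInt (cardB q.+1) 0 y) s (cardB q.+1 s).
  apply: (is_derive_RInt _ _ 0 s); last exact: cardB_continuous.
  by apply: filter_forall => y; apply: RInt_correct; apply: (pc_ex_RInt (n := 1)).
apply: (is_derive_ext (fun t => RInt (cardB q.+1) 0 t - RInt (cardB q.+1) 0 (t - 1))).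
  by move=> x; rewrite cardB_RInt.
apply: is_derive_minus; first exact: d.
have := @is_derive_comp _ _ (fun y => RInt (cardB q.+1) 0 y) (fun t => t - 1) t _ 1 (d (t - 1)).
rewrite /scal /= /mult /= Rmult_1_l; apply.
by auto_derive => //; ring.
Qed.

(** Since 2p + 1 is at least 3, both derivatives exist everywhere and [Derive_n] has no default
    value here. *)
Lemma cardB_Derive_n2 p x : (0 < p)%N -> Derive_n (cardB (2 * p + 1)) 2 x =
  cardB (2 * p - 1) x - 2 * cardB (2 * p - 1) (x - 1) + cardB (2 * p - 1) (x - 2).
Proof.
case: p => // p _; have -> : (2 * p.+1 + 1 = (2 * p).+3)%N by lia.
have -> : (2 * p.+1 - 1 = (2 * p).+1)%N by lia.
rewrite /= -/(cardB (2 * p).+2).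
rewrite (Derive_ext _ (fun t => cardB (2 * p).+2 t - cardB (2 * p).+2 (t - 1))); last first.
  by move=> t; apply: is_derive_unique; apply: cardB_derive.
apply: is_derive_unique.
have e1 := cardB_derive (2 * p) x; have e2 := cardB_derive (2 * p) (x - 1).
have -> : cardB (2 * p).+1 x - 2 * cardB (2 * p).+1 (x - 1) + cardB (2 * p).+1 (x - 2) =
  (cardB (2 * p).+1 x - cardB (2 * p).+1 (x - 1)) - (cardB (2 * p).+1 (x - 1) - cardB (2 * p).+1 (x - 1 - 1)).
  by rewrite (_ : x - 2 = x - 1 - 1); ring.
apply: is_derive_minus => //.
have := @is_derive_comp _ _ (cardB (2 * p).+2) (fun t => t - 1) x _ 1 e2.
rewrite /scal /= /mult /= Rmult_1_l; apply.
by auto_derive => //; ring.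
Qed.

Lemma cardB_sym q t : cardB q.+1 (INR q + 2 - t) = cardB q.+1 t.
Proof.
elim: q t => [|q IH] t.
  by rewrite !cardB1E /=; f_equal; rewrite Rmin_comm; f_equal; lra.
rewrite !(cardBS q.+1) -(IH t) -(IH (t - 1)) S_INR.
have -> : INR q + 1 + 2 - t - 1 = INR q + 2 - t by ring.
have -> : INR q + 2 - (t - 1) = INR q + 1 + 2 - t by ring.
by congr Rdiv; ring.
Qed.

(** In degree 0 the half-open indicator breaks the symmetry at 0 and 1. *)
Lemma cardB_sym_off q t : off 1 t -> cardB q (INR q + 1 - t) = cardB q t.
Proof.
case: q => [|q] ot; last by rewrite S_INR -(cardB_sym q t); congr cardB; ring.
rewrite !cardB0E /=.
have := ot 0%stdZ; have := ot 1%stdZ; rewrite /= => h1 h2.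
by repeat (case: Rle_dec => ? /=); repeat (case: Rlt_dec => ? /=); lra.
Qed.

(* x is an integer so that the jumps of cardB q (x - t) stay on the grid. *)
Lemma cardB_conv p q (x : Z) B : 0 <= B -> IZR x <= B ->
  RInt (fun t => cardB p t * cardB q (IZR x - t)) 0 B = cardB (p + q).+1 (IZR x).
Proof.
move=> B0 xB; elim: q p => [|q IH] p.
  rewrite addn0; have pp := cardB_pc p; have p0 := pc_comp_reflect x (cardB_pc 0).
  have [x0|x1] := Z_le_gt_dec x 0.
    have {}x0 := IZR_le _ _ x0.
    rewrite cardB_le0 // (@pc_RInt_eq0 1) //.
    - exact: pc_mult.
    - by move=> t _ ht; rewrite (@cardB_lt0 0); [ring|lra].
  have {}x1 : 1 <= IZR x by apply: IZR_le; lia.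
  rewrite (@pc_RInt_support 1 isT _ 0 B (IZR x - 1) (IZR x)) //; try lra.
  - rewrite cardB_RInt.
    rewrite (@pc_RInt_ext_open 1 isT _ (cardB p)) //; [|exact: pc_mult|lra|].
      by have := @pc_RInt_Chasles 1 isT _ 0 (IZR x - 1) (IZR x) pp; lra.
    move=> t _ ht; rewrite cardB0E; case: Rle_dec => ? /=; try case: Rlt_dec => ? /=; lra.
  - exact: pc_mult.
  - by move=> t _ ht; rewrite cardB0E; case: Rle_dec => ? /=; try case: Rlt_dec => ? /=; lra.
  - by move=> t _ ht; rewrite cardB0E; case: Rle_dec => ? /=; try case: Rlt_dec => ? /=; lra.
rewrite addnS -addSn -IH.
have pp := cardB_pc p; have pq := cardB_pc q.
pose F t := RInt (cardB p) 0 t.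
have cF t : continuous F t by apply: (pc_continuous_RInt (n := 1)).
have cG t : continuous (fun t => cardB q.+1 (IZR x - t)) t.
  apply: (continuous_comp (fun t => IZR x - t)); last exact: cardB_continuous.
  by apply: continuous_minus; [apply: continuous_const|apply: continuous_id].
have pF := pc_of_continuous 1 cF; have pG := pc_of_continuous 1 cG.
have cF1 t : continuous (fun t => F (t - 1)) t.
  apply: (continuous_comp (fun t => t - 1)); last exact: cF.
  by apply: continuous_minus; [apply: continuous_id|apply: continuous_const].
have pF1 := pc_of_continuous 1 cF1.
have p1 := pc_comp_reflect x pq; have p2 := pc_comp_reflect (x - 1) pq.
(* Integration by parts with F a primitive of [cardB p]: one degree passes from the second factor to
   the first. Boundary terms vanish because F is 0 at 0 and x - B <= 0. *)
have := @pc_FTC 1 isT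
  (fun t => cardB p t * cardB q.+1 (IZR x - t) +
     (F t * cardB q (IZR (x - 1) - t) - F t * cardB q (IZR x - t)))
  (fun t => F t * cardB q.+1 (IZR x - t)) 0 B.
rewrite /F RInt_point [cardB q.+1 (IZR x - B)]cardB_le0; last lra.
rewrite -/(F B) /zero /= => h.
have {h} : RInt (fun t => cardB p t * cardB q.+1 (IZR x - t) +
     (F t * cardB q (IZR (x - 1) - t) - F t * cardB q (IZR x - t))) 0 B = 0.
  rewrite h; first ringR.
  - by apply: pc_plus; [apply: pc_mult|apply: pc_minus; apply: pc_mult].
  - by move=> t; apply: continuous_mult.
  - move=> t ot.
    have e1 := pc_derive_RInt (n := 1) isT 0 pp ot.
    have e2 := cardB_derive_off q (@off_reflect x t ot).
    have e3 : is_derive (fun t => cardB q.+1 (IZR x - t)) t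
        (-1 * (cardB q (IZR x - t) - cardB q (IZR x - t - 1))).
      apply: (@is_derive_comp _ _ (cardB q.+1) (fun t => IZR x - t) t _ (-1) e2).
      by auto_derive => //; ring.
    refine (is_derive_eq (@is_derive_mult _ F (fun t => cardB q.+1 (IZR x - t)) t _ _ e1 e3 Rmult_comm) _).
    rewrite /plus /= /mult /= minus_IZR.
    have -> : IZR x - 1 - t = IZR x - t - 1 by ring.
    by rewrite -/(F t); ring.
rewrite (pc_RInt_plus (n := 1)) //; [|exact: pc_mult|by apply: pc_minus; apply: pc_mult].
rewrite (pc_RInt_minus (n := 1)) //; [|exact: pc_mult..].
(* Translating the variable moves the unit shift onto F; the strips [0, 1] and [B, B + 1] contribute
   nothing. *)
have -> : RInt (fun t => F t * cardB q (IZR (x - 1) - t)) 0 B =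
          RInt (fun t => F (t - 1) * cardB q (IZR x - t)) 0 B.
  have p3 : pc 1 (fun t => F (t - 1) * cardB q (IZR x - t)) by apply: pc_mult.
  have z1 : RInt (fun t => F (t - 1) * cardB q (IZR x - t)) 0 1 = 0.
    rewrite (@pc_RInt_eq0 1) //; first lra.
    by move=> t _ ht; rewrite /F RInt_cardB_le0; [ring|lra].
  have z2 : RInt (fun t => F (t - 1) * cardB q (IZR x - t)) B (B + 1) = 0.
    rewrite (@pc_RInt_eq0 1) //; first lra.
    by move=> t _ ht; rewrite (@cardB_lt0 q); [ring|lra].
  have := RInt_shift 0 B 1 p3.
  have := @pc_RInt_Chasles 1 isT _ 0 1 (B + 1) p3.
  have := @pc_RInt_Chasles 1 isT _ 0 B (B + 1) p3.
  rewrite Rplus_0_l z1 z2 => a1 a2 a3.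
  rewrite -[RHS]Rplus_0_r a1 -a2 Rplus_0_l -a3.
  apply: RInt_ext => t _; rewrite minus_IZR.
  by congr (_ * _); [congr F; ring|congr cardB; ring].
have -> : RInt (fun t => cardB p.+1 t * cardB q (IZR x - t)) 0 B =
  RInt (fun t => F t * cardB q (IZR x - t)) 0 B - RInt (fun t => F (t - 1) * cardB q (IZR x - t)) 0 B.
  rewrite -(pc_RInt_minus (n := 1)) //; [|exact: pc_mult..].
  by apply: RInt_ext => t _; rewrite cardB_RInt /F; ringR.
lra.
Qed.

(** Reflecting one factor by symmetry turns the inner product of two shifts into a convolution at an
    integer. *)
Lemma cardB_gram q (k : Z) B : 0 <= B -> INR q + 1 - IZR k <= B ->
  RInt (fun t => cardB q t * cardB q (t + IZR k)) 0 B = cardB (2 * q + 1) (INR q + 1 - IZR k).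
Proof.
move=> B0 hB; have e : IZR (Z.of_nat q + 1 - k) = INR q + 1 - IZR k.
  by rewrite minus_IZR plus_IZR -INR_IZR_INZ.
rewrite mul2n -addnn addn1 -e -(@cardB_conv q q _ B) ?e //.
have sh : pc 1 (fun t => cardB q (t + IZR k / INR 1)) by apply: pc_comp_shift => //; apply: cardB_pc.
apply: (pc_RInt_ext (n := 1)) => //.
  apply: pc_mult; first exact: cardB_pc.
  by apply: pc_ext sh => x _; congr cardB; simpl; lra.
move=> t ot; congr (_ * _).
rewrite -(cardB_sym_off q (@off_shift k t ot)); congr cardB; ring.
Qed.

(** * Polynomial splines on arbitrary knots *)

Definition step01 (a x : R) : R := if Rle_dec a x then 1 else 0.

(* The integrals in [GBaux], with its convention of a Dirac mass on degenerate supports; [dens] is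
   the derivative off the grid. *)
Definition cdf (s : nat -> R) (f : R -> R) (d i : nat) (x : R) : R :=
  if Rle_dec (s (i + d)%N) (s i) then step01 (s i) x
  else RInt f 0 x / RInt f 0 1.

Definition dens (s : nat -> R) (f : R -> R) (d i : nat) (x : R) : R :=
  if Rle_dec (s (i + d)%N) (s i) then 0 else f x / RInt f 0 1.

(** Polynomial B-splines through the very recurrence of [GBaux], so that closeness passes from one
    degree to the next. The start is the indicator, hence [GBaux] at stage q corresponds to
    [pspline] at q + 1. *)
Fixpoint pspline (s : nat -> R) (q i : nat) : R -> R :=
  match q with
  | 0%N => fun x => step01 (s i) x - step01 (s i.+1) x
  | q'.+1 => fun x => cdf s (pspline s q' i) q'.+1 i x
                      - cdf s (pspline s q' i.+1) q'.+1 i.+1 x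
  end.

(* The complete homogeneous symmetric polynomial of degree k in s i, ..., s (i + r). *)
Fixpoint chom (s : nat -> R) (i r k : nat) {struct r} : R :=
  match r with
  | 0%N => s i ^ k
  | r'.+1 => (fix g k := match k with
      | 0%N => 1
      | k'.+1 => chom s i r' k'.+1 + s (i + r)%N * g k' end) k
  end.

Section complete_homogeneous.
Variable s : nat -> R.

Lemma chom0 i r : chom s i r 0 = 1. Proof. by case: r. Qed.

Lemma chomSS i r k : chom s i r.+1 k.+1 = chom s i r k.+1 + s (i + r.+1)%N * chom s i r.+1 k.
Proof. by []. Qed.

Lemma chomSS_left i r k : chom s i r.+1 k.+1 = chom s i.+1 r k.+1 + s i * chom s i r.+1 k.
Proof.
elim: r k => [|r IHr]; elim=> [|k IHk].
- by rewrite chomSS !chom0 /= addn1; ring.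
- by rewrite chomSS {1}IHk chomSS /= addn1; ring.
- by rewrite (chomSS i r.+1) IHr (chomSS i.+1 r 0) !chom0 addSnnS; ring.
- rewrite chomSS {1}IHk IHr (chomSS i.+1 r k.+1) (chomSS i r.+1 k) addSnnS; ring.
Qed.

(** The same polynomial results from splitting off the last knot or the first; subtracting both
    recursions gives this divided-difference identity, which matches the difference of two
    consecutive terms in the spline recurrence. *)
Lemma chom_diff i r k : chom s i.+1 r k.+1 - chom s i r k.+1
  = (s (i + r.+1)%N - s i) * chom s i r.+1 k.
Proof. by have := chomSS_left i r k; rewrite chomSS; lra. Qed.

(** The binomial counts the monomials of degree k in r + 1 variables. This handles degenerate
    supports, whose knots all coincide. *)
Lemma chom_const i r k a : (forall j, (j <= r)%N -> s (i + j)%N = a) ->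
  chom s i r k = INR 'C(k + r, r) * a ^ k.
Proof.
elim: r k => [|r IHr] k h.
  by rewrite bin0 /= -(h 0%N) ?addn0 //; ring.
elim: k => [|k IHk]; first by rewrite chom0 add0n binn /=; ring.
rewrite chomSS IHk h // IHr; last by move=> j hj; apply: h; lia.
have -> : 'C(k.+1 + r.+1, r.+1) = ('C(k.+1 + r, r) + 'C(k + r.+1, r.+1))%N.
  by rewrite addSn binS addnC addSnnS.
by rewrite plus_INR /=; ring.
Qed.
End complete_homogeneous.

Section knots.
Variables (n : nat) (kap : nat -> nat).
Hypothesis n0 : (0 < n)%N.
Hypothesis kap_mono : forall i, (kap i <= kap i.+1)%N.
Hypothesis kap_step : forall i, (kap i.+1 <= (kap i).+1)%N.
Hypothesis kap_n : forall i, (kap i <= n)%N.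
Let s i := INR (kap i) / INR n.

Let nn : 0 < INR n. Proof. by apply: lt_0_INR; apply/ltP. Qed.

Lemma kap_le i d : (kap i <= kap (i + d))%N.
Proof. by elim: d => [|d IH]; [rewrite addn0|rewrite addnS; have := kap_mono (i + d); lia]. Qed.

Lemma kap_leD i d : (kap (i + d) <= kap i + d)%N.
Proof. by elim: d => [|d IH]; [rewrite addn0; lia|rewrite addnS; have := kap_step (i + d); lia]. Qed.

Lemma knot_ge0 i : 0 <= s i.
Proof. by apply/Rle_div_r => //; rewrite Rmult_0_l; apply: pos_INR. Qed.

Lemma knot_le1 i : s i <= 1.
Proof. by apply/Rle_div_l => //; rewrite Rmult_1_l; apply/le_INR/leP. Qed.

Lemma knot_mono i d : s i <= s (i + d).
Proof.
apply: Rmult_le_compat_r; first by apply/Rlt_le/Rinv_0_lt_compat.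
by apply/le_INR/leP/kap_le.
Qed.

Lemma knot_monoS i : s i <= s i.+1.
Proof. by have := knot_mono i 1; rewrite addn1. Qed.

Lemma knot_width i d : s (i + d) - s i <= INR d / INR n.
Proof.
have -> : s (i + d) - s i = (INR (kap (i + d)) - INR (kap i)) / INR n by rewrite /s; field; lra.
apply: Rmult_le_compat_r; first by apply/Rlt_le/Rinv_0_lt_compat.
by have /leP/le_INR := kap_leD i d; rewrite plus_INR; lra.
Qed.

(** Distinct integer multiples of 1/n are at least 1/n apart. The lower bounds on the normalizing
    integrals rest on this. *)
Lemma knot_gap i d : s i < s (i + d) -> 1 / INR n <= s (i + d) - s i.
Proof.
move=> h; have -> : s (i + d) - s i = (INR (kap (i + d)) - INR (kap i)) / INR n by rewrite /s; field; lra.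
apply: Rmult_le_compat_r; first by apply/Rlt_le/Rinv_0_lt_compat.
have : INR (kap i) < INR (kap (i + d)).
  apply: (Rmult_lt_reg_r (/ INR n)) => //; exact: Rinv_0_lt_compat.
move=> /INR_lt h2; have : ((kap i).+1 <= kap (i + d))%N by apply/ltP.
by move=> /leP/le_INR; rewrite S_INR; lra.
Qed.

Lemma off_neq_knot x i : off n x -> x <> s i.
Proof.
move=> ox e; apply: (ox (Z.of_nat (kap i))); rewrite -INR_IZR_INZ e /s; field; lra.
Qed.

Lemma pc_step01 i : pc n (step01 (s i)).
Proof.
move=> k; exists (fun=> step01 (IZR (Z.of_nat (kap i))) (IZR k)) => [x|x [h1 h2]].
  exact: continuous_const.
have hs : INR n * s i = INR (kap i) by rewrite /s; field; lra.
rewrite /step01 -INR_IZR_INZ; case: Rle_dec => h /=; case: Rle_dec => h' //=.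
  have a : INR (kap i) < IZR k + 1 by nra.
  rewrite INR_IZR_INZ -plus_IZR in a; have := lt_IZR _ _ a => b.
  by case: h'; rewrite INR_IZR_INZ; apply: IZR_le; lia.
by case: h; nra.
Qed.

Lemma pc_cdf f d i : pc n f -> pc n (cdf s f d i).
Proof.
move=> pf; rewrite /cdf; case: Rle_dec => h /=; first exact: pc_step01.
by apply: pc_div; apply: pc_of_continuous => x; apply: (pc_continuous_RInt n0).
Qed.

Lemma pc_dens f d i : pc n f -> pc n (dens s f d i).
Proof.
by move=> pf; rewrite /dens; case: Rle_dec => h /=; [apply: pc_const|apply: pc_div].
Qed.

Lemma derive_cdf f d i x : pc n f -> off n x ->
  is_derive (cdf s f d i) x (dens s f d i x).
Proof.
move=> pf ox; rewrite /cdf /dens; case: Rle_dec => h /=.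
  have [k hk] := off_cell ox; have [g _ hg] := pc_step01 i k.
  have hs : INR n * s i = INR (kap i) by rewrite /s; field; lra.
  apply: (is_derive_ext_loc (fun=> step01 (s i) x)); last exact: is_derive_const.
  have lk := locally_cell hk; apply: filter_imp lk => y [y1 y2].
  have sx : s i <= x <-> INR (kap i) < IZR k + 1.
    split=> [|a]; first by nra.
    rewrite INR_IZR_INZ -plus_IZR in a; have b := lt_IZR _ _ a.
    have : INR (kap i) <= IZR k by rewrite INR_IZR_INZ; apply: IZR_le; lia.
    by nra.
  have sy : s i <= y <-> INR (kap i) < IZR k + 1.
    split=> [|a]; first by nra.
    rewrite INR_IZR_INZ -plus_IZR in a; have b := lt_IZR _ _ a.
    have : INR (kap i) <= IZR k by rewrite INR_IZR_INZ; apply: IZR_le; lia.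
    by nra.
  by rewrite /step01; case: Rle_dec => h1 /=; case: Rle_dec => h2 //=; exfalso; tauto.
apply: (is_derive_ext (fun y => / RInt f 0 1 * RInt f 0 y)).
  by move=> y; rewrite /Rdiv Rmult_comm.
rewrite /Rdiv Rmult_comm; apply: is_derive_scal.
exact: (pc_derive_RInt n0).
Qed.

Lemma pc_pspline q i : pc n (pspline s q i).
Proof.
by elim: q i => [|q IH] i; apply: pc_minus; (exact: pc_step01 || exact: pc_cdf).
Qed.

Lemma pc_pow k : pc n (fun x => x ^ k).
Proof.
apply: pc_of_continuous => x; apply: (@ex_derive_continuous _ _ (fun x => x ^ k)).
by auto_derive.
Qed.

Lemma RInt_pow k a b : RInt (fun x => x ^ k) a b = (b ^ k.+1 - a ^ k.+1) / (INR k + 1).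
Proof.
have h := pos_INR k.
have d x : is_derive (fun x => / (INR k + 1) * x ^ k.+1) x (x ^ k).
  refine (is_derive_eq (is_derive_scal _ _ (/ (INR k + 1)) _ (is_derive_pow _ k.+1 _ _ (is_derive_id x))) _).
  by rewrite S_INR /= /Hierarchy.one /=; field; lra.
rewrite (@pc_FTC n n0 _ (fun x => / (INR k + 1) * x ^ k.+1) a b (pc_pow k)).
- by fieldR; lra.
- by move=> x; apply: ex_derive_continuous; eexists; exact: d.
- by move=> x _.
Qed.

Lemma RInt_pow_step01 k i :
  RInt (fun x => x ^ k * (1 - step01 (s i) x)) 0 1 = s i ^ k.+1 / (INR k + 1).
Proof.
have s0 := knot_ge0 i; have s1 := knot_le1 i; have pk := pc_pow k.
have p : pc n (fun x => x ^ k * (1 - step01 (s i) x)).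
  by apply: pc_mult => //; apply: pc_minus; [apply: pc_const|apply: pc_step01].
rewrite (@pc_RInt_support n n0 _ 0 1 0 (s i) p) //; try lra.
- rewrite (@pc_RInt_ext_open n n0 _ (fun x => x ^ k)) //.
    by rewrite RInt_pow /=; congr Rdiv; ring.
  by move=> x _ hx; rewrite /step01; case: Rle_dec => h /=; [lra|ring].
- by move=> x _ hx; lra.
- by move=> x _ hx; rewrite /step01; case: Rle_dec => h /=; [ring|lra].
Qed.

Lemma RInt_pow_cdf k f d i : pc n f -> s i < s (i + d) -> RInt f 0 1 <> 0 ->
  RInt (fun x => x ^ k * (1 - cdf s f d i x)) 0 1
  = RInt (fun x => x ^ k.+1 * f x) 0 1 / RInt f 0 1 / (INR k + 1).
Proof.
move=> pf hi Z0; have hk := pos_INR k; have pk := pc_pow.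
have pc1 : pc n (fun x => x ^ k * (1 - cdf s f d i x)).
  by apply: pc_mult => //; apply: pc_minus; [apply: pc_const|apply: pc_cdf].
have pc2 : pc n (fun x => x ^ k.+1 * f x) by apply: pc_mult.
pose Z := RInt f 0 1.
(* This primitive vanishes at 0 through the power and at 1 through the normalization, so the
   integration by parts leaves no boundary term. *)
pose F x := x ^ k.+1 * (1 - RInt f 0 x / Z).
have := @pc_FTC n n0 (fun x => (INR k + 1) * (x ^ k * (1 - cdf s f d i x)) - / Z * (x ^ k.+1 * f x)) F 0 1.
rewrite (pc_RInt_minus n0) //; try exact: pc_scal.
have -> : F 1 - F 0 = 0.
  by rewrite /F -/Z pow1 /=; fieldR.
move=> h.
suff : (INR k + 1) * RInt (fun x => x ^ k * (1 - cdf s f d i x)) 0 1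
    - / Z * RInt (fun x => x ^ k.+1 * f x) 0 1 = 0.
  rewrite -/Z => e; apply: (Rmult_eq_reg_l (INR k + 1)); last lra.
  by rewrite (Rminus_diag_uniq _ _ e); field; split=> //; lra.
rewrite -(pc_RInt_scal n0 _ _ _ pc1) -(pc_RInt_scal n0 _ _ _ pc2); apply: h.
- by apply: pc_minus; apply: pc_scal.
- move=> x; apply: continuous_mult.
    by apply: (@ex_derive_continuous _ _ (fun x => x ^ k.+1)); auto_derive.
  apply: continuous_minus; first exact: continuous_const.
  apply: (@continuous_mult _ _ (fun x => RInt f 0 x) (fun=> / Z)); last exact: continuous_const.
  exact: (pc_continuous_RInt n0).
- move=> x ox; have e1 := pc_derive_RInt n0 0 pf ox.
  have e2 : is_derive (fun x => x ^ k.+1) x ((INR k + 1) * x ^ k).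
    refine (is_derive_eq (is_derive_pow _ k.+1 _ _ (is_derive_id x)) _).
    by rewrite S_INR /= /Hierarchy.one /=; ring.
  have e3 : is_derive (fun x => 1 - RInt f 0 x / Z) x (- (/ Z * f x)).
    apply: (is_derive_ext (fun x => 1 - / Z * RInt f 0 x)).
      by move=> y; rewrite /Rdiv (Rmult_comm (/ Z)).
    refine (is_derive_eq (is_derive_minus _ _ _ _ _ (is_derive_const 1 x) (is_derive_scal _ _ (/ Z) _ e1)) _).
    by rewrite /minus /Hierarchy.plus /Hierarchy.opp /Hierarchy.zero /=; ringR.
  refine (is_derive_eq (is_derive_mult _ _ _ _ _ e2 e3 Rmult_comm) _).
  rewrite /plus /= /mult /= /cdf; case: Rle_dec => h' /=; first lra.
  by rewrite -/Z; ringR.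
Qed.

(* Only k = 0 is needed, but the induction on q uses all moments: integrating by parts against a
   primitive raises the power of x. *)
Lemma pspline_moment q i k :
  RInt (fun x => x ^ k * pspline s q i x) 0 1 =
  (s (i + q.+1) - s i) * chom s i q.+1 k / (INR q.+1 * INR 'C(k + q.+1, k)).
Proof.
elim: q i k => [|q IH] i k.
  have hk := pos_INR k.
  have p j : pc n (fun x => x ^ k * (1 - step01 (s j) x)).
    by apply: pc_mult; [apply: pc_pow|apply: pc_minus; [apply: pc_const|apply: pc_step01]].
  rewrite (RInt_ext _ (fun x => x ^ k * (1 - step01 (s i.+1) x) - x ^ k * (1 - step01 (s i) x))); last first.
    by move=> x _ /=; ring.
  rewrite (pc_RInt_minus n0) // !RInt_pow_step01 -chom_diff addn1 binSn !S_INR.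
  by rewrite /chom (_ : INR 0 = 0) //; fieldR; lra.
have nz r : 0 < INR 'C(k + r, k).
  by apply: lt_0_INR; apply/ltP; rewrite bin_gt0; lia.
have ZE j : RInt (pspline s q j) 0 1 = (s (j + q.+1) - s j) / INR q.+1.
  have := IH j 0%N; rewrite chom0 bin0 /= Rmult_1_r Rmult_1_r => <-.
  by apply: RInt_ext => x _; rewrite Rmult_1_l.
have hq : 0 < INR q.+1 by apply: lt_0_INR; apply/ltP.
have hk := pos_INR k.
have nz2 : 0 < INR 'C(k.+1 + q.+1, k.+1).
  by apply: lt_0_INR; apply/ltP; rewrite bin_gt0; lia.
(* One formula covers proper and degenerate supports, so no case split remains when the two terms
   are subtracted. Working with 1 - [cdf] avoids a boundary term at 1. *)
have M j : RInt (fun x => x ^ k * (1 - cdf s (pspline s q j) q.+1 j x)) 0 1 =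
    chom s j q.+1 k.+1 / ((INR k + 1) * INR 'C(k.+1 + q.+1, k.+1)).
  case: (Rle_dec (s (j + q.+1)) (s j)) => h.
    rewrite (RInt_ext _ (fun x => x ^ k * (1 - step01 (s j) x))); last first.
      by move=> x _; rewrite /cdf; case: Rle_dec.
    rewrite RInt_pow_step01 (@chom_const s j q.+1 k.+1 (s j)).
      rewrite -(@bin_sub (k.+1 + q.+1) q.+1) ?addnK; last lia.
      by fieldR; lra.
    move=> r hr; apply: Rle_antisym; last exact: knot_mono.
    have := knot_mono (j + r) (q.+1 - r); rewrite -addnA subnKC //; lra.
  rewrite RInt_pow_cdf; [|exact: pc_pspline|lra|].
    by rewrite IH ZE; fieldR; repeat split; lra.
  rewrite ZE => e; apply: h; have := Rinv_0_lt_compat _ hq.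
  by case: (Rmult_integral _ _ e); lra.
have p j : pc n (fun x => x ^ k * (1 - cdf s (pspline s q j) q.+1 j x)).
  apply: pc_mult; first exact: pc_pow.
  by apply: pc_minus; [apply: pc_const|apply: pc_cdf; apply: pc_pspline].
rewrite (RInt_ext _ (fun x => x ^ k * (1 - cdf s (pspline s q i.+1) q.+1 i.+1 x)
   - x ^ k * (1 - cdf s (pspline s q i) q.+1 i x))); last first.
  by move=> x _ /=; ring.
rewrite (pc_RInt_minus n0) // !M.
(* A binomial absorption identity: it converts the normalization of degree q into that of degree q +
   1. *)
have e : (INR k + 1) * INR 'C(k.+1 + q.+1, k.+1) = INR q.+2 * INR 'C(k + q.+2, k).
  have h : (k.+1 * 'C(k.+1 + q.+1, k.+1) = q.+2 * 'C(k + q.+2, k))%N.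
    by rewrite addSnnS mul_bin_left; congr muln; lia.
  by rewrite -S_INR -!mult_INR; congr INR.
rewrite e -chom_diff; fieldR; split; first by have := nz q.+2; lra.
by rewrite S_INR; lra.
Qed.

Lemma pspline_RInt q i : RInt (pspline s q i) 0 1 = (s (i + q.+1) - s i) / INR q.+1.
Proof.
have := pspline_moment q i 0; rewrite chom0 bin0 /= Rmult_1_r Rmult_1_r => <-.
by apply: RInt_ext => x _; rewrite Rmult_1_l.
Qed.

End knots.

(** * Mean values of bounded uniformly continuous functions *)

(** A class stable under sums, products and composition with continuous functions, on which both
    iterated integrals exist and are linear. *)
Definition buc (f : R -> R -> R) : Prop :=
  (exists C, forall x y, Rabs (f x y) <= C) /\
  forall e, 0 < e -> exists2 d, 0 < d & forall x y u v,
    Rabs (x - u) <= d -> Rabs (y - v) <= d -> Rabs (f x y - f u v) <= e.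

Lemma buc_const c : buc (fun _ _ => c).
Proof.
split=> [|e e0]; first by exists (Rabs c) => _ _; lra.
by exists 1 => [|x y u v _ _]; [lra|rewrite Rminus_diag Rabs_R0; lra].
Qed.

Lemma buc_add f g : buc f -> buc g -> buc (fun x y => f x y + g x y).
Proof.
move=> [[C hC] uf] [[D hD] ug]; split=> [|e e0].
  exists (C + D) => x y; apply: Rle_trans (Rabs_triang _ _) _.
  by apply: Rplus_le_compat.
have [d d0 hd] := uf (e / 2) ltac:(lra); have [d' d'0 hd'] := ug (e / 2) ltac:(lra).
exists (Rmin d d') => [|x y u v h1 h2]; first exact: Rmin_pos.
have := Rmin_l d d'; have := Rmin_r d d' => m1 m2.
have a1 := hd x y u v ltac:(lra) ltac:(lra); have a2 := hd' x y u v ltac:(lra) ltac:(lra).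
have -> : f x y + g x y - (f u v + g u v) = (f x y - f u v) + (g x y - g u v) by ring.
by apply: Rle_trans (Rabs_triang _ _) _; lra.
Qed.

Lemma buc_mul f g : buc f -> buc g -> buc (fun x y => f x y * g x y).
Proof.
move=> [[C hC] uf] [[D hD] ug].
have C0 : 0 <= C by apply: Rle_trans (Rabs_pos _) (hC 0 0).
have D0 : 0 <= D by apply: Rle_trans (Rabs_pos _) (hD 0 0).
split=> [|e e0].
  exists (C * D) => x y; rewrite Rabs_mult; apply: Rmult_le_compat => //; exact: Rabs_pos.
have e1 : 0 < e / (2 * (C + 1)) by apply: Rdiv_lt_0_compat; lra.
have e2 : 0 < e / (2 * (D + 1)) by apply: Rdiv_lt_0_compat; lra.
have [d d0 hd] := uf _ e2; have [d' d'0 hd'] := ug _ e1.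
exists (Rmin d d') => [|x y u v h1 h2]; first exact: Rmin_pos.
have := Rmin_l d d'; have := Rmin_r d d' => m1 m2.
have a1 := hd x y u v ltac:(lra) ltac:(lra); have a2 := hd' x y u v ltac:(lra) ltac:(lra).
have -> : f x y * g x y - f u v * g u v = f x y * (g x y - g u v) + (f x y - f u v) * g u v by ring.
apply: Rle_trans (Rabs_triang _ _) _; rewrite !Rabs_mult.
have b1 : Rabs (f x y) * Rabs (g x y - g u v) <= (C + 1) * (e / (2 * (C + 1))).
  by apply: Rmult_le_compat => //; try exact: Rabs_pos; have := hC x y; lra.
have b2 : Rabs (f x y - f u v) * Rabs (g u v) <= e / (2 * (D + 1)) * (D + 1).
  by apply: Rmult_le_compat => //; try exact: Rabs_pos; have := hD u v; lra.
have c1 : (C + 1) * (e / (2 * (C + 1))) = e / 2 by field; lra.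
have c2 : e / (2 * (D + 1)) * (D + 1) = e / 2 by field; lra.
lra.
Qed.

Lemma Rabs_cos_diff a b : Rabs (cos a - cos b) <= Rabs (a - b).
Proof.
have [|x _|c [_ ->]] := MVT_gen cos b a (fun x => - sin x).
- by move=> x _; apply: is_derive_cos.
- by apply/continuity_pt_filterlim; apply: continuous_cos.
rewrite Rabs_mult Rabs_Ropp.
have : Rabs (sin c) <= 1 by apply: Rabs_le; apply: SIN_bound.
have := Rabs_pos (a - b); nra.
Qed.

Lemma buc_cos a b : buc (fun x y => cos (a * x + b * y)).
Proof.
split=> [|e e0]; first by exists 1 => x y; apply: Rabs_le; apply: COS_bound.
have p0 : 0 < Rabs a + Rabs b + 1 by have := Rabs_pos a; have := Rabs_pos b; lra.
exists (e / (Rabs a + Rabs b + 1)) => [|x y u v h1 h2]; first exact: Rdiv_lt_0_compat.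
apply: Rle_trans (Rabs_cos_diff _ _) _.
have -> : a * x + b * y - (a * u + b * v) = a * (x - u) + b * (y - v) by ring.
apply: Rle_trans (Rabs_triang _ _) _; rewrite !Rabs_mult.
have d0 : 0 < e / (Rabs a + Rabs b + 1) by apply: Rdiv_lt_0_compat.
have E : (Rabs a + Rabs b + 1) * (e / (Rabs a + Rabs b + 1)) = e by field; lra.
have := Rabs_pos a; have := Rabs_pos b; nra.
Qed.

Lemma buc_comp (F : R -> R) g : (forall x, continuous F x) -> buc g -> buc (fun x y => F (g x y)).
Proof.
move=> cF [[C hC] ug].
have C0 : 0 <= C by apply: Rle_trans (Rabs_pos _) (hC 0 0).
have gC x y : - C <= g x y <= C by apply/Rabs_le_between.
(* A dummy second variable fixed at 0 brings [F] into the form of [uniform_continuity_2d_1d], which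
   yields uniform continuity on [-C, C]. *)
have cF2 x : - C <= x <= C -> continuity_2d_pt (fun x _ => F x) x 0.
  move=> _; apply: continuity_1d_2d_pt_comp; last exact: continuity_2d_pt_id1.
  by apply/continuity_pt_filterlim; apply: cF.
have cFp x : - C <= x <= C -> continuity_pt F x by move=> _; apply/continuity_pt_filterlim; apply: cF.
split=> [|e e0].
  have [M [hM _]] := continuity_ab_maj F (- C) C ltac:(lra) cFp.
  have [m [hm _]] := continuity_ab_min F (- C) C ltac:(lra) cFp.
  exists (Rmax (Rabs (F M)) (Rabs (F m))) => x y.
  have h1 := hM _ (gC x y); have h2 := hm _ (gC x y).
  have := Rle_abs (F M); have := Rle_abs (- F m); rewrite Rabs_Ropp => a1 a2.
  have := Rmax_l (Rabs (F M)) (Rabs (F m)); have := Rmax_r (Rabs (F M)) (Rabs (F m)) => a3 a4.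
  by apply: Rabs_le; lra.
have [d hd] := uniform_continuity_2d_1d (fun x _ => F x) (- C) C 0 cF2 (mkposreal _ e0).
have [d' d'0 hd'] := ug (d / 2) ltac:(have := cond_pos d; lra).
exists d' => // x y u v h1 h2; have h3 := hd' x y u v h1 h2.
have p0 := cond_pos d.
rewrite Rabs_minus_sym; apply: Rlt_le; apply: (hd (g x y) 0 (g u v) 0) => //; try lra.
by rewrite Rabs_minus_sym; lra.
Qed.

(** Through [buc_comp], composing with this clamp gives a bound for a continuous function on
    [-C, C]. *)
Lemma buc_clamp C : buc (fun x _ => Rmax (- C) (Rmin C x)).
Proof.
split=> [|e e0].
  exists (Rabs C) => x _; rewrite /Rmin; case: Rle_dec => h /=; rewrite /Rmax; case: Rle_dec => h2 /=;
    have := Rle_abs C; have := Rle_abs (- C); rewrite Rabs_Ropp => ? ?; apply: Rabs_le; lra.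
exists e => // x y u v h _; apply: Rle_trans _ h.
have := Rle_abs (x - u); have := Rle_abs (- (x - u)); rewrite Rabs_Ropp => a1 a2.
have := Rabs_pos (x - u) => a3.
rewrite /Rmin; case: Rle_dec => h1 /=; case: Rle_dec => h2 /=;
  rewrite /Rmax; case: Rle_dec => h3 /=; try case: Rle_dec => h4 /=; apply: Rabs_le; lra.
Qed.

Lemma continuous_of_unif (f : R -> R) x : (forall e, 0 < e -> exists2 d, 0 < d &
   forall u, Rabs (u - x) <= d -> Rabs (f u - f x) <= e) -> continuous f x.
Proof.
move=> h; apply/filterlim_locally => e.
have [d d0 hd] := h (e / 2) ltac:(have := cond_pos e; lra).
exists (mkposreal _ d0) => y hy.
have : Rabs (f y - f x) <= e / 2 by apply: hd; apply: Rlt_le; exact: hy.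
by move=> h2; change (Rabs (f y - f x) < e); have := cond_pos e; lra.
Qed.

Definition iint (f : R -> R -> R) (x : R) : R := RInt (f x) (- PI) PI.
Definition dint (f : R -> R -> R) : R := RInt (iint f) (- PI) PI.

Lemma buc_ex_in f x : buc f -> ex_RInt (f x) (- PI) PI.
Proof.
move=> [_ uf]; apply: ex_RInt_continuous => y _; apply: continuous_of_unif => e e0.
have [d d0 hd] := uf e e0; exists d => // u hu; apply: hd => //.
by rewrite Rminus_diag Rabs_R0; lra.
Qed.

Lemma iint_bound f x e : ex_RInt (f x) (- PI) PI -> (forall y, Rabs (f x y) <= e) ->
  Rabs (iint f x) <= 2 * PI * e.
Proof.
have p0 := PI_RGT_0; move=> ef fe.
have := norm_RInt_le_const (f x) (- PI) PI (iint f x) e ltac:(lra).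
rewrite /norm /= /abs /= => h; have -> : 2 * PI * e = (PI - - PI) * e by ring.
by apply: h => [y _|]; [exact: fe|apply: RInt_correct].
Qed.

Lemma buc_ex_out f : buc f -> ex_RInt (iint f) (- PI) PI.
Proof.
have p0 := PI_RGT_0; move=> bf; have [_ uf] := bf.
apply: ex_RInt_continuous => x _; apply: continuous_of_unif => e e0.
have [d d0 hd] := uf (e / (2 * PI)) ltac:(apply: Rdiv_lt_0_compat; lra).
exists d => // u hu; have e1 := buc_ex_in u bf; have e2 := buc_ex_in x bf.
have -> : iint f u - iint f x = iint (fun _ y => f u y - f x y) 0.
  by rewrite /iint; apply/esym/(RInt_minus (f u) (f x)).
have -> : e = 2 * PI * (e / (2 * PI)) by field; lra.
apply: iint_bound; first exact: (ex_RInt_minus (f u) (f x)).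
by move=> y; apply: hd => //; rewrite Rminus_diag Rabs_R0; lra.
Qed.

Lemma dint_bound f e : buc f -> (forall x y, Rabs (f x y) <= e) ->
  Rabs (dint f) <= 4 * PI ^ 2 * e.
Proof.
have p0 := PI_RGT_0; move=> bf fe.
have := norm_RInt_le_const (iint f) (- PI) PI (dint f) (2 * PI * e) ltac:(lra).
rewrite /norm /= /abs /= => h.
have -> : 4 * (PI * (PI * 1)) * e = (PI - - PI) * (2 * PI * e) by ring.
apply: h => [x _|]; last by apply: RInt_correct; apply: buc_ex_out.
by apply: iint_bound => //; apply: buc_ex_in.
Qed.

Lemma dint_ext f g : (forall x y, f x y = g x y) -> dint f = dint g.
Proof. by move=> fg; apply: RInt_ext => x _; apply: RInt_ext => y _. Qed.

Lemma dint_add f g : buc f -> buc g -> dint (fun x y => f x y + g x y) = dint f + dint g.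
Proof.
move=> bf bg; rewrite -[RHS](RInt_plus (iint f) (iint g)); [|exact: buc_ex_out..].
by apply: RInt_ext => x _; apply: (RInt_plus (f x) (g x)); exact: buc_ex_in.
Qed.

Lemma dint_scal c f : buc f -> dint (fun x y => c * f x y) = c * dint f.
Proof.
move=> bf; rewrite -[RHS](RInt_scal (iint f)); last exact: buc_ex_out.
by apply: RInt_ext => x _; apply: (RInt_scal (f x)); exact: buc_ex_in.
Qed.

Lemma sin_int_PI (a : Z) : sin (IZR a * PI) = 0.
Proof. by apply: sin_eq_0_1; exists a. Qed.

Lemma RInt_cos (a : Z) c : a <> Z0 -> RInt (fun y => cos (c + IZR a * y)) (- PI) PI = 0.
Proof.
move=> a0; have na : IZR a <> 0 by apply: not_0_IZR.
have d y : is_derive (fun y => / IZR a * sin (c + IZR a * y)) y (cos (c + IZR a * y)).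
  by auto_derive => //; field.
have := is_RInt_derive (fun y => / IZR a * sin (c + IZR a * y)) _ (- PI) PI (fun y _ => d y).
move=> h; apply: is_RInt_unique.
have -> : 0 = minus (/ IZR a * sin (c + IZR a * PI)) (/ IZR a * sin (c + IZR a * - PI)).
  rewrite /minus /Hierarchy.plus /Hierarchy.opp /= !sin_plus.
  have -> : IZR a * - PI = - (IZR a * PI) by ring.
  by rewrite sin_neg cos_neg sin_int_PI; ring.
apply: h => y _.
apply: (continuous_comp (fun y => c + IZR a * y)); last exact: continuous_cos.
by apply: ex_derive_continuous; auto_derive.
Qed.

(** Orthogonality of the characters. A nonzero [b] already annihilates the inner integral, so it is
    treated first. *)
Lemma dint_cos (a b : Z) : dint (fun x y => cos (IZR a * x + IZR b * y)) =
  if Z.eq_dec a Z0 then if Z.eq_dec b Z0 then 4 * PI ^ 2 else 0 else 0.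
Proof.
rewrite /dint /iint; case: (Z.eq_dec b Z0) => hb.
  rewrite (RInt_ext _ (fun x => 2 * PI * cos (0 + IZR a * x))); last first.
    move=> x _; rewrite (RInt_ext _ (fun=> cos (0 + IZR a * x))).
      by rewrite RInt_const /scal /= /mult /=; ring.
    by move=> y _; rewrite hb; congr cos; ring.
  case: Z.eq_dec => ha /=.
    rewrite (RInt_ext _ (fun=> 2 * PI)); last first.
      by move=> x _; rewrite ha Rmult_0_l Rplus_0_l cos_0 Rmult_1_r.
    by rewrite RInt_const /scal /= /mult /=; ring.
  have ec : ex_RInt (fun x => cos (0 + IZR a * x)) (- PI) PI.
    apply: ex_RInt_continuous => y _.
    apply: (continuous_comp (fun y => 0 + IZR a * y)); last exact: continuous_cos.
    by apply: ex_derive_continuous; auto_derive.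
  have := RInt_scal _ (- PI) PI (2 * PI) ec; rewrite /scal /= /mult /= => ->.
  by rewrite RInt_cos // Rmult_0_r.
rewrite (RInt_ext _ (fun=> 0)); last by move=> x _; apply: RInt_cos.
by rewrite RInt_const /scal /= /mult /=; case: Z.eq_dec => ? /=; ring.
Qed.

Local Arguments INR : simpl never.
Local Arguments pow : simpl never.

(** * Perturbation of splines *)

(** Write a/zf - b/zl = (a - b)/zf + b (zl - zf)/(zf zl). In [close_cdf] all of al, be, de, z1 and
    z2 carry a factor 1/n, and these factors cancel. *)
Lemma quot_diff a b zf zl al be de z1 z2 :
  Rabs (a - b) <= al -> Rabs b <= be -> Rabs (zf - zl) <= de ->
  0 < z1 -> z1 <= zf -> 0 < z2 -> z2 <= zl ->
  Rabs (a / zf - b / zl) <= al / z1 + be * de / (z1 * z2).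
Proof.
move=> hab hb hz z10 hz1 z20 hz2.
have -> : a / zf - b / zl = (a - b) * / zf + b * (zl - zf) * (/ zf * / zl) by field; lra.
apply: Rle_trans (Rabs_triang _ _) _.
have i1 : 0 < / zf <= / z1.
  by split; [apply: Rinv_0_lt_compat; lra|apply: Rinv_le_contravar].
have i2 : 0 < / zl <= / z2.
  by split; [apply: Rinv_0_lt_compat; lra|apply: Rinv_le_contravar].
rewrite !Rabs_mult (Rabs_pos_eq (/ zf)) ?(Rabs_pos_eq (/ zl)); [|lra..].
have := Rabs_pos (a - b); have := Rabs_pos b; have := Rabs_pos (zl - zf).
rewrite (Rabs_minus_sym zl) => p1 p2 p3.
rewrite /Rdiv Rinv_mult; apply: Rplus_le_compat.
  by apply: Rmult_le_compat => //; lra.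
apply: Rmult_le_compat; [nra|nra| |nra].
by apply: Rmult_le_compat.
Qed.

Definition supported (s : nat -> R) (f : nat -> R -> R) (d : nat) : Prop :=
  forall i x, 0 < x < 1 -> x < s i \/ s (i + d)%N < x -> f i x = 0.

(** The square is the support width (q' + 1)/n divided by the lower bound 1/(n (q' + 1)) of the
    integral; the 1 accounts for degenerate supports and the 2 for the difference of two terms. What
    matters is independence of n and of the knots. *)
Fixpoint pspline_bound (q : nat) : R :=
  match q with
  | 0%N => 1
  | q'.+1 => 2 * (1 + pspline_bound q' * INR q'.+1 ^ 2)
  end.

(** The value of the bound in [quot_diff], per unit of error, for supports of width (q + 1)/n and
    integrals at least 1/(2 n (q + 1)) and 1/(n (q + 1)). *)
Definition close_cst (q : nat) : R :=
  2 * INR q.+1 ^ 2 + 2 * pspline_bound q * INR q.+1 ^ 4.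

Lemma pspline_bound_gt0 q : 0 < pspline_bound q.
Proof.
elim: q => [|q IH]; first by simpl; lra.
rewrite [pspline_bound _]/=; have := pow2_ge_0 (INR q.+1); nra.
Qed.

Lemma INR_ge1 q : 1 <= INR q.+1.
Proof. by rewrite S_INR; have := pos_INR q; lra. Qed.

Lemma close_cst_gt0 q : 0 < close_cst q.
Proof.
have h := pspline_bound_gt0 q; have h2 := INR_ge1 q.
have : 0 < INR q.+1 ^ 2 by apply: pow_lt; lra.
have : 0 < INR q.+1 ^ 4 by apply: pow_lt; lra.
rewrite /close_cst; nra.
Qed.

Section knots.
Variables (n : nat) (kap : nat -> nat).
Hypothesis n0 : (0 < n)%N.
Hypothesis kap_mono : forall i, (kap i <= kap i.+1)%N.
Hypothesis kap_step : forall i, (kap i.+1 <= (kap i).+1)%N.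
Hypothesis kap_n : forall i, (kap i <= n)%N.
Let s i := INR (kap i) / INR n.

Let nn : 0 < INR n. Proof. by apply: lt_0_INR; apply/ltP. Qed.
Let s_ge0 i : 0 <= s i. Proof. exact: knot_ge0. Qed.
Let s_le1 i : s i <= 1. Proof. exact: knot_le1. Qed.
Let s_mono i d : s i <= s (i + d)%N. Proof. exact: knot_mono. Qed.

Lemma cdf_left f d i x : pc n f -> (forall y, 0 < y < 1 -> y < s i -> f y = 0) ->
  0 < x < 1 -> x < s i -> cdf s f d i x = 0.
Proof.
move=> pf hf hx hi; rewrite /cdf; case: Rle_dec => h /=.
  by rewrite /step01; case: Rle_dec => //= h2; lra.
rewrite (@pc_RInt_eq0 n n0 f 0 x pf); [rewrite /Rdiv; ring|lra|].
by move=> y _ hy; apply: hf; lra.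
Qed.

Lemma cdf_right f d i x : pc n f ->
  (forall y, 0 < y < 1 -> s (i + d)%N < y -> f y = 0) ->
  (s i < s (i + d)%N -> RInt f 0 1 <> 0) ->
  0 < x < 1 -> s (i + d)%N < x -> cdf s f d i x = 1.
Proof.
move=> pf hf hZ hx hi; rewrite /cdf; case: Rle_dec => h /=.
  rewrite /step01; case: Rle_dec => //= h2.
  by have := s_mono i d; lra.
rewrite -(@pc_RInt_Chasles n n0 f 0 x 1 pf) (@pc_RInt_eq0 n n0 f x 1 pf); [|lra|].
  have := hZ ltac:(lra).
  rewrite -(@pc_RInt_Chasles n n0 f 0 x 1 pf) (@pc_RInt_eq0 n n0 f x 1 pf); [|lra|].
    by rewrite Rplus_0_r => hz; fieldR.
  by move=> y _ hy; apply: hf; lra.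
by move=> y _ hy; apply: hf; lra.
Qed.

(** To the right of both supports the two terms equal 1 and cancel; the nonzero integrals are what
    normalizes them to 1. *)
Lemma supported_cdf f d : (forall i, pc n (f i)) -> supported s f d ->
  (forall i, s i < s (i + d)%N -> RInt (f i) 0 1 <> 0) ->
  supported s (fun i x => cdf s (f i) d i x - cdf s (f i.+1) d i.+1 x) d.+1.
Proof.
move=> pf sf hZ i x hx; have m1 : s i <= s i.+1 by have := s_mono i 1; rewrite addn1.
have m2 : s (i + d)%N <= s (i.+1 + d)%N by have := s_mono (i + d) 1; rewrite addn1 addSn.
move=> [h|]; last rewrite addnS -addSn => h.
  rewrite !cdf_left //; try lra.
  - by move=> y hy hy2; apply: sf => //; left.
  - by move=> y hy hy2; apply: sf => //; left.
rewrite !cdf_right //; try lra; try exact: hZ.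
- by move=> y hy hy2; apply: sf => //; right.
- by move=> y hy hy2; apply: sf => //; right.
Qed.

Lemma RInt_supported f d M i y : (forall i, pc n (f i)) -> supported s f d -> 0 <= M ->
  (forall x, off n x -> 0 < x < 1 -> Rabs (f i x) <= M) ->
  0 <= y <= 1 -> Rabs (RInt (f i) 0 y) <= M * (INR d / INR n).
Proof.
move=> pf sf M0 fM hy.
apply: Rle_trans (Rmult_le_compat_l _ _ _ M0 (knot_width n0 kap_step i d)).
apply: (pc_RInt_bound n0 (pf i) (b := 1)) => //.
- exact: s_ge0.
- exact: s_mono.
- exact: s_le1.
- by move=> x _; rewrite -/(s i) => hx; apply: sf; [have := s_le1 i; lra|left; lra].
- by move=> x _; rewrite -/(s (i + d)%N) => hx; apply: sf; [have := s_ge0 (i + d); lra|right; lra].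
Qed.

Lemma pspline_RInt_ge q i : s i < s (i + q.+1)%N ->
  1 / (INR n * INR q.+1) <= RInt (pspline s q i) 0 1.
Proof.
move=> h; rewrite (pspline_RInt n0 kap_mono kap_n) -/(s _) -/(s _).
have h1 := INR_ge1 q; have := knot_gap n0 h; rewrite -/(s i) -/(s (i + q.+1)%N) => h2.
have -> : 1 / (INR n * INR q.+1) = 1 / INR n / INR q.+1 by field; lra.
by apply: Rmult_le_compat_r => //; apply/Rlt_le/Rinv_0_lt_compat; lra.
Qed.

Lemma pspline_RInt_neq0 q i : s i < s (i + q.+1)%N -> RInt (pspline s q i) 0 1 <> 0.
Proof.
move=> h; have := pspline_RInt_ge h; have h1 := INR_ge1 q.
have : 0 < 1 / (INR n * INR q.+1) by apply: Rdiv_lt_0_compat; [lra|nra].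
by move=> ? ? ?; lra.
Qed.

Let pcp q i : pc n (pspline s q i). Proof. exact: pc_pspline. Qed.

Lemma pspline_supported q : supported s (pspline s q) q.+1.
Proof.
elim: q => [|q IH]; last first.
  by apply: supported_cdf => // i; exact: pspline_RInt_neq0.
move=> i x hx; rewrite addn1 /= /step01.
have m1 : s i <= s i.+1 by have := s_mono i 1; rewrite addn1.
by case: Rle_dec => h1 /=; case: Rle_dec => h2 /=; lra.
Qed.

Lemma cdf_pspline_bound q i x :
  (forall i x, 0 < x < 1 -> Rabs (pspline s q i x) <= pspline_bound q) ->
  0 <= x <= 1 -> Rabs (cdf s (pspline s q i) q.+1 i x) <= 1 + pspline_bound q * INR q.+1 ^ 2.
Proof.
move=> IH hx; have b0 := pspline_bound_gt0 q; have h1 := INR_ge1 q.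
have h2 : 0 <= pspline_bound q * INR q.+1 ^ 2 by have := pow2_ge_0 (INR q.+1); nra.
rewrite /cdf; set B := _ * INR q.+1 ^ 2 in h2 *; case: Rle_dec => h /=; rewrite ?/B.
  by rewrite -/B /step01; case: Rle_dec => h' /=; rewrite ?Rabs_R0 ?Rabs_R1; lra.
have hZ := @pspline_RInt_ge q i ltac:(lra).
have z0 : 0 < 1 / (INR n * INR q.+1) by apply: Rdiv_lt_0_compat; [lra|nra].
have hI := @RInt_supported (pspline s q) q.+1 (pspline_bound q) i x (@pcp q) (@pspline_supported q) ltac:(lra) (fun x _ => IH i x) hx.
rewrite /Rdiv Rabs_mult Rabs_inv (Rabs_pos_eq (RInt _ 0 1)); last lra.
apply: (@Rle_trans _ (pspline_bound q * (INR q.+1 / INR n) * (INR n * INR q.+1))).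
  apply: Rmult_le_compat => //; first exact: Rabs_pos.
    by apply/Rlt_le/Rinv_0_lt_compat; lra.
  have -> : INR n * INR q.+1 = / (1 / (INR n * INR q.+1)) by field; lra.
  exact: Rinv_le_contravar.
have -> : pspline_bound q * (INR q.+1 / INR n) * (INR n * INR q.+1) = pspline_bound q * INR q.+1 ^ 2.
  by field; lra.
lra.
Qed.

Lemma pspline_le q i x : 0 < x < 1 -> Rabs (pspline s q i x) <= pspline_bound q.
Proof.
elim: q i x => [|q IH] i x hx.
  by rewrite /= /step01; case: Rle_dec => h1 /=; case: Rle_dec => h2 /=; apply: Rabs_le; lra.
have c1 := cdf_pspline_bound i IH (x := x) ltac:(lra).
have c2 := cdf_pspline_bound i.+1 IH (x := x) ltac:(lra).
rewrite [pspline _ _ _]/= [pspline_bound q.+1]/=.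
by apply: Rle_trans (Rabs_triang _ _) _; rewrite Rabs_Ropp; lra.
Qed.

Lemma dens_pspline_le q i x : 0 < x < 1 ->
  Rabs (dens s (pspline s q i) q.+1 i x) <= INR n * (pspline_bound q * INR q.+1).
Proof.
move=> hx; have b0 := pspline_bound_gt0 q; have h1 := INR_ge1 q.
rewrite /dens; case: Rle_dec => h /=.
  by rewrite Rabs_R0; apply: Rmult_le_pos; nra.
have hZ := @pspline_RInt_ge q i ltac:(lra).
have z0 : 0 < 1 / (INR n * INR q.+1) by apply: Rdiv_lt_0_compat; [lra|nra].
rewrite /Rdiv Rabs_mult Rabs_inv (Rabs_pos_eq (RInt _ 0 1)); last lra.
have -> : INR n * (pspline_bound q * INR q.+1) = pspline_bound q * (INR n * INR q.+1) by ring.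
apply: Rmult_le_compat; first exact: Rabs_pos.
- by apply/Rlt_le/Rinv_0_lt_compat; lra.
- exact: pspline_le.
have -> : INR n * INR q.+1 = / (1 / (INR n * INR q.+1)) by field; lra.
exact: Rinv_le_contravar.
Qed.

Section closeness.
Variables (q : nat) (f : nat -> R -> R) (e : R).
Hypothesis pf : forall i, pc n (f i).
Hypothesis sf : supported s f q.+1.
Hypothesis fe : forall i x, off n x -> 0 < x < 1 -> Rabs (f i x - pspline s q i x) <= e.
Hypothesis e0 : 0 <= e.
Hypothesis e_small : e * INR q.+1 ^ 2 <= / 2.

Let h1 := INR_ge1 q.
Let b0 := pspline_bound_gt0 q.

Let diff_RInt i y : 0 <= y <= 1 ->
  Rabs (RInt (f i) 0 y - RInt (pspline s q i) 0 y) <= e * (INR q.+1 / INR n).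
Proof.
move=> hy; rewrite -(pc_RInt_minus n0) //.
apply: (@RInt_supported (fun i x => f i x - pspline s q i x)) => //.
- by move=> j; apply: pc_minus.
- by move=> j x hx hj; rewrite sf // (pspline_supported hx hj); ring.
- by move=> x ox hx; apply: fe.
Qed.

(** The integral moves by at most e (q + 1)/n, which [e_small] makes at most half of its lower bound
    1/(n (q + 1)). *)
Lemma close_RInt_ge i : s i < s (i + q.+1)%N ->
  1 / (2 * (INR n * INR q.+1)) <= RInt (f i) 0 1.
Proof.
move=> h; have hZ := pspline_RInt_ge h; have := @diff_RInt i 1 ltac:(lra).
move=> /Rabs_le_between [d1 _].
have : e * (INR q.+1 / INR n) <= 1 / (2 * (INR n * INR q.+1)); last first.
  have : 1 / (INR n * INR q.+1) = 2 * (1 / (2 * (INR n * INR q.+1))) by field; lra.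
  lra.
have -> : e * (INR q.+1 / INR n) = e * INR q.+1 ^ 2 * (1 / (INR n * INR q.+1)) by field; lra.
have -> : 1 / (2 * (INR n * INR q.+1)) = / 2 * (1 / (INR n * INR q.+1)) by field; lra.
apply: Rmult_le_compat_r => //; apply/Rlt_le/Rdiv_lt_0_compat; [lra|nra].
Qed.

Lemma close_cdf i y : 0 <= y <= 1 ->
  Rabs (cdf s (f i) q.+1 i y - cdf s (pspline s q i) q.+1 i y) <= e * close_cst q.
Proof.
move=> hy; have c0 := close_cst_gt0 q; rewrite /cdf; case: Rle_dec => h /=.
  by rewrite Rminus_diag Rabs_R0; nra.
have hs : s i < s (i + q.+1)%N by lra.
have hI := @RInt_supported (pspline s q) q.+1 (pspline_bound q) i y (@pcp q) (@pspline_supported q) ltac:(lra) (fun x _ => @pspline_le q i x) hy.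
have z1 : 0 < 1 / (2 * (INR n * INR q.+1)) by apply: Rdiv_lt_0_compat; [lra|nra].
have z2 : 0 < 1 / (INR n * INR q.+1) by apply: Rdiv_lt_0_compat; [lra|nra].
apply: Rle_trans (quot_diff (diff_RInt i hy) hI (@diff_RInt i 1 ltac:(lra)) z1 (close_RInt_ge hs) z2 (pspline_RInt_ge hs)) _.
by right; rewrite /close_cst; field; lra.
Qed.

(** Unlike in [close_cdf] the numerator is not integrated, so one factor 1/n is missing. Densities
    are themselves of order n, so the precision is still relative. *)
Lemma close_dens i x : off n x -> 0 < x < 1 ->
  Rabs (dens s (f i) q.+1 i x - dens s (pspline s q i) q.+1 i x) <= INR n * (e * close_cst q).
Proof.
move=> ox hx; have c0 := close_cst_gt0 q; rewrite /dens; case: Rle_dec => h /=.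
  by rewrite Rminus_diag Rabs_R0; apply: Rmult_le_pos; nra.
have hs : s i < s (i + q.+1)%N by lra.
have z1 : 0 < 1 / (2 * (INR n * INR q.+1)) by apply: Rdiv_lt_0_compat; [lra|nra].
have z2 : 0 < 1 / (INR n * INR q.+1) by apply: Rdiv_lt_0_compat; [lra|nra].
apply: Rle_trans (quot_diff (fe i ox hx) (pspline_le q i hx) (@diff_RInt i 1 ltac:(lra)) z1 (close_RInt_ge hs) z2 (pspline_RInt_ge hs)) _.
have -> : e / (1 / (2 * (INR n * INR q.+1))) + pspline_bound q * (e * (INR q.+1 / INR n)) /
   (1 / (2 * (INR n * INR q.+1)) * (1 / (INR n * INR q.+1))) =
  INR n * (e * (2 * INR q.+1 + 2 * pspline_bound q * INR q.+1 ^ 3)) by field; lra.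
apply: Rmult_le_compat_l; first lra.
apply: Rmult_le_compat_l => //; rewrite /close_cst.
have a : INR q.+1 <= INR q.+1 ^ 2 by nra.
have b : INR q.+1 ^ 3 <= INR q.+1 ^ 4.
  have : 0 < INR q.+1 ^ 3 by apply: pow_lt; lra.
  by rewrite (_ : INR q.+1 ^ 4 = INR q.+1 * INR q.+1 ^ 3) //; nra.
nra.
Qed.
End closeness.
End knots.

(** * GB-splines close to polynomial splines *)

(** Truncated subtraction repeats the knot 0 and the minimum repeats the knot 1. *)
Definition kapn (n p k : nat) : nat := minn n (k - p.+1).

Lemma kapn_mono n p i : (kapn n p i <= kapn n p i.+1)%N. Proof. rewrite /kapn; lia. Qed.
Lemma kapn_step n p i : (kapn n p i.+1 <= (kapn n p i).+1)%N. Proof. rewrite /kapn; lia. Qed.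
Lemma kapn_le n p i : (kapn n p i <= n)%N. Proof. rewrite /kapn; lia. Qed.

Lemma knotE n p : (0 < n)%N -> knot n p = (fun k => INR (kapn n p k) / INR n).
Proof.
move=> n0; apply: functional_extensionality => k; rewrite /knot /kapn !INRE RdivE.
have nn : (n%:R != 0 :> R)%R by rewrite -INRE; apply/eqP; apply: not_0_INR; lia.
case: ifP => h1; first by rewrite (_ : minn n (k - p.+1) = 0%N) ?GRing.mul0r //; lia.
case: ifP => h2; first by congr (_ / _)%R; congr (_%:R)%R; lia.
by rewrite (_ : minn n (k - p.+1) = n) ?GRing.mulfV //; lia.
Qed.

Definition tder (Q : gbkind) (x : R) : R :=
  match Q with Trig => cos x | Hyp => cosh x end.

Lemma is_derive_tfun Q x : is_derive (tfun Q) x (tder Q x).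
Proof.
case: Q; first exact: is_derive_sin.
by apply/is_derive_Reals; apply: derivable_pt_lim_sinh.
Qed.

Lemma continuous_tder Q x : continuous (tder Q) x.
Proof.
case: Q; first exact: continuous_cos.
apply: ex_derive_continuous; exists (sinh x).
by apply/is_derive_Reals; apply: derivable_pt_lim_cosh.
Qed.

Lemma tfun0 Q : tfun Q 0 = 0.
Proof. by case: Q; [exact: sin_0|exact: sinh_0]. Qed.

Lemma tder0 Q : tder Q 0 = 1.
Proof. by case: Q; [exact: cos_0|exact: cosh_0]. Qed.

(** The error on [tfun] must be relative, since the hats divide by its value at mu/n. It comes from
    the derivative being close to 1, by the mean value theorem. *)
Lemma tfun_close Q e : 0 < e -> exists2 d, 0 < d & forall y, 0 <= y <= d ->
  Rabs (tder Q y - 1) <= e /\ Rabs (tfun Q y - y) <= e * y.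
Proof.
move=> e0; have := @continuous_tder Q 0; rewrite /continuous tder0.
move=> /filterlim_locally /(_ (mkposreal _ e0)) [d hd].
have hd' y : 0 <= y <= d / 2 -> Rabs (tder Q y - 1) <= e.
  move=> hy; have d0 := cond_pos d; apply: Rlt_le; apply: (hd y).
  by change (Rabs (y - 0) < d); apply: Rabs_def1; lra.
exists (d / 2) => [|y hy]; first by have := cond_pos d; lra.
split; first exact: hd'.
have [|x _|c [hc]] := MVT_gen (tfun Q) 0 y (tder Q).
- by move=> x _; apply: is_derive_tfun.
- by apply/continuity_pt_filterlim; apply: ex_derive_continuous; eexists; apply: is_derive_tfun.
rewrite tfun0 !Rminus_0_r => ->; rewrite Rmin_left ?Rmax_right in hc; try lra.
have -> : tder Q c * y - y = (tder Q c - 1) * y by ring.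
rewrite Rabs_mult (Rabs_pos_eq y); last lra.
by apply: Rmult_le_compat_r; [lra|apply: hd'; lra].
Qed.

(** As e <= 1/2, the denominator th is at least h/2; numerator and denominator each contribute an
    error e, doubled by the division. *)
Lemma ratio_close t h th u e : 0 < h -> 0 < e <= / 2 -> 0 <= u <= 1 ->
  Rabs (t - h * u) <= e * (h * u) -> Rabs (th - h) <= e * h ->
  Rabs (t / th - u) <= 4 * e.
Proof.
move=> h0 he hu ht hth; have [h1 h2] := proj1 (Rabs_le_between _ _) hth.
have th0 : h / 2 <= th by nra.
have -> : t / th - u = ((t - h * u) - u * (th - h)) / th by field; lra.
rewrite /Rdiv Rabs_mult Rabs_inv (Rabs_pos_eq th); last lra.
apply/Rle_div_l; first lra.
apply: Rle_trans (Rabs_triang _ _) _; rewrite Rabs_Ropp Rabs_mult (Rabs_pos_eq u); last lra.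
have := Rabs_pos (th - h); nra.
Qed.

Lemma ratio_close_der t h th e : 0 < h -> 0 < e <= / 2 ->
  Rabs (t - 1) <= e -> Rabs (th - h) <= e * h ->
  Rabs (h * t / th - 1) <= 4 * e.
Proof.
move=> h0 he ht hth; have [h1 h2] := proj1 (Rabs_le_between _ _) hth.
have th0 : h / 2 <= th by nra.
have -> : h * t / th - 1 = (h * (t - 1) - (th - h)) / th by field; lra.
rewrite /Rdiv Rabs_mult Rabs_inv (Rabs_pos_eq th); last lra.
apply/Rle_div_l; first lra.
apply: Rle_trans (Rabs_triang _ _) _; rewrite Rabs_Ropp Rabs_mult (Rabs_pos_eq h); last lra.
nra.
Qed.

Section hat.
Variables (Q : gbkind) (mu : R) (n p : nat) (n0 : (0 < n)%N) (mu0 : 0 < mu).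
Let s := knot n p.

Let nn : 0 < INR n. Proof. by apply: lt_0_INR; apply/ltP. Qed.
Let sE : s = (fun k => INR (kapn n p k) / INR n). Proof. exact: knotE. Qed.
Let s_monoS i : s i <= s i.+1.
Proof. by rewrite sE; apply: knot_monoS => // j; apply: kapn_mono. Qed.

Definition dGB1 (i : nat) (x : R) : R :=
  if Rlt_dec (s i) x then if Rlt_dec x (s i.+1) then
    mu * tder Q (mu * (x - s i)) / tfun Q (mu * (s i.+1 - s i))
  else if Rlt_dec x (s i.+2) then
    - (mu * tder Q (mu * (s i.+2 - x)) / tfun Q (mu * (s i.+2 - s i.+1)))
  else 0 else 0.

Lemma GB1_up i x : s i < x < s i.+1 ->
  GB1 Q mu n p i x = tfun Q (mu * (x - s i)) / tfun Q (mu * (s i.+1 - s i)).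
Proof.
move=> [h1 h2]; rewrite /GB1 -/s ifT; first by rewrite -RdivE.
by apply/and3P; split; [apply/RltP; lra|apply/RleP; lra|apply/RltP].
Qed.

Lemma GB1_down i x : s i.+1 < x < s i.+2 ->
  GB1 Q mu n p i x = tfun Q (mu * (s i.+2 - x)) / tfun Q (mu * (s i.+2 - s i.+1)).
Proof.
move=> [h1 h2]; rewrite /GB1 -/s ifF.
  rewrite ifT; first by rewrite -RdivE.
  by apply/and3P; split; [apply/RltP; lra|apply/RleP; lra|apply/RltP].
by apply/negP => /and3P[_ _ /RltP]; lra.
Qed.

Lemma GB1_out i x : x < s i \/ s i.+2 < x -> GB1 Q mu n p i x = 0.
Proof.
have m1 := s_monoS i; have m2 := s_monoS i.+1.
move=> h; rewrite /GB1 -/s ifF; last by apply/negP => /and3P[_ /RleP ? /RltP]; lra.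
by rewrite ifF //; apply/negP => /and3P[_ /RleP ? /RltP]; lra.
Qed.

Lemma cell_knot k j :
  (forall y, IZR k < INR n * y < IZR k + 1 -> s j < y) \/
  (forall y, IZR k < INR n * y < IZR k + 1 -> y < s j).
Proof.
have hs : INR n * s j = INR (kapn n p j) by rewrite sE; field; lra.
case: (Z_le_gt_dec (Z.of_nat (kapn n p j)) k) => h; [left|right] => y hy.
  have : INR (kapn n p j) <= IZR k by rewrite INR_IZR_INZ; apply: IZR_le.
  by nra.
have : IZR k + 1 <= INR (kapn n p j) by rewrite INR_IZR_INZ -plus_IZR; apply: IZR_le; lia.
by nra.
Qed.

(** An open cell contains no knot, so a single formula, smooth on the whole line, is valid on it.
    Piecewise continuity and the derivative off the grid both follow. *)
Lemma GB1_cell k i : exists g dg : R -> R,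
  [/\ forall x, is_derive g x (dg x), forall x, continuous dg x &
      forall y, IZR k < INR n * y < IZR k + 1 -> GB1 Q mu n p i y = g y /\ dGB1 i y = dg y].
Proof.
have m1 := s_monoS i; have m2 := s_monoS i.+1.
have out : (forall y, IZR k < INR n * y < IZR k + 1 -> y < s i \/ s i.+2 < y) ->
    exists g dg : R -> R,
  [/\ forall x, is_derive g x (dg x), forall x, continuous dg x &
      forall y, IZR k < INR n * y < IZR k + 1 -> GB1 Q mu n p i y = g y /\ dGB1 i y = dg y].
  move=> h; exists (fun=> 0), (fun=> 0); split=> [x|x|y /h hy].
  - exact: is_derive_const.
  - exact: continuous_const.
  rewrite GB1_out //; split=> //; rewrite /dGB1.
  by case: Rlt_dec => h1 //=; case: Rlt_dec => h2 /=; [lra|case: Rlt_dec => h3 //=; lra].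
have cd c d (e : R) x : continuous (fun x => e * (mu * tder Q (c * x + d))) x.
  apply: (@continuous_mult _ _ (fun=> e)); first exact: continuous_const.
  apply: (@continuous_mult _ _ (fun=> mu)); first exact: continuous_const.
  apply: (continuous_comp (fun x => c * x + d)); last exact: continuous_tder.
  by apply: ex_derive_continuous; auto_derive.
have dd c d (e : R) x : is_derive (fun x => e * tfun Q (c * x + d)) x (e * (c * tder Q (c * x + d))).
  apply: is_derive_scal; apply: (@is_derive_comp _ _ (tfun Q) (fun x => c * x + d)).
    exact: is_derive_tfun.
  by auto_derive => //; ring.
case: (cell_knot k i) => hi; last by apply: out => y /hi; left.
case: (cell_knot k i.+2) => hi2; first by apply: out => y /hi2; right.
case: (cell_knot k i.+1) => hi1.
  exists (fun x => / tfun Q (mu * (s i.+2 - s i.+1)) * tfun Q (- mu * x + mu * s i.+2)).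
  exists (fun x => - / tfun Q (mu * (s i.+2 - s i.+1)) * (mu * tder Q (- mu * x + mu * s i.+2))).
  split=> // [x|y hy].
    by refine (is_derive_eq (dd _ _ _ _) _); ring.
  have a1 := hi y hy; have a2 := hi2 y hy; have a3 := hi1 y hy.
  have -> : - mu * y + mu * s i.+2 = mu * (s i.+2 - y) by ring.
  rewrite GB1_down // /dGB1; case: Rlt_dec => //= _; case: Rlt_dec => h2 /=; first lra.
  by case: Rlt_dec => //= _; rewrite /Rdiv; split; ring.
exists (fun x => / tfun Q (mu * (s i.+1 - s i)) * tfun Q (mu * x + - mu * s i)).
exists (fun x => / tfun Q (mu * (s i.+1 - s i)) * (mu * tder Q (mu * x + - mu * s i))).
split=> // y hy.
have a1 := hi y hy; have a2 := hi2 y hy; have a3 := hi1 y hy.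
have -> : mu * y + - mu * s i = mu * (y - s i) by ring.
rewrite GB1_up // /dGB1; case: Rlt_dec => //= _; case: Rlt_dec => h2 //=.
by rewrite /Rdiv; split; ring.
Qed.

Lemma pc_GB1 i : pc n (GB1 Q mu n p i).
Proof.
move=> k; have [g [dg [h1 h2 h3]]] := GB1_cell k i; exists g => [x|x /h3[]//].
by apply: ex_derive_continuous; eexists; exact: h1.
Qed.

Lemma pc_dGB1 i : pc n (dGB1 i).
Proof. by move=> k; have [g [dg [h1 h2 h3]]] := GB1_cell k i; exists dg => // x /h3[]. Qed.

Lemma derive_GB1 i x : off n x -> is_derive (GB1 Q mu n p i) x (dGB1 i x).
Proof.
move=> /off_cell[k hk]; have [g [dg [h1 h2 h3]]] := GB1_cell k i.
have [_ ->] := h3 x hk; apply: (is_derive_ext_loc g); last exact: h1.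
by have := locally_cell hk; apply: filter_imp => y /h3[].
Qed.

Lemma GB1_supported : supported s (GB1 Q mu n p) 2.
Proof. by move=> i x _; rewrite addn2; exact: GB1_out. Qed.

Lemma dGB1_supported : supported s dGB1 2.
Proof.
move=> i x _; rewrite addn2 /dGB1 => h; have m1 := s_monoS i; have m2 := s_monoS i.+1.
by case: Rlt_dec => h1 //=; case: Rlt_dec => h2 /=; [lra|case: Rlt_dec => h3 //=; lra].
Qed.

Lemma hat_width i : s i < s i.+1 -> s i.+1 - s i = 1 / INR n.
Proof.
move=> h; apply: Rle_antisym.
  have := knot_width n0 (kapn_step n p) i 1; rewrite addn1 (_ : INR 1 = 1) //.
  by have := sE => ->.
have := @knot_gap n (kapn n p) n0 i 1; rewrite addn1.
by move=> gap; move: h; rewrite sE => h; exact: gap.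
Qed.

Lemma ind_RInt i : RInt (pspline s 0 i) 0 1 = s i.+1 - s i.
Proof.
have := pspline_RInt n0 (kapn_mono n p) (kapn_le n p) 0 i; rewrite sE addn1 => ->.
by rewrite (_ : INR 1 = 1) //=; fieldR; lra.
Qed.

Lemma cdf_ind i x : off n x -> 0 < x < 1 -> cdf s (pspline s 0 i) 1 i x =
  if Rlt_dec x (s i) then 0 else if Rlt_dec x (s i.+1) then INR n * (x - s i) else 1.
Proof.
move=> ox hx.
have pp : pc n (pspline s 0 i) by rewrite sE; apply: pc_pspline.
have ps : supported s (pspline s 0) 1.
  by rewrite sE; apply: pspline_supported => //; [exact: kapn_mono|exact: kapn_le].
have ZE := ind_RInt i.
have ne j : x <> s j by have := @off_neq_knot n (kapn n p) n0 x j ox; rewrite sE.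
have si0 : 0 <= s i by rewrite sE; apply: knot_ge0.
have Z0 : s i < s (i + 1)%N -> RInt (pspline s 0 i) 0 1 <> 0.
  by rewrite addn1 ZE => ? ?; lra.
case: Rlt_dec => h1 /=.
  by move: pp h1 ps; rewrite sE => pp h1 ps; apply: cdf_left => // y hy hy2; apply: ps => //; left.
case: Rlt_dec => h2 /=; last first.
  have h3 : s (i + 1)%N < x by have := ne i.+1; rewrite addn1; lra.
  move: pp h3 ps Z0; rewrite sE => pp h3 ps Z0.
  by apply: cdf_right => //; [exact: kapn_mono|move=> y hy hy2; apply: ps => //; right].
rewrite /cdf addn1; case: Rle_dec => h3 /=; first lra.
rewrite ZE hat_width; last lra.
rewrite (@pc_RInt_support n n0 _ 0 x (s i) x pp) //; try lra.
- rewrite (@pc_RInt_ext_open n n0 _ (fun=> 1)) //; [|exact: pc_const|lra|].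
    by rewrite RInt_const /scal /= /mult /=; field; lra.
  move=> y _ hy; rewrite /= /step01; case: Rle_dec => h4 /=; last lra.
  by case: Rle_dec => h5 /=; lra.
- by move=> y _ hy; apply: ps; [lra|left; lra].
- by move=> y _ hy; lra.
Qed.

(** Put h = mu/n and let u in [0, 1] be the value of the polynomial hat. On either slope the GB hat
    is tfun(h u)/tfun(h), with derivative plus or minus n times h tder(h u)/tfun(h). *)
Lemma hat_close i x e : 0 < e <= / 2 ->
  (forall y, 0 <= y <= mu / INR n ->
     Rabs (tder Q y - 1) <= e /\ Rabs (tfun Q y - y) <= e * y) ->
  off n x -> 0 < x < 1 ->
  Rabs (GB1 Q mu n p i x - pspline s 1 i x) <= 4 * e /\
  Rabs (dGB1 i x - (dens s (pspline s 0 i) 1 i x - dens s (pspline s 0 i.+1) 1 i.+1 x))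
    <= INR n * (4 * e).
Proof.
move=> he hT ox hx; have m1 := s_monoS i; have m2 := s_monoS i.+1.
have ne j : x <> s j by have := @off_neq_knot n (kapn n p) n0 x j ox; rewrite sE.
have h0 : 0 < mu / INR n by apply: Rdiv_lt_0_compat.
have [_ th] := hT (mu / INR n) ltac:(lra).
have pe : 0 <= INR n * (4 * e) by apply: Rmult_le_pos; lra.
have dE j : dens s (pspline s 0 j) 1 j x =
    if Rlt_dec (s j) x then if Rlt_dec x (s j.+1) then INR n else 0 else 0.
  rewrite /dens addn1 ind_RInt; case: Rle_dec => h1 /=.
    by case: Rlt_dec => h2 //=; case: Rlt_dec => h3 //=; lra.
  rewrite hat_width; last lra.
  rewrite /step01; have := ne j; have := ne j.+1.
  case: Rle_dec => h2 /=; case: Rle_dec => h3 /=; case: Rlt_dec => h4 /=; try case: Rlt_dec => h5 /=; move=> ? ?; try lra; field; lra.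
have pE : pspline s 1 i x = cdf s (pspline s 0 i) 1 i x - cdf s (pspline s 0 i.+1) 1 i.+1 x by [].
rewrite !dE pE {pE}.
rewrite !cdf_ind //.
have := ne i; have := ne i.+1; have := ne i.+2 => n2 n1 ni.
case: (Rlt_dec x (s i)) => hi /=.
  rewrite GB1_out; last by left.
  rewrite dGB1_supported //; last by left.
  have -> : is_left (Rlt_dec x (s i.+1)) = true by case: Rlt_dec => // ?; lra.
  have -> : is_left (Rlt_dec (s i) x) = false by case: Rlt_dec => // ?; lra.
  have -> : is_left (Rlt_dec (s i.+1) x) = false by case: Rlt_dec => // ?; lra.
  by rewrite !Rminus_diag Rabs_R0; split; lra.
have -> : is_left (Rlt_dec (s i) x) = true by case: Rlt_dec => // ?; lra.
case: (Rlt_dec x (s i.+1)) => hi1 /=.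
  have w := @hat_width i ltac:(lra).
  have -> : is_left (Rlt_dec (s i.+1) x) = false by case: Rlt_dec => // ?; lra.
  rewrite GB1_up /dGB1; last lra.
  case: Rlt_dec => [_|] /=; last lra; case: Rlt_dec => [_|] /=; last lra.
  rewrite w (_ : mu * (1 / INR n) = mu / INR n); last by field; lra.
  have u1 : 0 <= INR n * (x - s i) <= 1.
    split; first nra.
    have : INR n * (x - s i) <= INR n * (1 / INR n) by apply: Rmult_le_compat_l; lra.
    by have -> : INR n * (1 / INR n) = 1 by field; lra.
  have E : mu * (x - s i) = mu / INR n * (INR n * (x - s i)) by field; lra.
  have [t1 t2] := hT (mu * (x - s i)) ltac:(rewrite E; nra).
  rewrite !Rminus_0_r; split.
    by apply: (@ratio_close _ (mu / INR n)) => //; rewrite -E.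
  have -> : mu * tder Q (mu * (x - s i)) / tfun Q (mu / INR n) - INR n =
     INR n * (mu / INR n * tder Q (mu * (x - s i)) / tfun Q (mu / INR n) - 1).
    have : tfun Q (mu / INR n) <> 0 by have [] := proj1 (Rabs_le_between _ _) th; nra.
    by move=> ?; field; lra.
  rewrite Rabs_mult (Rabs_pos_eq (INR n)); last lra.
  by apply: Rmult_le_compat_l; [lra|exact: ratio_close_der].
have -> : is_left (Rlt_dec (s i.+1) x) = true by case: Rlt_dec => // ?; lra.
case: (Rlt_dec x (s i.+2)) => hi2 /=; last first.
  rewrite GB1_out; last by right; lra.
  rewrite dGB1_supported //; last by right; rewrite addn2; lra.
  by rewrite !Rminus_diag Rabs_R0; split; lra.
have w := @hat_width i.+1 ltac:(lra).
rewrite GB1_down /dGB1; last lra.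
case: Rlt_dec => [_|] /=; last lra; case: Rlt_dec => [|_] /=; first lra.
case: Rlt_dec => [_|] /=; last lra.
rewrite w (_ : mu * (1 / INR n) = mu / INR n); last by field; lra.
have u1 : 0 <= INR n * (s i.+2 - x) <= 1.
  split; first nra.
  have : INR n * (s i.+2 - x) <= INR n * (1 / INR n) by apply: Rmult_le_compat_l; lra.
  by have -> : INR n * (1 / INR n) = 1 by field; lra.
have E : mu * (s i.+2 - x) = mu / INR n * (INR n * (s i.+2 - x)) by field; lra.
have [t1 t2] := hT (mu * (s i.+2 - x)) ltac:(rewrite E; nra).
split.
  have -> : 1 - INR n * (x - s i.+1) = INR n * (s i.+2 - x).
    by rewrite (_ : s i.+2 = s i.+1 + 1 / INR n); [field|]; lra.
  by apply: (@ratio_close _ (mu / INR n)) => //; rewrite -E.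
have -> : - (mu * tder Q (mu * (s i.+2 - x)) / tfun Q (mu / INR n)) - (0 - INR n) =
   - (INR n * (mu / INR n * tder Q (mu * (s i.+2 - x)) / tfun Q (mu / INR n) - 1)).
  have : tfun Q (mu / INR n) <> 0 by have [] := proj1 (Rabs_le_between _ _) th; nra.
  by move=> ?; field; lra.
rewrite Rabs_Ropp Rabs_mult (Rabs_pos_eq (INR n)); last lra.
by apply: Rmult_le_compat_l; [lra|exact: ratio_close_der].
Qed.
End hat.

(** Stage q has degree q + 1, so its supports span q + 2 knot intervals. *)
Lemma GBauxS Q mu n p q i x : GBaux Q mu n p q.+1 i x =
  cdf (knot n p) (GBaux Q mu n p q i) q.+2 i x
  - cdf (knot n p) (GBaux Q mu n p q i.+1) q.+2 i.+1 x.
Proof.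
have I j : (if (knot n p (j + q.+1 + 1) <= knot n p j)%R then
          (if (knot n p j <= x)%R then 1%R else 0%R)
        else (RInt (GBaux Q mu n p q j) 0 x / RInt (GBaux Q mu n p q j) 0 1)%R)
   = cdf (knot n p) (GBaux Q mu n p q j) q.+2 j x.
  rewrite /cdf -addnA addn1 /step01; case: Rle_dec => h /=.
    move/RleP: (h) => ->; case: Rle_dec => h2 /=; first by move/RleP: (h2) => ->.
    by case: RleP => // h3; case: h2.
  by case: RleP => [h3|_]; [case: h|rewrite -RdivE].
by rewrite -!I.
Qed.

Definition gbder (Q : gbkind) (mu : R) (n p q : nat) : nat -> R -> R :=
  match q with
  | 0%N => dGB1 Q mu n p
  | q'.+1 => fun i x =>
      dens (knot n p) (GBaux Q mu n p q' i) q.+1 i x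
      - dens (knot n p) (GBaux Q mu n p q' i.+1) q.+1 i.+1 x
  end.

Definition pder (s : nat -> R) (q i : nat) (x : R) : R :=
  dens s (pspline s q i) q.+1 i x - dens s (pspline s q i.+1) q.+1 i.+1 x.

Lemma psplineS s q i x : pspline s q.+1 i x =
  cdf s (pspline s q i) q.+1 i x - cdf s (pspline s q i.+1) q.+1 i.+1 x.
Proof. by []. Qed.

(** The invariant of the induction on the degree. Derivatives are of order n, hence the error n e on
    them. Supports are included because the next stage needs integrals of size O(1/n). *)
Record gb_close (Q : gbkind) (mu : R) (n p q : nat) (e : R) : Prop := GbClose {
  gb_pc : forall i, pc n (GBaux Q mu n p q i);
  gb_supp : supported (knot n p) (GBaux Q mu n p q) q.+2;
  gb_near : forall i x, off n x -> 0 < x < 1 ->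
    Rabs (GBaux Q mu n p q i x - pspline (knot n p) q.+1 i x) <= e;
  gbd_pc : forall i, pc n (gbder Q mu n p q i);
  gbd_supp : supported (knot n p) (gbder Q mu n p q) q.+2;
  gbd_near : forall i x, off n x -> 0 < x < 1 ->
    Rabs (gbder Q mu n p q i x - pder (knot n p) q i x) <= INR n * e;
  gbd_derive : forall i x, off n x -> is_derive (GBaux Q mu n p q i) x (gbder Q mu n p q i x)
}.

Lemma supported_dens s f d : (forall i, s i <= s i.+1) -> supported s f d ->
  supported s (fun i x => dens s (f i) d i x - dens s (f i.+1) d i.+1 x) d.+1.
Proof.
move=> sm sf i x hx; rewrite addnS -addSn => h.
have m1 := sm i; have m2 := sm (i + d)%N; rewrite -addSn in m2.
have d0 j : f j x = 0 -> dens s (f j) d j x = 0.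
  by rewrite /dens => ->; case: Rle_dec => _ //=; rewrite /Rdiv; ring.
rewrite !d0 ?Rminus_diag //; apply: sf => //; case: h => h; [left|right|left|right]; lra.
Qed.

Lemma exists_INR_ge (x : R) : exists2 n0 : nat, (0 < n0)%N & forall n, (n0 <= n)%N -> x <= INR n.
Proof.
have [k hk] := nfloor_ex (Rmax x 0) (Rmax_r _ _).
exists k.+1 => // n hn; have : INR k.+1 <= INR n by apply/le_INR/leP.
by rewrite S_INR; have := Rmax_l x 0; lra.
Qed.

(** Precision is chosen backwards: precision e at one stage asks for a finer e' at the stage below,
    down to the hats, where it fixes the threshold on n. *)
Lemma gb_close_ev Q mu p q e : 0 < mu -> 0 < e ->
  exists2 n0 : nat, (0 < n0)%N & forall n, (n0 <= n)%N -> gb_close Q mu n p q e.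
Proof.
move=> mu0; elim: q e => [|q IH] e e0.
  pose e' := Rmin (e / 4) (/ 2).
  have e'0 : 0 < e' by apply: Rmin_pos; lra.
  have e'1 : e' <= e / 4 by exact: Rmin_l.
  have e'2 : e' <= / 2 by exact: Rmin_r.
  have [d d0 hd] := tfun_close Q e'0.
  (* From here on mu/n <= d. In the trigonometric case this also keeps the sines in the denominators
     away from 0, as e' <= 1/2. *)
  have [n0 n00 hn0] := exists_INR_ge (mu / d).
  exists n0 => // n hn; have n1 : (0 < n)%N by lia.
  have nn : 0 < INR n by apply: lt_0_INR; apply/ltP.
  have hT y : 0 <= y <= mu / INR n ->
      Rabs (tder Q y - 1) <= e' /\ Rabs (tfun Q y - y) <= e' * y.
    move=> hy; apply: hd; split; first lra.
    apply: Rle_trans (proj2 hy) _; apply/Rle_div_l => //.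
    by have /Rle_div_l := hn0 n hn => /(_ d0); rewrite Rmult_comm.
  have hc i x : off n x -> 0 < x < 1 -> Rabs (GB1 Q mu n p i x - pspline (knot n p) 1 i x) <= e /\
      Rabs (dGB1 Q mu n p i x - pder (knot n p) 0 i x) <= INR n * e.
    move=> ox hx; have [h1 h2] := @hat_close Q mu n p n1 mu0 i x e' (conj e'0 e'2) hT ox hx.
    split; first lra; apply: Rle_trans h2 _.
    by apply: Rmult_le_compat_l; lra.
  split.
  - by move=> i; apply: pc_GB1.
  - exact: GB1_supported.
  - by move=> i x ox /(hc i x ox) [].
  - by move=> i; apply: pc_dGB1.
  - exact: dGB1_supported.
  - by move=> i x ox /(hc i x ox) [].
  - by move=> i x ox; apply: derive_GB1.
have K0 := close_cst_gt0 q.+1; have h1 := INR_ge1 q.+1.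
have h2 : 0 < INR q.+2 ^ 2 by apply: pow_lt; lra.
(* The first bound makes the two terms of the recurrence lose at most e together; the second is the
   condition [e_small]. *)
pose e' := Rmin (e / (2 * close_cst q.+1)) (/ (2 * INR q.+2 ^ 2)).
have e'0 : 0 < e'.
  apply: Rmin_pos; first by apply: Rdiv_lt_0_compat; lra.
  by apply: Rinv_0_lt_compat; lra.
have e'1 : 2 * (e' * close_cst q.+1) <= e.
  have := Rmin_l (e / (2 * close_cst q.+1)) (/ (2 * INR q.+2 ^ 2)); rewrite -/e'.
  move=> h; have : e' * (2 * close_cst q.+1) <= e by apply/Rle_div_r => //; lra.
  lra.
have e'2 : e' * INR q.+2 ^ 2 <= / 2.
  have := Rmin_r (e / (2 * close_cst q.+1)) (/ (2 * INR q.+2 ^ 2)); rewrite -/e'.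
  move=> h; have := Rmult_le_compat_r (INR q.+2 ^ 2) _ _ (Rlt_le _ _ h2) h.
  have -> : / (2 * INR q.+2 ^ 2) * INR q.+2 ^ 2 = / 2 by field; lra.
  by [].
have [n0 n00 hn0] := IH e' e'0.
exists n0 => // n hn; have n1 : (0 < n)%N by lia.
have nn : 0 < INR n by apply: lt_0_INR; apply/ltP.
have [g1 g2 g3 _ _ _ _] := hn0 n hn.
have sE := knotE p n1.
have km := kapn_mono n p; have ks := kapn_step n p; have kl := kapn_le n p.
have fE i : GBaux Q mu n p q.+1 i = fun x => cdf (knot n p) (GBaux Q mu n p q i) q.+2 i x
  - cdf (knot n p) (GBaux Q mu n p q i.+1) q.+2 i.+1 x.
  by apply: functional_extensionality => x; apply: GBauxS.
have pcn i : pc n (cdf (knot n p) (GBaux Q mu n p q i) q.+2 i).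
  by rewrite sE; apply: pc_cdf.
have pdn i : pc n (dens (knot n p) (GBaux Q mu n p q i) q.+2 i).
  by rewrite sE; apply: pc_dens.
have abs3 a b c d : Rabs (a - b - (c - d)) <= Rabs (a - c) + Rabs (b - d).
  have -> : a - b - (c - d) = (a - c) + - (b - d) by ring.
  by apply: Rle_trans (Rabs_triang _ _) _; rewrite Rabs_Ropp; lra.
rewrite sE in g2 g3.
split.
- by move=> i; rewrite fE; apply: pc_minus.
- have sup := @supported_cdf n (kapn n p) n1 km (GBaux Q mu n p q) q.+2 g1 g2.
  have ge := close_RInt_ge n1 km ks kl g1 g2 g3 (Rlt_le _ _ e'0) e'2.
  rewrite -sE in sup ge; move=> i x hx hi; rewrite GBauxS; apply: sup => // j /ge.
  have : 0 < 1 / (2 * (INR n * INR q.+2)) by apply: Rdiv_lt_0_compat; [lra|nra].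
  by move=> ? ? ?; lra.
- move=> i x ox hx; rewrite GBauxS psplineS; apply: Rle_trans (abs3 _ _ _ _) _.
  have c1 := close_cdf n1 km ks kl g1 g2 g3 (Rlt_le _ _ e'0) e'2 i (y := x) ltac:(lra).
  have c2 := close_cdf n1 km ks kl g1 g2 g3 (Rlt_le _ _ e'0) e'2 i.+1 (y := x) ltac:(lra).
  rewrite -sE in c1 c2; lra.
- by move=> i; apply: pc_minus.
- apply: (@supported_dens (knot n p) (GBaux Q mu n p q) q.+2); last by rewrite sE.
  by move=> i; rewrite sE; apply: knot_monoS.
- move=> i x ox hx; rewrite /pder /gbder; apply: Rle_trans (abs3 _ _ _ _) _.
  have c1 := close_dens n1 km ks kl g1 g2 g3 (Rlt_le _ _ e'0) e'2 i ox hx.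
  have c2 := close_dens n1 km ks kl g1 g2 g3 (Rlt_le _ _ e'0) e'2 i.+1 ox hx.
  rewrite -sE in c1 c2.
  have : INR n * (2 * (e' * close_cst q.+1)) <= INR n * e by apply: Rmult_le_compat_l; lra.
  lra.
- move=> i x ox; rewrite fE /=; apply: is_derive_minus; rewrite sE.
    exact: derive_cdf.
  exact: derive_cdf.
Qed.

(** * Interior splines as scaled cardinal B-splines *)

Lemma pc_comp_scale n a f : pc 1 f -> pc n (fun x => f (INR n * x - INR a)).
Proof.
move=> pf k; have [g cg hg] := pf (k - Z.of_nat a)%stdZ.
exists (fun x => g (INR n * x - INR a)) => [x|x hx].
  apply: (continuous_comp (fun x => INR n * x - INR a) g); last exact: cg.
  by apply: ex_derive_continuous; auto_derive.
by rewrite hg // minus_IZR -INR_IZR_INZ (_ : INR 1 = 1) //; lra.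
Qed.

Section interior.
Variables (n p : nat) (n0 : (0 < n)%N).
Let s := knot n p.
Let nn : 0 < INR n. Proof. by apply: lt_0_INR; apply/ltP. Qed.
Let sE : s = (fun k => INR (kapn n p k) / INR n). Proof. exact: knotE. Qed.

Lemma knot_interior i : (p.+1 <= i)%N -> (i <= n + p.+1)%N -> s i = INR (i - p.+1) / INR n.
Proof. by move=> h1 h2; rewrite sE /kapn; congr (INR _ / _); lia. Qed.

Lemma pspline_interior_RInt q i : (p.+1 <= i)%N -> (i + q <= n + p)%N ->
  RInt (pspline s q i) 0 1 = 1 / INR n.
Proof.
move=> h1 h2; have := pspline_RInt n0 (kapn_mono n p) (kapn_le n p) q i; rewrite -sE => ->.
have -> : INR (kapn n p (i + q.+1)) / INR n = s (i + q.+1)%N by rewrite sE.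
have -> : INR (kapn n p i) / INR n = s i by rewrite sE.
rewrite !knot_interior; try lia.
rewrite (_ : (i + q.+1 - p.+1 = (i - p.+1) + q.+1)%N) ?plus_INR; last lia.
by have := INR_ge1 q; move=> ?; fieldR; lra.
Qed.

Lemma knot_interior_lt q i : (p.+1 <= i)%N -> (i + q <= n + p)%N -> s i < s (i + q.+1)%N.
Proof.
move=> h1 h2; rewrite !knot_interior; try lia.
apply: Rmult_lt_compat_r; first exact: Rinv_0_lt_compat.
by apply: lt_INR; lia.
Qed.

(** The knots of such a spline are distinct and equally spaced, so its recurrence is [cardB_RInt]
    after the change of variable n x - (i - p - 1). *)
Lemma pspline_interior q i x : (p.+1 <= i)%N -> (i + q <= n + p)%N ->
  pspline s q i x = cardB q (INR n * x - INR (i - p.+1)).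
Proof.
elim: q i x => [|q IH] i x h1 h2.
  have e1 : INR n * (x - s i) = INR n * x - INR (i - p.+1).
    by rewrite knot_interior; [field; lra|lia..].
  have e2 : INR n * (x - s i.+1) = INR n * x - INR (i - p.+1) - 1.
    rewrite knot_interior; try lia.
    by rewrite (_ : (i.+1 - p.+1 = (i - p.+1).+1)%N) ?S_INR; [field; lra|lia].
  rewrite cardB0E; set t := INR n * x - _ in e1 e2 *.
  have {}e1 : s i <= x <-> 0 <= t by rewrite -e1; split; nra.
  have {}e2 : s i.+1 <= x <-> 1 <= t by split; nra.
  rewrite /= /step01; case: Rle_dec => a /=; case: Rle_dec => b /=;
    case: Rle_dec => c /=; try case: Rlt_dec => d /=; try tauto; lra.
have pq := cardB_pc q.
have cE j y : (p.+1 <= j)%N -> (j + q <= n + p)%N ->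
    cdf s (pspline s q j) q.+1 j y = RInt (cardB q) 0 (INR n * y - INR (j - p.+1)).
  move=> h3 h4; rewrite /cdf; have := @knot_interior_lt q j h3 h4 => ?.
  case: Rle_dec => /= ?; first lra.
  rewrite (pspline_interior_RInt h3 h4).
  have := @RInt_comp_lin _ (cardB q) (INR n) (- INR (j - p.+1)) 0 y.
  rewrite Rmult_0_r Rplus_0_l => cl.
  rewrite -(@pc_RInt_Chasles 1 isT _ 0 (- INR (j - p.+1)) _ pq) RInt_cardB_le0; last by have := pos_INR (j - p.+1); lra.
  rewrite Rplus_0_l -cl; last exact: (pc_ex_RInt (n := 1)).
  have -> : RInt (fun y => scal (INR n) (cardB q (INR n * y + - INR (j - p.+1)))) 0 y =
     INR n * RInt (pspline s q j) 0 y; last by fieldR; lra.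
  rewrite -(pc_RInt_scal n0); last by rewrite sE; apply: pc_pspline.
  by apply: RInt_ext => z _; rewrite IH.
rewrite psplineS !cE ?cardB_RInt; try lia.
congr (_ - RInt _ 0 _); rewrite (_ : (i.+1 - p.+1 = (i - p.+1).+1)%N) ?S_INR; [ring|lia].
Qed.

Lemma dens_interior q i x : (p.+1 <= i)%N -> (i + q <= n + p)%N ->
  dens s (pspline s q i) q.+1 i x = INR n * cardB q (INR n * x - INR (i - p.+1)).
Proof.
move=> h1 h2; rewrite /dens; have := knot_interior_lt h1 h2 => ?.
case: Rle_dec => /= ?; first lra.
by rewrite pspline_interior_RInt // pspline_interior //; field; lra.
Qed.

Lemma pder_interior q i x : (p.+1 <= i)%N -> (i + q < n + p)%N ->
  pder s q i x = INR n * (cardB q (INR n * x - INR (i - p.+1))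
                         - cardB q (INR n * x - INR (i - p.+1).+1)).
Proof.
move=> h1 h2; rewrite /pder !dens_interior; try lia.
by rewrite (_ : (i.+1 - p.+1 = (i - p.+1).+1)%N); [ring|lia].
Qed.

(** The conditions place both supports inside [0, 1], so the integral is the full inner product. *)
Lemma cardB_gram_scaled q a b : (a + q < n)%N -> (b + q < n)%N ->
  INR n * RInt (fun x => cardB q (INR n * x - INR a) * cardB q (INR n * x - INR b)) 0 1
  = cardB (2 * q + 1) (INR q + 1 - (INR a - INR b)).
Proof.
move=> ha hb; have pq := cardB_pc q.
pose k := (Z.of_nat a - Z.of_nat b)%stdZ.
have kE : IZR k = INR a - INR b by rewrite minus_IZR -!INR_IZR_INZ.
have la : INR a + INR q + 1 <= INR n by rewrite -plus_INR -S_INR; apply: le_INR; lia.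
have lb : INR b + INR q + 1 <= INR n by rewrite -plus_INR -S_INR; apply: le_INR; lia.
have a0 := pos_INR a; have b0 := pos_INR b; have q0 := pos_INR q.
rewrite -kE -(@cardB_gram q k (INR n - INR a)) ?kE; try lra.
have pk : pc 1 (fun t => cardB q t * cardB q (t + (INR a - INR b))).
  apply: pc_mult => //; have sh := @pc_comp_shift 1 (cardB q) k isT pq.
  by apply: pc_ext sh => x _; congr cardB; rewrite kE (_ : INR 1 = 1) //; field.
have := @RInt_comp_lin _ _ (INR n) (- INR a) 0 1 (pc_ex_RInt (n := 1) isT _ _ pk).
rewrite Rmult_0_r Rplus_0_l Rmult_1_r => cl.
have c2 := @pc_RInt_Chasles 1 isT _ (- INR a) 0 (INR n - INR a) pk.
have c3 : RInt (fun t => cardB q t * cardB q (t + (INR a - INR b))) (- INR a) 0 = 0.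
  apply: (@pc_RInt_eq0 1) => //; first lra.
  by move=> x _ hx; rewrite cardB_lt0; [ring|lra].
rewrite -(pc_RInt_scal n0); last by apply: pc_mult; apply: pc_comp_scale.
rewrite c3 Rplus_0_l in c2; rewrite /Rminus in c2 cl *; rewrite c2 -cl.
by apply: RInt_ext => x _; rewrite /scal /= /mult /=; congr (_ * (_ * cardB _ _)); ring.
Qed.
End interior.

(** * Galerkin entries *)

(** Common format for splines and for their derivatives divided by n, so that [C] and [e] do not
    depend on n in either case. *)
Record approx (n p d : nat) (F P : nat -> R -> R) (C e : R) : Prop := Approx {
  ap_pcF : forall i, pc n (F i);
  ap_pcP : forall i, pc n (P i);
  ap_suppF : supported (knot n p) F d;
  ap_suppP : supported (knot n p) P d;
  ap_near : forall i x, off n x -> 0 < x < 1 -> Rabs (F i x - P i x) <= e;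
  ap_bound : forall i x, off n x -> 0 < x < 1 -> Rabs (P i x) <= C;
  ap_C : 0 <= C; ap_e : 0 <= e
}.

Section products.
Variables (n p d : nat) (n0 : (0 < n)%N).
Variables (F P G T : nat -> R -> R) (C C' e : R).
Hypothesis aF : approx n p d F P C e.
Hypothesis aG : approx n p d G T C' e.
Let nn : 0 < INR n. Proof. by apply: lt_0_INR; apply/ltP. Qed.
Let sE : knot n p = (fun k => INR (kapn n p k) / INR n). Proof. exact: knotE. Qed.

Let int_bound (f : R -> R) i M : pc n f -> 0 <= M ->
  (forall x, off n x -> 0 < x < 1 -> Rabs (f x) <= M) ->
  (forall x, 0 < x < 1 -> x < knot n p i \/ knot n p (i + d) < x -> f x = 0) ->
  Rabs (INR n * RInt f 0 1) <= INR d * M.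
Proof.
move=> pf M0 fM sf; rewrite Rabs_mult (Rabs_pos_eq (INR n)); last lra.
(* [RInt_supported] speaks of a family; this one vanishes at every index but i. *)
pose f' (j : nat) x := if j == i then f x else 0.
have := @RInt_supported n (kapn n p) n0 (kapn_mono n p) (kapn_step n p) (kapn_le n p) f' d M i 1.
have -> : f' i = f by rewrite /f' eqxx.
move=> h; have {}h : Rabs (RInt f 0 1) <= M * (INR d / INR n).
  apply: h => //; last lra.
    by move=> j; rewrite /f'; case: eqP => // _; apply: pc_const.
  by rewrite -sE => j x hx hj; rewrite /f'; case: eqP => // E; rewrite -E in sf; apply: sf.
have := Rmult_le_compat_l _ _ _ (Rlt_le _ _ nn) h.
by have -> : INR n * (M * (INR d / INR n)) = INR d * M by field; lra.
Qed.

(** The two supports meet at most in a knot, which lies on the grid. *)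
Lemma prod_band i j : (i + d <= j)%N \/ (j + d <= i)%N ->
  RInt (fun x => F i x * G j x) 0 1 = 0.
Proof.
move=> h; apply: (@pc_RInt_eq0 n n0); [|lra|].
  by apply: pc_mult; [apply: ap_pcF aF _|apply: ap_pcF aG _].
have mono a b : (a <= b)%N -> knot n p a <= knot n p b.
  by move=> ab; rewrite -(subnKC ab) sE; apply: knot_mono => //; apply: kapn_mono.
move=> x ox hx; have ne a : x <> knot n p a by rewrite sE; apply: off_neq_knot.
have zF : x < knot n p i \/ knot n p (i + d) < x -> F i x = 0 by apply: (ap_suppF aF).
have zG : x < knot n p j \/ knot n p (j + d) < x -> G j x = 0 by apply: (ap_suppF aG).
case: h => /mono h.
  case: (Rlt_dec x (knot n p j)) => h1; first by rewrite zG; [ring|left].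
  by rewrite zF; [ring|right]; have := ne j; lra.
case: (Rlt_dec x (knot n p i)) => h1; first by rewrite zF; [ring|left].
by rewrite zG; [ring|right]; have := ne i; lra.
Qed.

Lemma prod_near i j : Rabs (INR n * RInt (fun x => F i x * G j x) 0 1
    - INR n * RInt (fun x => P i x * T j x) 0 1) <= INR d * (e * (C' + e) + C * e).
Proof.
have pF := ap_pcF aF; have pG := ap_pcF aG; have pP := ap_pcP aF; have pT := ap_pcP aG.
have C0 := ap_C aF; have C'0 := ap_C aG; have e0 := ap_e aF.
rewrite -Rmult_minus_distr_l -(pc_RInt_minus n0); [|exact: pc_mult..].
apply: (int_bound (i := i)).
- by apply: pc_minus; apply: pc_mult.
- nra.
- move=> x ox hx.
  have -> : F i x * G j x - P i x * T j x = (F i x - P i x) * G j x + P i x * (G j x - T j x) by ring.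
  have h1 := ap_near aF i ox hx; have h2 := ap_near aG j ox hx.
  have h3 := ap_bound aF i ox hx; have h4 := ap_bound aG j ox hx.
  have h5 : Rabs (G j x) <= C' + e.
    have -> : G j x = T j x + (G j x - T j x) by ring.
    by apply: Rle_trans (Rabs_triang _ _) _; lra.
  apply: Rle_trans (Rabs_triang _ _) _; rewrite !Rabs_mult.
  by apply: Rplus_le_compat; apply: Rmult_le_compat => //; apply: Rabs_pos.
- by move=> x hx h; rewrite (ap_suppF aF hx h) (ap_suppP aF hx h); ring.
Qed.

Lemma prod_bound i j : Rabs (INR n * RInt (fun x => P i x * T j x) 0 1) <= INR d * (C * C').
Proof.
have pP := ap_pcP aF; have pT := ap_pcP aG.
have C0 := ap_C aF; have C'0 := ap_C aG.
apply: (int_bound (i := i)).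
- exact: pc_mult.
- nra.
- move=> x ox hx; have h3 := ap_bound aF i ox hx; have h4 := ap_bound aG j ox hx.
  by rewrite Rabs_mult; apply: Rmult_le_compat => //; apply: Rabs_pos.
- by move=> x hx h; rewrite (ap_suppP aF hx h); ring.
Qed.
End products.

Definition gb_fun Q mu p n := GBaux Q mu n p p.-1.
Definition gb_dfun Q mu p n := fun i x => gbder Q mu n p p.-1 i x / INR n.
Definition poly_fun p n := pspline (knot n p) p.
Definition poly_dfun p n := fun i x => pder (knot n p) p.-1 i x / INR n.

Section entries.
Variables (Q : gbkind) (mu : R) (p : nat).
Hypotheses (mu0 : 0 < mu) (p0 : (0 < p)%N).

Definition dbound := 2 * (pspline_bound p.-1 * INR p).

Lemma approx_ev e : 0 < e -> exists2 n0 : nat, (0 < n0)%N & forall n, (n0 <= n)%N ->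
  [/\ approx n p p.+1 (gb_fun Q mu p n) (poly_fun p n) (pspline_bound p) e,
      approx n p p.+1 (gb_dfun Q mu p n) (poly_dfun p n) dbound e &
      forall i x, off n x -> Derive (gb_fun Q mu p n i) x = INR n * gb_dfun Q mu p n i x].
Proof.
move=> e0; have [n0 n00 hn0] := gb_close_ev Q p p.-1 mu0 e0.
exists n0 => // n hn; have n1 : (0 < n)%N by lia.
have nn : 0 < INR n by apply: lt_0_INR; apply/ltP.
have [g1 g2 g3 g4 g5 g6 g7] := hn0 n hn; rewrite prednK // in g2 g3 g5 g6.
have sE := knotE p n1; have km := kapn_mono n p; have ks := kapn_step n p; have kl := kapn_le n p.
have b0 := pspline_bound_gt0 p; have b1 := pspline_bound_gt0 p.-1.
have p1 := INR_ge1 p.-1; rewrite prednK // in p1.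
have divn a : Rabs (a / INR n) = Rabs a / INR n.
  by rewrite /Rdiv Rabs_mult Rabs_inv (Rabs_pos_eq (INR n)) //; lra.
split.
- split=> //.
  + by move=> i; rewrite /poly_fun sE; apply: pc_pspline.
  + by rewrite /poly_fun sE; apply: pspline_supported.
  + by move=> i x _ hx; rewrite /poly_fun sE; apply: pspline_le.
  + by lra.
  + by lra.
- split.
  + by move=> i; apply: pc_div.
  + move=> i; apply: pc_div; apply: pc_minus; rewrite sE; apply: pc_dens => //; exact: pc_pspline.
  + by move=> i x hx h; rewrite /gb_dfun g5 //; rewrite /Rdiv; ring.
  + move=> i x hx h; rewrite /poly_dfun /pder.
    have sm j : knot n p j <= knot n p j.+1 by rewrite sE; apply: knot_monoS.
    have sp : supported (knot n p) (pspline (knot n p) p.-1) p.-1.+1.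
      by rewrite sE; apply: pspline_supported.
    by rewrite (supported_dens sm sp) ?prednK //; rewrite /Rdiv; ring.
  + move=> i x ox hx; rewrite /gb_dfun /poly_dfun.
    have -> (a b : R) : a / INR n - b / INR n = (a - b) / INR n by field; lra.
    rewrite divn.
    by apply/Rle_div_l => //; rewrite Rmult_comm; apply: g6.
  + move=> i x ox hx; rewrite /poly_dfun /pder divn; apply/Rle_div_l => //.
    have c1 := dens_pspline_le n1 km ks kl p.-1 i hx.
    have c2 := dens_pspline_le n1 km ks kl p.-1 i.+1 hx.
    rewrite -sE prednK // in c1 c2; rewrite prednK //.
    by apply: Rle_trans (Rabs_triang _ _) _; rewrite Rabs_Ropp /dbound; lra.
  + by rewrite /dbound; nra.
  + by lra.
- move=> i x ox; rewrite (is_derive_unique _ _ _ (g7 i x ox)) /gb_dfun; field; lra.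
Qed.

(** With derivatives divided by n, the three scalings 1/n, 1 and n of K, H and M become the same
    factor n, so one band lemma and one limit lemma serve all of them. *)
Definition entryM n i j := INR n * RInt (fun x => gb_fun Q mu p n j x * gb_fun Q mu p n i x) 0 1.
Definition entryK n i j := INR n * RInt (fun x => gb_dfun Q mu p n j x * gb_dfun Q mu p n i x) 0 1.
Definition entryH n i j := INR n * RInt (fun x => gb_dfun Q mu p n j x * gb_fun Q mu p n i x) 0 1.

Definition symM (k : nat) := cardB (2 * p + 1) (INR p + 1 - INR k).
Definition symK (k : nat) := - Derive_n (cardB (2 * p + 1)) 2 (INR p + 1 - INR k).

Definition banded (E : nat -> nat -> nat -> R) : Prop := exists C n0, forall n, (n0 <= n)%N ->
  (forall i j, (p < i - j + (j - i))%N -> E n i j = 0) /\ (forall i j, Rabs (E n i j) <= C).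

(** The spline indices p < i <= n are those with pairwise distinct knots. The sum of truncated
    differences is the distance between i and j. *)
Definition toeplitz_limit (E : nat -> nat -> nat -> R) (m : nat -> R) : Prop :=
  forall e, 0 < e -> exists n0, forall n, (n0 <= n)%N ->
  forall i j, (p < i <= n)%N -> (p < j <= n)%N -> Rabs (E n i j - m (i - j + (j - i))%N) <= e.

Lemma banded_gen (F G : nat -> nat -> R -> R) P T C C' :
  (exists2 n0 : nat, (0 < n0)%N & forall n, (n0 <= n)%N ->
    approx n p p.+1 (F n) (P n) C 1 /\ approx n p p.+1 (G n) (T n) C' 1) ->
  banded (fun n i j => INR n * RInt (fun x => F n j x * G n i x) 0 1).
Proof.
move=> [n0 n00 h]; exists (INR p.+1 * (1 * (C' + 1) + C * 1) + INR p.+1 * (C * C')), n0 => n hn.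
have n1 : (0 < n)%N by lia.
have [aF aG] := h n hn; split=> i j.
  by move=> hij; rewrite (prod_band n1 aF aG); [ring|lia].
have h1 := prod_near n1 aF aG j i; have h2 := prod_bound n1 aF aG j i.
set u := INR n * _ in h1 *; set v := INR n * _ in h1 h2.
have -> : u = (u - v) + v by ring.
by apply: Rle_trans (Rabs_triang _ _) _; lra.
Qed.

Lemma limit_gen (F G : nat -> nat -> R -> R) P T C C' m :
  0 <= C -> 0 <= C' ->
  (forall e, 0 < e -> exists2 n0 : nat, (0 < n0)%N & forall n, (n0 <= n)%N ->
    approx n p p.+1 (F n) (P n) C e /\ approx n p p.+1 (G n) (T n) C' e) ->
  (forall n i j, (0 < n)%N -> (p < i <= n)%N -> (p < j <= n)%N ->
     INR n * RInt (fun x => P n j x * T n i x) 0 1 = m (i - j + (j - i))%N) ->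
  toeplitz_limit (fun n i j => INR n * RInt (fun x => F n j x * G n i x) 0 1) m.
Proof.
move=> C0 C'0 h hm e e0; have p1 := INR_ge1 p.
have K0 : 0 < INR p.+1 * (C' + 1 + C) by nra.
pose e' := Rmin 1 (e / (INR p.+1 * (C' + 1 + C))).
have e'0 : 0 < e' by apply: Rmin_pos; [lra|apply: Rdiv_lt_0_compat].
have e'1 : e' <= 1 by exact: Rmin_l.
have e'2 : e' * (INR p.+1 * (C' + 1 + C)) <= e by apply/Rle_div_r => //; exact: Rmin_r.
have [n0 n00 hn0] := h e' e'0; exists n0 => n hn i j hi hj.
have n1 : (0 < n)%N by lia.
have [aF aG] := hn0 n hn; rewrite -(hm n i j n1 hi hj).
apply: Rle_trans (prod_near n1 aF aG j i) _; apply: Rle_trans _ e'2.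
have -> : e' * (INR p.+1 * (C' + 1 + C)) = INR p.+1 * (e' * (C' + 1 + C)) by ring.
apply: Rmult_le_compat_l; first lra.
nra.
Qed.

Lemma dist_cases i j : INR i - INR j = INR (i - j + (j - i))%N \/
  INR i - INR j = - INR (i - j + (j - i))%N.
Proof.
case: (leqP i j) => h; [right|left].
  have -> : (i - j + (j - i) = j - i)%N by lia.
  by rewrite minus_INR; [ring|lia].
have -> : (i - j + (j - i) = i - j)%N by lia.
by rewrite minus_INR; [ring|lia].
Qed.

(** Symmetry about the midpoint q + 1 of the support; it makes the limit entries depend on the
    distance of the indices only. *)
Lemma cardB_even q a : cardB (2 * q + 1) (INR q + 1 - - a) = cardB (2 * q + 1) (INR q + 1 - a).
Proof.
rewrite addn1 -(cardB_sym (2 * q) (INR q + 1 - a)) mult_INR (_ : INR 2 = 2) //.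
congr cardB; ring.
Qed.

Lemma entryM_banded : banded entryM.
Proof.
have [n0 n00 h] := approx_ev Rlt_0_1.
by apply: banded_gen; exists n0 => // n /h [? ? _]; split; eassumption.
Qed.

Lemma entryK_banded : banded entryK.
Proof.
have [n0 n00 h] := approx_ev Rlt_0_1.
by apply: banded_gen; exists n0 => // n /h [? ? _]; split; eassumption.
Qed.

Lemma entryH_banded : banded entryH.
Proof.
have [n0 n00 h] := approx_ev Rlt_0_1.
by apply: banded_gen; exists n0 => // n /h [? ? _]; split; eassumption.
Qed.

Lemma entryM_limit : toeplitz_limit entryM symM.
Proof.
have b0 := pspline_bound_gt0 p.
apply: (@limit_gen _ _ (poly_fun p) (poly_fun p) (pspline_bound p) (pspline_bound p)); try lra.
  by move=> e /approx_ev[n0 n00 h]; exists n0 => // n /h [? ? _]; split.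
move=> n i j n1 hi hj.
rewrite (RInt_ext _ (fun x => cardB p (INR n * x - INR (j - p.+1)) * cardB p (INR n * x - INR (i - p.+1)))); last first.
  by move=> x _; rewrite /poly_fun !pspline_interior //; lia.
rewrite cardB_gram_scaled //; try lia; rewrite /symM.
rewrite (_ : (i - j + (j - i) = (j - p.+1) - (i - p.+1) + ((i - p.+1) - (j - p.+1)))%N); last lia.
by case: (dist_cases (j - p.+1) (i - p.+1)) => ->; rewrite ?cardB_even.
Qed.

Lemma symK_E k : symK k = 2 * cardB (2 * p.-1 + 1) (INR p - INR k)
  - cardB (2 * p.-1 + 1) (INR p - (INR k - 1)) - cardB (2 * p.-1 + 1) (INR p - (INR k + 1)).
Proof.
rewrite /symK cardB_Derive_n2 // (_ : (2 * p - 1 = 2 * p.-1 + 1)%N); last lia.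
have -> : INR p + 1 - INR k - 1 = INR p - INR k by ring.
have -> : INR p + 1 - INR k - 2 = INR p - (INR k + 1) by ring.
have -> : INR p + 1 - INR k = INR p - (INR k - 1) by ring.
ring.
Qed.

(** The scaled derivatives are differences of two degree p - 1 splines. Their product expands into
    four Gram values of degree 2 (p - 1) + 1, which assemble into minus a second difference, that
    is, minus the second derivative in degree 2 p + 1. *)
Lemma entryK_limit : toeplitz_limit entryK symK.
Proof.
have d0 : 0 <= dbound.
  have := pspline_bound_gt0 p.-1; have := pos_INR p; rewrite /dbound; nra.
apply: (@limit_gen _ _ (poly_dfun p) (poly_dfun p) dbound dbound) => //.
  by move=> e /approx_ev[n0 n00 h]; exists n0 => // n /h [? ? _]; split.
move=> n i j n1 hi hj.
have nn : 0 < INR n by apply: lt_0_INR; apply/ltP.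
pose c a x := cardB p.-1 (INR n * x - INR a).
have pcc a b : pc n (fun x => c a x * c b x).
  by apply: pc_mult; apply: pc_comp_scale; apply: cardB_pc.
pose a := (j - p.+1)%N; pose b := (i - p.+1)%N.
rewrite (RInt_ext _ (fun x => (c a x * c b x + c a.+1 x * c b.+1 x) - (c a x * c b.+1 x + c a.+1 x * c b x))); last first.
  move=> x _; rewrite /poly_dfun !pder_interior //; try lia.
  by rewrite /c /a /b; fieldR; lra.
rewrite (pc_RInt_minus n1) ?(pc_RInt_plus n1) //; try exact: pc_plus.
rewrite /c Rmult_minus_distr_l !Rmult_plus_distr_l !cardB_gram_scaled //; try (rewrite /a /b; lia).
rewrite symK_E (_ : (i - j + (j - i) = a - b + (b - a))%N); last by rewrite /a /b; lia.
have hp : INR p.-1 + 1 = INR p by rewrite -S_INR prednK.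
rewrite !hp !S_INR.
have -> : INR a + 1 - (INR b + 1) = INR a - INR b by ring.
have -> : INR a - (INR b + 1) = INR a - INR b - 1 by ring.
have -> : INR a + 1 - INR b = INR a - INR b + 1 by ring.
have ev x : cardB (2 * p.-1 + 1) (INR p - - x) = cardB (2 * p.-1 + 1) (INR p - x).
  by have := cardB_even p.-1 x; rewrite hp.
case: (dist_cases a b) => ->; first ring.
set D := INR (a - b + (b - a)).
have -> : - D - 1 = - (D + 1) by ring.
have -> : - D + 1 = - (D - 1) by ring.
by rewrite !ev; ring.
Qed.
End entries.

(** At a knot [Derive] may return an arbitrary value, but knots lie on the grid and do not affect
    the integrals. *)
Lemma entry_Derive Q mu p : 0 < mu -> (0 < p)%N -> exists n0, forall n, (n0 <= n)%N -> forall i j,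
  / INR n * RInt (fun x => Derive (gb_fun Q mu p n j) x * Derive (gb_fun Q mu p n i) x) 0 1
    = entryK Q mu p n i j /\
  RInt (fun x => Derive (gb_fun Q mu p n j) x * gb_fun Q mu p n i x) 0 1 = entryH Q mu p n i j.
Proof.
move=> mu0 p0; have [n0 n00 h] := @approx_ev Q mu p mu0 p0 1 Rlt_0_1.
exists n0 => n hn i j; have [aF aG dE] := h n hn; have n1 : (0 < n)%N by lia.
have nn : 0 < INR n by apply: lt_0_INR; apply/ltP.
have pF := ap_pcF aF; have pG := ap_pcF aG.
rewrite /entryK /entryH; split.
  rewrite -(@pc_RInt_ext n n1 (fun x => INR n * (INR n * (gb_dfun Q mu p n j x * gb_dfun Q mu p n i x)))).
  - rewrite !(@pc_RInt_scal n n1); [by fieldR; lra|exact: pc_mult|].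
    by apply: pc_scal; apply: pc_mult.
  - by do 2!apply: pc_scal; apply: pc_mult.
  - by move=> x ox; rewrite !dE //; fieldR.
rewrite -(@pc_RInt_scal n n1); last exact: pc_mult.
symmetry; apply: (@pc_RInt_ext n n1); first by apply: pc_scal; apply: pc_mult.
by move=> x ox; rewrite dE //; fieldR.
Qed.

From mathcomp Require Import spectral ring lra.
Import Order.TTheory GRing.Theory Num.Theory Normc.
Local Open Scope ring_scope.
Bind Scope ring_scope with R.
Local Notation cplx x := (@Complex R x 0).

(** * Matrices with a symbol *)

Definition ev (P : nat -> Prop) : Prop := exists N, forall n, (N <= n)%N -> P n.

Lemma ev_and P Q : ev P -> ev Q -> ev (fun n => P n /\ Q n).
Proof.
move=> [N hN] [M hM]; exists (maxn N M) => n hn.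
by split; [apply: hN|apply: hM]; lia.
Qed.

Lemma ev_imp (P Q : nat -> Prop) : (forall n, P n -> Q n) -> ev P -> ev Q.
Proof. by move=> PQ [N hN]; exists N => n /hN /PQ. Qed.

Lemma ev_comp P (k : nat -> nat) : (forall N, ev (fun n => (N <= k n)%N)) -> ev P ->
  ev (fun n => P (k n)).
Proof. by move=> hk [N hN]; apply: ev_imp (hk N) => n /hN. Qed.

Lemma cos_le1 x : `|cos x| <= 1.
Proof. by have [/RleP h1 /RleP h2] := COS_bound x; rewrite ler_norml h1 h2. Qed.

Lemma sin_le1 x : `|sin x| <= 1.
Proof. by have [/RleP h1 /RleP h2] := SIN_bound x; rewrite ler_norml h1 h2. Qed.

Lemma sum_trig_le (I : finType) (F G : I -> R) : (forall i, `|G i| <= 1) ->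
  `|\sum_i F i * G i| <= \sum_i `|F i|.
Proof.
move=> hG; apply: le_trans (ler_norm_sum _ _ _) _; apply: ler_sum => i _.
by rewrite normrM ler_piMr.
Qed.

Lemma big_tens (V : nmodType) m n (F : 'I_m -> 'I_n -> V) :
  \sum_(k < m * n) F (mxtens_unindex k).1 (mxtens_unindex k).2 = \sum_i \sum_j F i j.
Proof.
rewrite pair_big (reindex (@mxtens_index m n)); last first.
  exists (@mxtens_unindex m n) => k _; first exact: mxtens_indexK.
  exact: mxtens_unindexK.
by apply: eq_bigr => -[i j] _; rewrite mxtens_indexK.
Qed.

Definition near1 (w i j : nat) : bool := (i <= j + w)%N && (j <= i + w)%N.
Definition inner1 (w m i : nat) : bool := (w <= i)%N && (i + w < m)%N.

Section one_dimension.
Variable m : nat -> nat.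

Definition bb1 (X : forall n, 'M[R]_(m n)) (C : R) (w : nat) : Prop :=
  ev (fun n => (forall i j : 'I_(m n), ~~ near1 w i j -> X n i j = 0) /\
               (forall i, \sum_j `|X n i j| <= C)).

Definition ph1 (i j : nat) (t : R) : R := (j%:R - i%:R) * t.

(* Interior rows of X act on the exponential of frequency t as multiplication by s t; separating real
   and imaginary parts avoids complex numbers. *)
Definition lim1 (X : forall n, 'M[R]_(m n)) (s : R -> R) (w : nat) : Prop :=
  forall e, 0 < e -> ev (fun n => forall i : 'I_(m n), inner1 w (m n) i -> forall t,
    `|\sum_j X n i j * cos (ph1 i j t) - s t| <= e /\
    `|\sum_j X n i j * sin (ph1 i j t)| <= e).
End one_dimension.

Section two_dimensions.
Variables m2 m1 : nat -> nat.
Local Notation idx n := 'I_(m2 n * m1 n).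

Definition px (a b : nat) (i : 'I_(a * b)) : nat := (mxtens_unindex i).1.
Definition py (a b : nat) (i : 'I_(a * b)) : nat := (mxtens_unindex i).2.

Definition ph (a b : nat) (i j : 'I_(a * b)) (t1 t2 : R) : R :=
  ph1 (px i) (px j) t1 + ph1 (py i) (py j) t2.

Lemma phD a b (i j k : 'I_(a * b)) t1 t2 : ph i j t1 t2 = ph i k t1 t2 + ph k j t1 t2.
Proof.
rewrite /ph /ph1; move: (px i)%:R (px j)%:R (px k)%:R (py i)%:R (py j)%:R (py k)%:R.
by move=> *; ring.
Qed.

Definition near2 (w a b : nat) (i j : 'I_(a * b)) : bool :=
  near1 w (px i) (px j) && near1 w (py i) (py j).
Definition inner2 (w a b : nat) (i : 'I_(a * b)) : bool :=
  inner1 w a (px i) && inner1 w b (py i).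

Definition bb2 (A : forall n, 'M[R]_(m2 n * m1 n)) (C : R) (w : nat) : Prop :=
  ev (fun n => (forall i j, ~~ near2 w i j -> A n i j = 0) /\
               (forall i, \sum_j `|A n i j| <= C)).

Definition lim2 (A : forall n, 'M[R]_(m2 n * m1 n)) (s : R -> R -> R) (w : nat) : Prop :=
  forall e, 0 < e -> ev (fun n => forall i : idx n, inner2 w i -> forall t1 t2,
    `|\sum_j A n i j * cos (ph i j t1 t2) - s t1 t2| <= e /\
    `|\sum_j A n i j * sin (ph i j t1 t2)| <= e).

(** [C] bounds the symbol and the row sums; [w] is both the bandwidth and the width of the boundary
    layer exempted from the limit. *)
Definition at2 (A : forall n, 'M[R]_(m2 n * m1 n)) (s : R -> R -> R) : Prop :=
  exists C w, [/\ 0 <= C, forall t1 t2, `|s t1 t2| <= C, bb2 A C w & lim2 A s w].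

Lemma near2_widen w w' a b (i j : 'I_(a * b)) : (w <= w')%N -> near2 w i j -> near2 w' i j.
Proof. rewrite /near2 /near1 => h; lia. Qed.

Lemma inner2_widen w w' a b (i : 'I_(a * b)) : (w <= w')%N -> inner2 w' i -> inner2 w i.
Proof. rewrite /inner2 /inner1 => h; lia. Qed.

Lemma at2_add A B s t : at2 A s -> at2 B t ->
  at2 (fun n => A n + B n) (fun t1 t2 => s t1 t2 + t t1 t2).
Proof.
move=> [C [w [C0 sC bA lA]]] [D [v [D0 tD bB lB]]].
exists (C + D), (maxn w v); split.
- by rewrite addr_ge0.
- by move=> t1 t2; apply: le_trans (ler_normD _ _) _; apply: lerD.
- apply: ev_imp (ev_and bA bB) => n [[zA rA] [zB rB]]; split=> [i j hij|i].
    rewrite mxE zA ?zB ?addr0 //; apply: contra hij; apply: near2_widen; lia.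
  apply: le_trans (lerD (rA i) (rB i)); rewrite -big_split /=.
  by apply: ler_sum => j _; rewrite mxE; apply: ler_normD.
- move=> e e0; have e20 : 0 < e / 2 by lra.
  apply: ev_imp (ev_and (lA _ e20) (lB _ e20)) => n [hA hB] i hi t1 t2.
  have [|a1 a2] := hA i _ t1 t2; first by apply: inner2_widen hi; lia.
  have [|b1 b2] := hB i _ t1 t2; first by apply: inner2_widen hi; lia.
  have E (G : idx n -> R) : \sum_j (A n + B n) i j * G j = \sum_j A n i j * G j + \sum_j B n i j * G j.
    by rewrite -big_split; apply: eq_bigr => j _; rewrite mxE mulrDl.
  rewrite !E; split.
    rewrite opprD addrACA; apply: le_trans (ler_normD _ _) _; lra.
  by apply: le_trans (ler_normD _ _) _; lra.
Qed.

Definition conv (c : nat -> R) (l : R) : Prop := forall e, 0 < e -> ev (fun n => `|c n - l| <= e).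

Lemma conv_bounded c l : conv c l -> ev (fun n => `|c n| <= `|l| + 1).
Proof.
move=> h; apply: ev_imp (h 1 ltr01) => n hn.
by rewrite -[c n](subrK l); apply: le_trans (ler_normD _ _) _; lra.
Qed.

Lemma bb2_scale A C w c K : 0 <= C -> 0 <= K -> bb2 A C w -> ev (fun n => `|c n| <= K) ->
  bb2 (fun n => c n *: A n) (K * C) w.
Proof.
move=> C0 K0 bA hc; apply: ev_imp (ev_and bA hc) => n [[zA rA] hK]; split=> [i j hij|i].
  by rewrite mxE zA ?mulr0.
apply: le_trans (ler_pM _ _ hK (rA i)); rewrite ?sumr_ge0 ?mulr_sumr //.
by apply: ler_sum => j _; rewrite mxE normrM.
Qed.

Lemma scale_sum n (A : 'M[R]_(m2 n * m1 n)) c i (G : idx n -> R) :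
  \sum_j (c *: A) i j * G j = c * \sum_j A i j * G j.
Proof. by rewrite mulr_sumr; apply: eq_bigr => j _; rewrite mxE mulrA. Qed.

Lemma at2_scale A s c l : conv c l -> at2 A s ->
  at2 (fun n => c n *: A n) (fun t1 t2 => l * s t1 t2).
Proof.
move=> hc [C [w [C0 sC bA lA]]]; have hK := conv_bounded hc.
have K0 : 0 <= `|l| + 1 by rewrite addr_ge0.
exists ((`|l| + 1) * C), w; split.
- exact: mulr_ge0.
- move=> t1 t2; rewrite normrM; apply: ler_pM => //; lra.
- exact: bb2_scale.
- move=> e e0.
  pose e1 := e / (2 * (`|l| + 1)); pose e2 := e / (2 * (C + 1)).
  have l0 : 0 <= `|l| by [].
  have e10 : 0 < e1 by rewrite divr_gt0 // mulr_gt0 //; lra.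
  have e20 : 0 < e2 by rewrite divr_gt0 // mulr_gt0 //; lra.
  have E1 : (`|l| + 1) * e1 = e / 2 by rewrite /e1; field; lra.
  have E2 : (C + 1) * e2 = e / 2 by rewrite /e2; field; lra.
  apply: ev_imp (ev_and (ev_and (lA _ e10) (hc _ e20)) hK) => n [[hA hcn] hKn] i hi t1 t2.
  have [a1 a2] := hA i hi t1 t2; rewrite !scale_sum; split.
    set S := \sum_j _ in a1 *.
    have -> : c n * S - l * s t1 t2 = c n * (S - s t1 t2) + (c n - l) * s t1 t2 by ring.
    apply: le_trans (ler_normD _ _) _; rewrite !normrM.
    have : `|c n| * `|S - s t1 t2| <= (`|l| + 1) * e1 by apply: ler_pM.
    have : `|c n - l| * `|s t1 t2| <= e2 * C by apply: ler_pM.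
    lra.
  rewrite normrM; have : `|c n| * `|\sum_j A n i j * sin (ph i j t1 t2)| <= (`|l| + 1) * e1 by apply: ler_pM.
  lra.
Qed.

(** For the lower order terms bounded row sums suffice: a vanishing coefficient gives the symbol 0
    whatever the rows do. *)
Lemma at2_vanish A c C w : 0 <= C -> bb2 A C w -> conv c 0 ->
  at2 (fun n => c n *: A n) (fun _ _ => 0).
Proof.
move=> C0 bA hc; exists C, w; split=> //.
- by move=> _ _; rewrite normr0.
- have := @bb2_scale A C w c 1 C0 ler01 bA; rewrite mul1r; apply.
  by apply: ev_imp (hc 1 ltr01) => n; rewrite subr0.
- move=> e e0; have e10 : 0 < e / (C + 1) by rewrite divr_gt0 //; lra.
  have E1 : e / (C + 1) * (C + 1) = e by field; lra.
  apply: ev_imp (ev_and bA (hc _ e10)) => n [[_ rA]]; rewrite subr0 => hcn i hi t1 t2.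
  have key G : (forall j, `|G j| <= 1) -> `|\sum_j (c n *: A n) i j * G j| <= e.
    move=> hG; rewrite scale_sum normrM.
    have h1 := le_trans (sum_trig_le (A n i) hG) (rA i).
    have : `|c n| * `|\sum_j A n i j * G j| <= e / (C + 1) * C by apply: ler_pM.
    lra.
  by rewrite subr0; split; apply: key => j; [apply: cos_le1|apply: sin_le1].
Qed.

(** The phase is additive along i, k, j by [phD], so the rows of B turn the exponential at k into t
    times itself, and the row of A then contributes s. Bandwidths and boundary layers add. *)
Lemma at2_mul A B s t : at2 A s -> at2 B t ->
  at2 (fun n => A n *m B n) (fun t1 t2 => s t1 t2 * t t1 t2).
Proof.
move=> [C [w [C0 sC bA lA]]] [D [v [D0 tD bB lB]]].
exists (C * D), (w + v)%N; split.
- exact: mulr_ge0.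
- by move=> t1 t2; rewrite normrM; apply: ler_pM.
- apply: ev_imp (ev_and bA bB) => n [[zA rA] [zB rB]]; split=> [i j hij|i].
    rewrite mxE big1 // => k _.
    have [h1|h1] := boolP (near2 w i k); last by rewrite zA ?mul0r.
    have [h2|h2] := boolP (near2 v k j); last by rewrite zB ?mulr0.
    by move: hij h1 h2; rewrite /near2 /near1; lia.
  apply: (@le_trans _ _ (\sum_j \sum_k `|A n i k| * `|B n k j|)).
    apply: ler_sum => j _; rewrite mxE; apply: le_trans (ler_norm_sum _ _ _) _.
    by apply: ler_sum => k _; rewrite normrM.
  rewrite exchange_big /=; apply: (@le_trans _ _ (\sum_k `|A n i k| * D)).
    by apply: ler_sum => k _; rewrite -mulr_sumr ler_wpM2l.
  by rewrite -mulr_suml ler_wpM2r.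
- move=> e e0.
  pose e1 := e / (2 * (D + 1)); pose e2 := e / (4 * (C + 1)).
  have e10 : 0 < e1 by rewrite divr_gt0 // mulr_gt0 //; lra.
  have e20 : 0 < e2 by rewrite divr_gt0 // mulr_gt0 //; lra.
  have E1 : (D + 1) * e1 = e / 2 by rewrite /e1; field; lra.
  have E2 : (C + 1) * e2 = e / 4 by rewrite /e2; field; lra.
  apply: ev_imp (ev_and (ev_and bA (lA _ e10)) (lB _ e20)) => n [[[zA rA] hA] hB] i hi t1 t2.
  have [|a1 a2] := hA i _ t1 t2; first by apply: inner2_widen hi; lia.
  pose Bc k := \sum_j B n k j * cos (ph k j t1 t2).
  pose Bs k := \sum_j B n k j * sin (ph k j t1 t2).
  (* A nonzero entry forces k within w of i, so k is interior for B because i is interior with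
     margin w + v. *)
  have hk k : A n i k != 0 -> `|Bc k - t t1 t2| <= e2 /\ `|Bs k| <= e2.
    move=> Aik; apply: hB; have : near2 w i k by apply: contraR Aik => /zA ->.
    by move: hi; rewrite /inner2 /inner1 /near2 /near1; lia.
  have Ec : \sum_j (A n *m B n) i j * cos (ph i j t1 t2) =
      \sum_k A n i k * (cos (ph i k t1 t2) * Bc k - sin (ph i k t1 t2) * Bs k).
    under eq_bigr do rewrite mxE mulr_suml.
    rewrite exchange_big /=; apply: eq_bigr => k _.
    rewrite /Bc /Bs !mulr_sumr -sumrB mulr_sumr; apply: eq_bigr => j _.
    rewrite (phD i j k) cosD; ring.
  have Es : \sum_j (A n *m B n) i j * sin (ph i j t1 t2) =
      \sum_k A n i k * (sin (ph i k t1 t2) * Bc k + cos (ph i k t1 t2) * Bs k).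
    under eq_bigr do rewrite mxE mulr_suml.
    rewrite exchange_big /=; apply: eq_bigr => k _.
    rewrite /Bc /Bs !mulr_sumr -big_split mulr_sumr; apply: eq_bigr => j _ /=.
    rewrite (phD i j k) sinD; ring.
  have err (F G : idx n -> R) : (forall k, `|F k| <= 1) -> (forall k, `|G k| <= 1) ->
      `|\sum_k A n i k * (F k * (Bc k - t t1 t2) + G k * Bs k)| <= e / 2.
    move=> hF hG; apply: (@le_trans _ _ (\sum_k `|A n i k| * (2 * e2))).
      apply: le_trans (ler_norm_sum _ _ _) _; apply: ler_sum => k _; rewrite normrM.
      have [->|Aik] := eqVneq (A n i k) 0; first by rewrite normr0 !mul0r.
      have [k1 k2] := hk k Aik; apply: ler_wpM2l => //.
      apply: le_trans (ler_normD _ _) _; rewrite !normrM.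
      have : `|F k| * `|Bc k - t t1 t2| <= 1 * e2 by apply: ler_pM.
      have : `|G k| * `|Bs k| <= 1 * e2 by apply: ler_pM.
      lra.
    rewrite -mulr_suml; have : (\sum_k `|A n i k|) * (2 * e2) <= C * (2 * e2).
      by rewrite ler_wpM2r //; lra.
    lra.
  rewrite Ec Es; split.
    have -> : \sum_k A n i k * (cos (ph i k t1 t2) * Bc k - sin (ph i k t1 t2) * Bs k) - s t1 t2 * t t1 t2
      = \sum_k A n i k * (cos (ph i k t1 t2) * (Bc k - t t1 t2) + (- sin (ph i k t1 t2)) * Bs k)
        + t t1 t2 * (\sum_k A n i k * cos (ph i k t1 t2) - s t1 t2).
      rewrite mulrBr addrA mulr_sumr -big_split /= [t _ _ * s _ _]mulrC; congr (_ - _).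
      by apply: eq_bigr => k _; ring.
    apply: le_trans (ler_normD _ _) _.
    have h1 := err (fun k => cos (ph i k t1 t2)) (fun k => - sin (ph i k t1 t2))
      (fun k => cos_le1 _) (fun k => ltac:(rewrite normrN; exact: sin_le1)).
    rewrite normrM; set T := \sum_k _ in a1 *.
    have : `|t t1 t2| * `|T - s t1 t2| <= D * e1 by apply: ler_pM.
    lra.
  have -> : \sum_k A n i k * (sin (ph i k t1 t2) * Bc k + cos (ph i k t1 t2) * Bs k)
    = \sum_k A n i k * (sin (ph i k t1 t2) * (Bc k - t t1 t2) + cos (ph i k t1 t2) * Bs k)
      + t t1 t2 * (\sum_k A n i k * sin (ph i k t1 t2)).
    by rewrite mulr_sumr -big_split /=; apply: eq_bigr => k _; ring.
  apply: le_trans (ler_normD _ _) _.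
  have h1 := err (fun k => sin (ph i k t1 t2)) (fun k => cos (ph i k t1 t2))
    (fun k => sin_le1 _) (fun k => cos_le1 _).
  rewrite normrM; set T := \sum_k _ in a2 *.
  have : `|t t1 t2| * `|T| <= D * e1 by apply: ler_pM.
  lra.
Qed.

Lemma ph_diag a b (i : 'I_(a * b)) t1 t2 : ph i i t1 t2 = 0.
Proof. rewrite /ph /ph1 !subrr; ring. Qed.

Lemma at2_1 : at2 (fun n => 1%:M) (fun _ _ => 1).
Proof.
have E n (i : idx n) (G : idx n -> R) : \sum_j (1%:M : 'M[R]_(m2 n * m1 n)) i j * G j = G i.
  rewrite (bigD1 i) //= mxE eqxx mul1r big1 ?addr0 // => j /negPf ne.
  by rewrite mxE eq_sym ne mul0r.
exists 1, 0%N; split=> //.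
- by move=> _ _; rewrite normr1.
- exists 0%N => n _; split=> [i j|i].
    by rewrite mxE; case: eqP => // ->; rewrite /near2 /near1; lia.
  have := E n i (fun=> 1); under eq_bigr do rewrite mulr1.
  by move=> h; rewrite -[X in _ <= X]h; apply: ler_sum => j _; rewrite mxE normr_nat.
- move=> e e0; exists 0%N => n _ i _ t1 t2; rewrite !E ph_diag.
  by rewrite cos_0 sin_0 subrr normr0; split; apply: ltW.
Qed.

Lemma at2_exp A s k : at2 A s -> at2 (fun n => A n ^+ k) (fun t1 t2 => s t1 t2 ^+ k).
Proof.
move=> hA; elim: k => [|k IH]; first exact: at2_1.
have := at2_mul hA IH; rewrite /at2 /bb2 /lim2.
move=> [C [w [h1 h2 h3 h4]]]; exists C, w; split=> //.
- by move=> t1 t2; rewrite exprS.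
- by move: h3; apply: ev_imp => n; rewrite exprS.
- by move=> e e0; move: (h4 e e0); apply: ev_imp => n; rewrite exprS => h i hi t1 t2; rewrite exprS; apply: h.
Qed.

Lemma bb2_tens (X : forall n, 'M[R]_(m2 n)) (Y : forall n, 'M[R]_(m1 n)) C D w v :
  0 <= C -> 0 <= D -> bb1 X C w -> bb1 Y D v ->
  bb2 (fun n => X n *t Y n) (C * D) (maxn w v).
Proof.
move=> C0 D0 bX bY; apply: ev_imp (ev_and bX bY) => n [[zX rX] [zY rY]]; split=> [i j hij|i].
  rewrite mxE; have [h1|h1] := boolP (near1 w (px i) (px j)); last by rewrite zX ?mul0r.
  have [h2|h2] := boolP (near1 v (py i) (py j)); last by rewrite zY ?mulr0.
  by move: hij h1 h2; rewrite /near2 /near1; lia.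
under eq_bigr do rewrite mxE normrM.
rewrite (big_tens (fun j1 j2 => `|X n (mxtens_unindex i).1 j1| * `|Y n (mxtens_unindex i).2 j2|)).
under eq_bigr do rewrite -mulr_sumr.
by rewrite -mulr_suml; apply: ler_pM => //; rewrite sumr_ge0.
Qed.

(** The two-dimensional exponential is a product of one-dimensional ones, so the sums over a row
    factor; the addition formulas are its real and imaginary parts. *)
Lemma at2_tens (X : forall n, 'M[R]_(m2 n)) (Y : forall n, 'M[R]_(m1 n)) s t C D w v :
  0 <= C -> 0 <= D -> (forall x, `|s x| <= C) -> (forall x, `|t x| <= D) ->
  bb1 X C w -> bb1 Y D v -> lim1 X s w -> lim1 Y t v ->
  at2 (fun n => X n *t Y n) (fun t1 t2 => s t1 * t t2).
Proof.
move=> C0 D0 sC tD bX bY lX lY; exists (C * D), (maxn w v); split.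
- exact: mulr_ge0.
- by move=> t1 t2; rewrite normrM; apply: ler_pM.
- exact: bb2_tens.
move=> e e0.
(* The cap at 1 bounds a product of two errors by a single one. *)
pose e1 := Order.min 1 (e / (3 * (C + D + 1))).
have p0 : 0 < 3 * (C + D + 1) by lra.
have e10 : 0 < e1 by rewrite lt_min ltr01 divr_gt0.
have e11 : e1 <= 1 by rewrite ge_min lexx.
have e12 : e1 * (3 * (C + D + 1)) <= e by rewrite -ler_pdivlMr // ge_min lexx orbT.
apply: ev_imp (ev_and (lX _ e10) (lY _ e10)) => n [hX hY] i /andP[hi1 hi2] t1 t2.
have [|x1 x2] := hX (mxtens_unindex i).1 _ t1; first by move: hi1; rewrite /inner1 /px; lia.
have [|y1 y2] := hY (mxtens_unindex i).2 _ t2; first by move: hi2; rewrite /inner1 /py; lia.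
set xc := \sum_j X n _ j * cos _ in x1; set xs := \sum_j X n _ j * sin _ in x2.
set yc := \sum_j Y n _ j * cos _ in y1; set ys := \sum_j Y n _ j * sin _ in y2.
have -> : \sum_j (X n *t Y n) i j * cos (ph i j t1 t2) = xc * yc - xs * ys.
  under eq_bigr do rewrite mxE /ph cosD.
  rewrite (big_tens (fun j1 j2 => X n (mxtens_unindex i).1 j1 * Y n (mxtens_unindex i).2 j2 *
    (cos (ph1 (px i) j1 t1) * cos (ph1 (py i) j2 t2) - sin (ph1 (px i) j1 t1) * sin (ph1 (py i) j2 t2)))).
  rewrite /xc /xs !mulr_suml -sumrB; apply: eq_bigr => j1 _.
  rewrite /yc /ys !mulr_sumr -sumrB; apply: eq_bigr => j2 _; rewrite /px /py; ring.
have -> : \sum_j (X n *t Y n) i j * sin (ph i j t1 t2) = xs * yc + xc * ys.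
  under eq_bigr do rewrite mxE /ph sinD.
  rewrite (big_tens (fun j1 j2 => X n (mxtens_unindex i).1 j1 * Y n (mxtens_unindex i).2 j2 *
    (sin (ph1 (px i) j1 t1) * cos (ph1 (py i) j2 t2) + cos (ph1 (px i) j1 t1) * sin (ph1 (py i) j2 t2)))).
  rewrite /xc /xs !mulr_suml -big_split; apply: eq_bigr => j1 _ /=.
  rewrite /yc /ys !mulr_sumr -big_split; apply: eq_bigr => j2 _; rewrite /px /py /=; ring.
have hs := sC t1; have ht := tD t2.
have q1 : `|xc| <= C + 1.
  by rewrite -[xc](subrK (s t1)); apply: le_trans (ler_normD _ _) _; lra.
have q2 : `|yc| <= D + 1.
  by rewrite -[yc](subrK (t t2)); apply: le_trans (ler_normD _ _) _; lra.
split.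
  have -> : xc * yc - xs * ys - s t1 * t t2 = xc * (yc - t t2) + (xc - s t1) * t t2 + (- xs) * ys by ring.
  apply: le_trans (ler_normD _ _) _; apply: le_trans (lerD (ler_normD _ _) (lexx _)) _.
  rewrite !normrM normrN.
  have : `|xc| * `|yc - t t2| <= (C + 1) * e1 by apply: ler_pM.
  have : `|xc - s t1| * `|t t2| <= e1 * D by apply: ler_pM.
  have : `|xs| * `|ys| <= e1 * 1 by apply: ler_pM => //; lra.
  have := mulr_ge0 (ltW e10) C0; have := mulr_ge0 (ltW e10) D0; lra.
apply: le_trans (ler_normD _ _) _; rewrite !normrM.
have : `|xs| * `|yc| <= e1 * (D + 1) by apply: ler_pM.
have : `|xc| * `|ys| <= (C + 1) * e1 by apply: ler_pM.
have := mulr_ge0 (ltW e10) C0; have := mulr_ge0 (ltW e10) D0; lra.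
Qed.
End two_dimensions.

(** * Traces *)

Lemma sum_bool_iota (P : pred nat) m (s : seq nat) :
  {subset [seq i <- iota 0 m | P i] <= s} -> (\sum_(i < m) P i <= size s)%N.
Proof.
move=> sub; rewrite -(big_mkord xpredT (fun i => P i : nat)).
have -> : (\sum_(0 <= i < m) P i)%N = size [seq i <- iota 0 m | P i].
  rewrite size_filter -sum1_count [RHS]big_mkcond /= /index_iota subn0.
  by apply: eq_bigr => i _; case: (P i).
by apply: uniq_leq_size => //; apply: filter_uniq; apply: iota_uniq.
Qed.

Lemma sum_near1_le p m i : (\sum_(j < m) near1 p i j <= p.*2.+1)%N.
Proof.
rewrite -[X in (_ <= X)%N](size_iota (i - p)); apply: sum_bool_iota => j.
rewrite mem_filter !mem_iota /near1; lia.
Qed.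

Lemma sum_inner1_le w m : (\sum_(i < m) ~~ inner1 w m i <= w.*2)%N.
Proof.
have <- : size (iota 0 w ++ iota (m - w) w) = w.*2 by rewrite size_cat !size_iota addnn.
apply: (@sum_bool_iota (fun i => ~~ inner1 w m i)) => i.
rewrite mem_filter mem_cat !mem_iota /inner1; lia.
Qed.

Lemma sum_window (F : nat -> R) p m i :
  (forall j, (j < m)%N -> ~~ near1 p i j -> F j = 0) -> inner1 p m i ->
  \sum_(j < m) F j = F i + \sum_(1 <= k < p.+1) (F (i - k)%N + F (i + k)%N).
Proof.
move=> F0 /andP[h1 h2]; rewrite -(big_mkord xpredT F).
rewrite (@big_cat_nat _ _ _ (i - p)) //=; [|lia].
rewrite (@big_cat_nat _ _ _ (i + p).+1 (i - p)) //=; [|lia].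
rewrite big_nat_cond big1 ?add0r; last first.
  by move=> j hj; apply: F0; rewrite /near1; lia.
rewrite addrC big_nat_cond big1 ?add0r; last first.
  by move=> j hj; apply: F0; rewrite /near1; lia.
elim: p h1 {F0 h2} => [|p IH] h1.
  by rewrite subn0 addn0 big_nat1 big_geq // addr0.
rewrite big_ltn; last lia.
rewrite addnS big_nat_recr /=; last lia.
rewrite [in RHS]big_nat_recr //= (_ : (i - p.+1).+1 = (i - p)%N); last lia.
rewrite IH; last lia.
by rewrite addnS; ring.
Qed.

(** * Symbols of matrices with nearly Toeplitz entries *)

Definition cos_series (p : nat) (c : nat -> R) (t : R) : R :=
  c 0%N + 2 * \sum_(1 <= k < p.+1) c k * cos (k%:R * t)%R.

Lemma cos_series_bound p c t : `|cos_series p c t| <= `|c 0%N| + 2 * \sum_(1 <= k < p.+1) `|c k|.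
Proof.
apply: le_trans (ler_normD _ _) _; rewrite lerD2l normrM ger0_norm // ler_pM2l //.
apply: le_trans (ler_norm_sum _ _ _) _; apply: ler_sum => k _.
by rewrite normrM ler_piMr // cos_le1.
Qed.

(** The offset 2 leads from 0-based matrix indices to spline indices. The margin 2 p + 1 keeps the
    whole band of row i in the range of [toeplitz_limit]. *)
Lemma inner_entry n p i k : inner1 p.*2.+1 (mdim n p) i -> (k < p.+1)%N ->
  [/\ (p < i.+2 <= n)%N, (p < (i - k).+2 <= n)%N, (p < (i + k).+2 <= n)%N & (k <= i)%N].
Proof. rewrite /inner1 /mdim => hi hk; split; lia. Qed.

Section from_entries.
Variables (p : nat) (E : nat -> nat -> nat -> R).

Definition entry_mx (n : nat) : 'M[R]_(mdim n p) := \matrix_(i, j) E n i.+2 j.+2.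

Lemma banded_bb1 : banded p E -> exists2 C, 0 <= C &
  forall w, (p <= w)%N -> bb1 entry_mx C w.
Proof.
move=> [C [n0 h]].
have C0 : 0 <= C by have [_ /(_ 0%N 0%N) /RleP] := h n0 (leqnn _); rewrite RabsE; apply: le_trans.
exists (C * p.*2.+1%:R) => [|w pw]; first exact: mulr_ge0.
exists n0 => n hn; have [h1 h2] := h n hn; split=> [i j hij|i].
  by rewrite mxE h1 //; move: hij; rewrite /near1; lia.
apply: (@le_trans _ _ (\sum_(j < mdim n p) C * (near1 p i j)%:R)).
  apply: ler_sum => j _; rewrite mxE; have [hij|hij] := boolP (near1 p i j).
    by rewrite mulr1; have /RleP := h2 i.+2 j.+2; rewrite RabsE.
  by rewrite h1 ?normr0 ?mulr0 //; move: hij; rewrite /near1; lia.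
by rewrite -mulr_sumr -natr_sum ler_wpM2l // ler_nat sum_near1_le.
Qed.

(** Entries at equal distance on both sides of the diagonal have the same limit, so they pair into
    cosines and their sine contributions cancel. *)
Lemma toeplitz_lim1 c : banded p E -> toeplitz_limit p E c ->
  lim1 entry_mx (cos_series p c) p.*2.+1.
Proof.
move=> [C [n0 hb]] ht e e0.
(* A row has at most 2 p + 1 nonzero entries. *)
pose e1 := e / (p.*2.+1)%:R.
have q0 : 0 < (p.*2.+1)%:R :> R by rewrite ltr0n.
have e10 : 0 < e1 by rewrite divr_gt0.
have /RltP e10' := e10; have [n1 h1] := ht e1 e10'.
exists (maxn n0 n1) => n hn i hi t.
have [z _] := hb n ltac:(lia).
have near a b : (p < a <= n)%N -> (p < b <= n)%N -> `|E n a b - c (a - b + (b - a))%N| <= e1.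
  by move=> ha hb'; have /RleP := h1 n ltac:(lia) a b ha hb'; rewrite RabsE.
have hi' : inner1 p (mdim n p) i by move: hi; rewrite /inner1; lia.
have bnd k : (1 <= k < p.+1)%N -> `|E n i.+2 (i - k).+2 - c k| <= e1 /\ `|E n i.+2 (i + k).+2 - c k| <= e1.
  move=> /andP[_ hk]; have [a1 a2 a3 a4] := inner_entry hi hk; split.
    by have := near _ _ a1 a2; rewrite (_ : (i.+2 - (i - k).+2 + ((i - k).+2 - i.+2) = k)%N) //; lia.
  by have := near _ _ a1 a3; rewrite (_ : (i.+2 - (i + k).+2 + ((i + k).+2 - i.+2) = k)%N) //; lia.
have win (f : R -> R) : \sum_(j < mdim n p) entry_mx n i j * f (ph1 i j t) =
    E n i.+2 i.+2 * f 0 + \sum_(1 <= k < p.+1)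
      (E n i.+2 (i - k).+2 * f (- (k%:R * t)) + E n i.+2 (i + k).+2 * f (k%:R * t)).
  under eq_bigr do rewrite mxE.
  rewrite (@sum_window (fun j => E n i.+2 j.+2 * f (ph1 i j t)) p _ i) //; last first.
    by move=> j hj hij; rewrite z ?mul0r //; move: hij; rewrite /near1; lia.
  congr (_ * f _ + _); first by rewrite /ph1 subrr mul0r.
  rewrite !big_nat; apply: eq_bigr => k hk; rewrite /ph1.
  move: hi'; rewrite /inner1 => /andP[a1 a2].
  rewrite natrB ?natrD; last lia.
  by congr (_ * f _ + _ * f _); ring.
have tot : e1 + \sum_(1 <= k < p.+1) (e1 + e1) = e.
  rewrite sumr_const_nat subn1 /= -mulr2n -mulrnA mul2n -mulrS.
  by rewrite -mulr_natr /e1 -mulrA mulVf ?mulr1 //; apply: lt0r_neq0.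
split.
  rewrite win cos_0 mulr1 /cos_series mulr_sumr opprD addrACA -sumrB -[X in _ <= X]tot.
  apply: le_trans (ler_normD _ _) _; apply: lerD.
    have := @near i.+2 i.+2; rewrite subnn; apply; move: hi; rewrite /inner1 /mdim; lia.
  apply: le_trans (ler_norm_sum _ _ _) _; rewrite !big_nat; apply: ler_sum => k hk.
  have [b1 b2] := bnd k hk; rewrite cos_neg.
  set u := cos _; have hu : `|u| <= 1 by exact: cos_le1.
  have -> : E n i.+2 (i - k).+2 * u + E n i.+2 (i + k).+2 * u - 2 * (c k * u) =
    (E n i.+2 (i - k).+2 - c k) * u + (E n i.+2 (i + k).+2 - c k) * u by ring.
  apply: le_trans (ler_normD _ _) _; rewrite !normrM.
  by apply: lerD; rewrite -[e1]mulr1; apply: ler_pM.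
rewrite win sin_0 mulr0 add0r -[X in _ <= X]tot.
apply: le_trans (_ : \sum_(1 <= k < p.+1) (e1 + e1) <= _); last by rewrite lerDr ltW.
apply: le_trans (ler_norm_sum _ _ _) _; rewrite !big_nat; apply: ler_sum => k hk.
have [b1 b2] := bnd k hk; rewrite sin_neg.
set u := sin _; have hu : `|u| <= 1 by exact: sin_le1.
have -> : E n i.+2 (i - k).+2 * - u + E n i.+2 (i + k).+2 * u =
  (E n i.+2 (i - k).+2 - c k) * - u + (E n i.+2 (i + k).+2 - c k) * u by ring.
apply: le_trans (ler_normD _ _) _; rewrite !normrM normrN.
by apply: lerD; rewrite -[e1]mulr1; apply: ler_pM.
Qed.
End from_entries.

(** * Mean over the frequencies and the averaged trace *)

Lemma px_py_inj a b (i j : 'I_(a * b)) : px i = px j -> py i = py j -> i = j.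
Proof.
rewrite /px /py => h1 h2; rewrite -(mxtens_unindexK i) -(mxtens_unindexK j).
congr mxtens_index; case: (mxtens_unindex i) (mxtens_unindex j) h1 h2 => [? ?] [? ?] /= h1 h2.
by congr pair; apply: val_inj.
Qed.

Lemma ph_IZR a b (i j : 'I_(a * b)) t1 t2 : ph i j t1 t2 =
  (IZR (Z.sub (Z.of_nat (px j)) (Z.of_nat (px i))) * t1
   + IZR (Z.sub (Z.of_nat (py j)) (Z.of_nat (py i))) * t2)%R.
Proof. by rewrite !minus_IZR -!INR_IZR_INZ !INRE. Qed.

Lemma buc_ph a b (i j : 'I_(a * b)) : buc (fun t1 t2 => cos (ph i j t1 t2)).
Proof.
have := buc_cos (IZR (Z.sub (Z.of_nat (px j)) (Z.of_nat (px i)))) (IZR (Z.sub (Z.of_nat (py j)) (Z.of_nat (py i)))).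
congr buc; apply: functional_extensionality => t1.
by apply: functional_extensionality => t2; rewrite ph_IZR.
Qed.

Definition mean2 (f : R -> R -> R) : R := (4 * PI ^+ 2)^-1 * dint f.

Lemma pi2_gt0 : 0 < 4 * PI ^+ 2 :> R.
Proof. by rewrite mulr_gt0 // exprn_gt0 //; apply/RltP; exact: PI_RGT_0. Qed.

Lemma four_PI2 : (4 * PI ^ 2)%coqR = 4 * PI ^+ 2.
Proof. by rewrite RmultE RpowE IZRposE INRE. Qed.

Lemma mean2_ph a b (i j : 'I_(a * b)) : mean2 (fun t1 t2 => cos (ph i j t1 t2)) = (i == j)%:R.
Proof.
rewrite /mean2; have := dint_cos (Z.sub (Z.of_nat (px j)) (Z.of_nat (px i))) (Z.sub (Z.of_nat (py j)) (Z.of_nat (py i))).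
rewrite (@dint_ext _ (fun t1 t2 => cos (ph i j t1 t2))); last by move=> t1 t2; rewrite ph_IZR.
move=> ->; have n0 := lt0r_neq0 pi2_gt0; set P := (4 * _)%coqR.
have PE : P = 4 * PI ^+ 2 := four_PI2.
have [->|ne] := eqVneq i j.
  case: Z.eq_dec => [e1|] /=; last lia.
  case: Z.eq_dec => [e2|] /=; last lia.
  by rewrite PE mulVf.
case: Z.eq_dec => [e1|e1] /=; last by rewrite mulr0.
case: Z.eq_dec => [e2|e2] /=; last by rewrite mulr0.
by case/eqP: ne; apply: px_py_inj; lia.
Qed.

Lemma mean2_bound f e : buc f -> (forall x y, `|f x y| <= e) -> `|mean2 f| <= e.
Proof.
move=> bf fe; have p0 := pi2_gt0.
have /RleP := @dint_bound f e bf (fun x y => ltac:(rewrite RabsE; apply/RleP; exact: fe)).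
rewrite RabsE four_PI2 => h.
by rewrite /mean2 normrM gtr0_norm ?invr_gt0 // mulrC ler_pdivrMr // [e * _]mulrC.
Qed.

Lemma mean2_ext f g : (forall x y, f x y = g x y) -> mean2 f = mean2 g.
Proof. by move=> fg; rewrite /mean2 (dint_ext fg). Qed.

Lemma mean2_add f g : buc f -> buc g -> mean2 (fun x y => f x y + g x y) = mean2 f + mean2 g.
Proof. by move=> bf bg; rewrite /mean2 (dint_add bf bg) RplusE mulrDr. Qed.

Lemma mean2_scal c f : buc f -> mean2 (fun x y => c * f x y) = c * mean2 f.
Proof. by move=> bf; rewrite /mean2 (dint_scal c bf) RmultE mulrCA. Qed.

Lemma buc_scal c f : buc f -> buc (fun x y => c * f x y).
Proof. by move=> bf; apply: (buc_mul (buc_const c) bf). Qed.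

Lemma buc_sum (I : Type) (r : seq I) (c : I -> R) (f : I -> R -> R -> R) :
  (forall i, buc (f i)) ->
  buc (fun x y => \sum_(i <- r) c i * f i x y) /\
  mean2 (fun x y => \sum_(i <- r) c i * f i x y) = \sum_(i <- r) c i * mean2 (f i).
Proof.
move=> bf; elim: r => [|i r [IH1 IH2]].
  have E : (fun _ _ : R => \sum_(i <- [::]) c i * f i 0 0) = (fun _ _ => 0).
    by apply: functional_extensionality => x;
       apply: functional_extensionality => y; rewrite big_nil.
  have E2 : (fun x y : R => \sum_(i <- [::]) c i * f i x y) = (fun _ _ => 0).
    by apply: functional_extensionality => x;
       apply: functional_extensionality => y; rewrite big_nil.
  rewrite E2 big_nil; split; first exact: buc_const.
  apply/eqP; rewrite -normr_le0; apply: mean2_bound; first exact: buc_const.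
  by move=> _ _; rewrite normr0.
have E : (fun x y : R => \sum_(j <- i :: r) c j * f j x y)
       = (fun x y => c i * f i x y + \sum_(j <- r) c j * f j x y).
  by apply: functional_extensionality => x;
     apply: functional_extensionality => y; rewrite big_cons.
have bi := buc_scal (c i) (bf i).
rewrite E big_cons; split; first exact: (buc_add bi IH1).
by rewrite (mean2_add bi IH1) IH2 (mean2_scal _ (bf i)).
Qed.

Section trace_limit.
Variables m2 m1 : nat -> nat.
Hypothesis m1oo : forall N, ev (fun n => (N <= m1 n)%N).
Hypothesis m2oo : forall N, ev (fun n => (N <= m2 n)%N).

Lemma sum_inner2_le w a b :
  (\sum_(i < a * b) ~~ inner2 w i <= w.*2 * b + a * w.*2)%N.
Proof.
have := @big_tens nat a b (fun i j => ~~ (inner1 w a i && inner1 w b j) : nat).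
rewrite /inner2 /px /py => h; apply: (@leq_trans (\sum_(i < a) \sum_(j < b) (~~ inner1 w a i + ~~ inner1 w b j))%N).
  have -> : (\sum_(i < a * b) ~~ (inner1 w a (mxtens_unindex i).1 && inner1 w b (mxtens_unindex i).2))%N
     = (\sum_(i < a) \sum_(j < b) ~~ (inner1 w a i && inner1 w b j))%N by exact: h.
  by apply: leq_sum => i _; apply: leq_sum => j _; case: inner1; case: inner1.
rewrite (eq_bigr (fun i : 'I_a => (~~ inner1 w a i * b + \sum_(j < b) ~~ inner1 w b j)%N)); last first.
  by move=> i _; rewrite big_split /= sum_nat_const card_ord mulnC.
rewrite big_split /= -big_distrl /= sum_nat_const card_ord.
by apply: leq_add; rewrite ?leq_mul2l ?leq_mul2r ?sum_inner1_le ?orbT.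
Qed.

(** By [mean2_ph], averaging the action of row i on the cosines leaves its diagonal entry, which is
    thus close to the mean of s for interior i. The remaining rows are few, each with an error at
    most 2 C. *)
Lemma trace_limit A s : @at2 m2 m1 A s -> buc s ->
  conv (fun n => (m2 n * m1 n)%N%:R^-1 * \tr (A n)) (mean2 s).
Proof.
move=> [C [w [C0 sC bA lA]]] bs e e0.
have Ls : `|mean2 s| <= C by exact: mean2_bound.
have e20 : 0 < e / 2 by lra.
pose K := 2 * C * (w.*2)%:R + 1.
have CW : 0 <= 2 * C * (w.*2)%:R by rewrite !mulr_ge0.
have K0 : 0 < K by rewrite /K; lra.
(* Once both dimensions exceed N, the boundary rows contribute at most e/4 for each of the two
   directions. *)
pose N := (Num.truncn (4 * K / e)).+1.
have hN : 4 * K / e <= N%:R by apply: ltW; exact: truncnS_gt.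
have N0 : 0 < N%:R :> R by rewrite ltr0n.
apply: ev_imp (ev_and (ev_and bA (lA _ e20)) (ev_and (m1oo N) (m2oo N))) => n [[[zA rA] hA] [h1 h2]].
have diag i : A n i i = mean2 (fun t1 t2 => \sum_j A n i j * cos (ph i j t1 t2)).
  have [_ ->] := @buc_sum _ (index_enum _) (fun j => A n i j) (fun j t1 t2 => cos (ph i j t1 t2)) (fun j => buc_ph i j).
  rewrite (bigD1 i) //= mean2_ph eqxx mulr1 big1 ?addr0 // => j ne.
  by rewrite mean2_ph eq_sym (negPf ne) mulr0.
have dA i : inner2 w i -> `|A n i i - mean2 s| <= e / 2.
  move=> hi; have [bS _] := @buc_sum _ (index_enum _) (fun j => A n i j) (fun j t1 t2 => cos (ph i j t1 t2)) (fun j => buc_ph i j).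
  have bN := buc_scal (-1) bs.
  rewrite diag -[mean2 s]mul1r -mulNr -(mean2_scal _ bs) -(mean2_add bS bN).
  apply: mean2_bound; first exact: (buc_add bS bN).
  by move=> t1 t2; rewrite mulN1r; have [] := hA i hi t1 t2.
have dA2 i : `|A n i i - mean2 s| <= 2 * C.
  apply: le_trans (ler_normB _ _) _.
  have : `|A n i i| <= C by apply: le_trans (rA i); rewrite (bigD1 i) //= lerDl sumr_ge0.
  lra.
have m10 : 0 < (m1 n)%:R :> R by rewrite ltr0n; lia.
have m20 : 0 < (m2 n)%:R :> R by rewrite ltr0n; lia.
have d0 : 0 < (m2 n * m1 n)%N%:R :> R by rewrite natrM mulr_gt0.
have -> : (m2 n * m1 n)%N%:R^-1 * \tr (A n) - mean2 s =
    (m2 n * m1 n)%N%:R^-1 * \sum_i (A n i i - mean2 s).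
  rewrite sumrB sumr_const card_ord -[mean2 s *+ _]mulr_natl mulrBr mulrA mulVf ?mul1r //.
  exact: lt0r_neq0.
rewrite normrM gtr0_norm ?invr_gt0 // mulrC ler_pdivrMr //.
apply: le_trans (ler_norm_sum _ _ _) _.
apply: (@le_trans _ _ (\sum_(i < m2 n * m1 n) (e / 2 + 2 * C * (~~ inner2 w i)%:R))).
  apply: ler_sum => i _; have [/dA h|_] := boolP (inner2 w i).
    by rewrite mulr0 addr0.
  by rewrite mulr1; apply: le_trans (dA2 i) _; lra.
rewrite big_split /= sumr_const card_ord -mulr_sumr -natr_sum -[(e / 2) *+ _]mulr_natr.
have hs : (\sum_(i < m2 n * m1 n) ~~ inner2 w i)%N%:R <= (w.*2 * m1 n + m2 n * w.*2)%N%:R :> R.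
  by rewrite ler_nat sum_inner2_le.
have hC : 0 <= 2 * C by lra.
have := ler_wpM2l hC hs; rewrite !natrD !natrM.
set a := (m2 n)%:R in m20 *; set b := (m1 n)%:R in m10 *; set W := (w.*2)%:R; set S := (\sum_(i < _) _)%:R.
move=> hS.
have W0 : 0 <= W by [].
have hNa : N%:R <= a by rewrite ler_nat.
have hNb : N%:R <= b by rewrite ler_nat.
have Ke : 4 * K <= e * N%:R by rewrite [e * _]mulrC -ler_pdivrMr.
have Ka : 4 * K <= e * a by apply: le_trans Ke _; rewrite ler_pM2l.
have Kb : 4 * K <= e * b by apply: le_trans Ke _; rewrite ler_pM2l.
have KE : 2 * C * W <= K by rewrite /K; lra.
have t1 : 2 * C * W * b <= K * b by rewrite ler_wpM2r // ltW.
have t2 : 2 * C * W * a <= K * a by rewrite ler_wpM2r // ltW.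
have t3 : 4 * K * b <= e * a * b by rewrite ler_wpM2r // ltW.
have t4 : 4 * K * a <= e * b * a by rewrite ler_wpM2r // ltW.
have E1 : 2 * C * (W * b + a * W) = 2 * C * W * b + 2 * C * W * a by ring.
have E2 : e / 2 * (a * b) = e * a * b / 2 by field.
have E3 : e * b * a = e * a * b by ring.
rewrite E1 in hS; rewrite E2 mulrA; lra.
Qed.
End trace_limit.

(** * Eigenvalues *)

Lemma normc_real (x : R) : normc (cplx x) = `|x|.
Proof. by rewrite /normc expr0n addr0 sqrtr_sqr. Qed.

Lemma normc_sum (I : Type) (r : seq I) (f : I -> R[i]) :
  normc (\sum_(i <- r) f i) <= \sum_(i <- r) normc (f i).
Proof.
elim: r => [|i r IH]; first by rewrite !big_nil normc0.
by rewrite !big_cons; apply: le_trans (le_normcD _ _) _; rewrite lerD2l.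
Qed.

Lemma normc_ge0 (z : R[i]) : 0 <= normc z.
Proof. by case: z => a b; apply: sqrtr_ge0. Qed.

Lemma ge_Re_normc (z : R[i]) : `|complex.Re z| <= normc z.
Proof.
case: z => a b /=; rewrite -sqrtr_sqr ler_wsqrtr //.
by rewrite lerDl sqr_ge0.
Qed.

Section spectrum.
Variables (d : nat) (A : 'M[R]_d) (s : seq R[i]).
Hypothesis As : eigenvalue_list A s.
Let Ac : 'M[R[i]]_d := map_mx (real_complex R) A.

Lemma eigenvalue_list_char : char_poly Ac = \prod_(z <- s) ('X - z%:P).
Proof. by rewrite -[RHS]As /Ac -map_char_poly. Qed.

Lemma eigenvalue_list_size : size s = d.
Proof.
have := size_char_poly Ac; rewrite eigenvalue_list_char size_prod_XsubC.
by move=> /eqP; rewrite eqSS => /eqP.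
Qed.

Lemma eigenvalue_list_vec z : z \in s -> exists2 v : 'rV[R[i]]_d, v *m Ac = z *: v & v != 0.
Proof.
move=> zs; have : eigenvalue Ac z.
  by rewrite eigenvalue_root_char eigenvalue_list_char root_prod_XsubC.
by move=> /eigenvalueP.
Qed.

Lemma trig_exp_diag (T : 'M[R[i]]_d) k : is_trig_mx T ->
  is_trig_mx (T ^+ k) /\ forall i, (T ^+ k) i i = T i i ^+ k.
Proof.
move=> /is_trig_mxP hT; elim: k => [|k [/is_trig_mxP IH1 IH2]].
  by rewrite expr0; split=> [|i]; [exact: scalar_mx_is_trig|rewrite mxE eqxx].
rewrite exprS; split.
  apply/is_trig_mxP => i j ij; rewrite mxE big1 // => l _.
  have [il|li] := ltnP i l; first by rewrite hT ?mul0r.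
  by rewrite IH1 ?mulr0 //; apply: leq_ltn_trans ij.
move=> i; rewrite mxE (bigD1 i) //= IH2 -exprS big1 ?addr0 // => l li.
have [il|il] := ltnP i l; first by rewrite hT ?mul0r.
by rewrite IH1 ?mulr0 // ltn_neqAle il andbT.
Qed.

(** Without diagonalizability, a Schur form over the complex numbers is used: the diagonal of the
    triangular matrix is the eigenvalue list up to order, and powers act on it entrywise. The Schur
    form asks for positive size. *)
Lemma eigenvalue_list_trace k : \sum_(z <- s) z ^+ k = cplx (\tr (A ^+ k)).
Proof.
case: (posnP d) => [d0|d0].
  have s0 : s = [::] by apply/size0nil; rewrite eigenvalue_list_size.
  rewrite s0 big_nil /mxtrace big1 // => i _; by have := ltn_ord i; lia.
have [P Pu] := Schur Ac d0.
have {}Pu : P \in unitmx by apply: unitarymx_unit.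
rewrite /similar_to /=; set T := conjmx P Ac => hT.
have TE : T = P *m Ac *m invmx P by rewrite /T conjumx.
have Tk m : T ^+ m = P *m (Ac ^+ m) *m invmx P.
  elim: m => [|m IH]; first by rewrite !expr0 mulmx1 mulmxV.
  rewrite !exprS -!mulmxE IH TE !mulmxA; congr (_ *m _); congr (_ *m _).
  by rewrite mulmxKV.
have -> : cplx (\tr (A ^+ k)) = \tr (T ^+ k).
  rewrite Tk mxtrace_mulC mulmxA mulVmx // mul1mx.
  have -> : Ac ^+ k = map_mx (real_complex R) (A ^+ k).
    elim: (k) => [|m IH]; first by rewrite !expr0 map_mx1.
    by rewrite !exprS IH -!mulmxE map_mxM.
  by rewrite trace_map_mx.
have cT : char_poly T = char_poly Ac.
  rewrite TE; apply/esym; rewrite /char_poly.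
  have -> : char_poly_mx (P *m Ac *m invmx P) =
     map_mx polyC P *m char_poly_mx Ac *m map_mx polyC (invmx P).
    rewrite /char_poly_mx mulmxBr mulmxBl -!map_mxM; congr (_ - _).
    by rewrite scalar_mxC -mulmxA -map_mxM mulmxV // map_mx1 mulmx1.
  rewrite !det_mulmx mulrC mulrA -det_mulmx -map_mxM mulVmx // map_mx1 det1 mul1r.
  by [].
have ps : perm_eq s [seq T i i | i <- index_enum 'I_d].
  apply: prod_XsubC_eq; rewrite -eigenvalue_list_char -cT char_poly_trig //.
  by rewrite big_map.
have [_ hd] := trig_exp_diag k hT.
by rewrite (perm_big _ ps) /= big_map /mxtrace; apply: eq_bigr => i _; rewrite hd.
Qed.

(** Eigenvectors are rows here, so measuring them in the sum norm makes the row sums of A appear. *)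
Lemma eigenvalue_bound C z : (forall i, \sum_j `|A i j| <= C) -> z \in s -> normc z <= C.
Proof.
move=> rA /eigenvalue_list_vec [v vA v0].
have N0 : 0 < \sum_j normc (v 0 j).
  rewrite lt_neqAle sumr_ge0 ?andbT; last by move=> *; apply: normc_ge0.
  apply: contra v0 => /eqP/esym/eqP; rewrite psumr_eq0; last by move=> *; apply: normc_ge0.
  move=> /allP h; apply/eqP/rowP => j; rewrite mxE; apply: eq0_normc.
  by apply/eqP; apply: h; rewrite mem_index_enum.
rewrite -(ler_pM2r N0) mulr_sumr.
apply: (@le_trans _ _ (\sum_j \sum_i normc (v 0 i) * `|A i j|)).
  apply: ler_sum => j _; rewrite -normcM.
  have -> : z * v 0 j = \sum_i v 0 i * cplx (A i j).
    have := congr1 (fun M : 'rV_d => M 0 j) vA; rewrite !mxE => <-.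
    by apply: eq_bigr => i _; rewrite mxE.
  apply: le_trans (normc_sum _ _) _; apply: ler_sum => i _.
  by rewrite normcM normc_real.
rewrite exchange_big /= mulr_sumr; apply: ler_sum => i _.
by rewrite -mulr_sumr mulrC ler_wpM2r // normc_ge0.
Qed.

(** For an eigenvector a + i b, combining real and imaginary parts of the equation expresses Im z
    times its squared norm as the form of A minus its transpose evaluated at b and a. The inequality
    of the two means then splits this into row sums. *)
Lemma eigenvalue_Im e z : (forall i, \sum_j `|A i j - A j i| <= e) -> z \in s ->
  `|complex.Im z| <= e.
Proof.
move=> rA /eigenvalue_list_vec [v vA v0].
pose a j := complex.Re (v 0 j); pose b j := complex.Im (v 0 j).
pose N := \sum_j (a j ^+ 2 + b j ^+ 2).
have N0 : 0 < N.
  rewrite lt_neqAle sumr_ge0 ?andbT; last by move=> *; rewrite addr_ge0 ?sqr_ge0.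
  apply: contra v0 => /eqP/esym/eqP; rewrite psumr_eq0; last by move=> *; rewrite addr_ge0 ?sqr_ge0.
  move=> /allP h; apply/eqP/rowP => j; rewrite mxE.
  have := h j (mem_index_enum _); rewrite paddr_eq0 ?sqr_ge0 // !sqrf_eq0 /a /b.
  by case: (v 0 j) => x y /= /andP[/eqP -> /eqP ->].
have eqs j : \sum_i a i * A i j = complex.Re z * a j - complex.Im z * b j /\
             \sum_i b i * A i j = complex.Re z * b j + complex.Im z * a j.
  have := congr1 (fun M : 'rV_d => M 0 j) vA; rewrite !mxE => h.
  have hr : complex.Re (\sum_i v 0 i * Ac i j) = \sum_i a i * A i j.
    rewrite (big_morph (@complex.Re R) (id1 := 0) (op1 := +%R)) //; last by case=> ? ? [].
    by apply: eq_bigr => i _; rewrite mxE /a; case: (v 0 i) => x y /=; rewrite mulr0 subr0.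
  have hi : complex.Im (\sum_i v 0 i * Ac i j) = \sum_i b i * A i j.
    rewrite (big_morph (@complex.Im R) (id1 := 0) (op1 := +%R)) //; last by case=> ? ? [].
    by apply: eq_bigr => i _; rewrite mxE /b; case: (v 0 i) => x y /=; rewrite mulr0 add0r.
  rewrite -hr -hi h /a /b; case: z {vA h} => x y; case: (v 0 j) => x' y' /=; split=> //.
have key : complex.Im z * N = \sum_i \sum_j b i * (A i j - A j i) * a j.
  have -> : complex.Im z * N = \sum_j (\sum_i b i * A i j) * a j - \sum_j (\sum_i a i * A i j) * b j.
    rewrite /N mulr_sumr -sumrB; apply: eq_bigr => j _.
    by have [-> ->] := eqs j; ring.
  under eq_bigr do rewrite mulr_suml.
  rewrite exchange_big /=; under [X in _ - X]eq_bigr do rewrite mulr_suml.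
  by rewrite -sumrB; apply: eq_bigr => i _; rewrite -sumrB; apply: eq_bigr => j _; ring.
have am (x y : R) : `|x * y| <= (x ^+ 2 + y ^+ 2) / 2.
  have := sqr_ge0 (x - y); have := sqr_ge0 (x + y); rewrite !expr2 ler_norml.
  by move=> h1 h2; apply/andP; split; lra.
have e0 : N * e = \sum_i (a i ^+ 2 + b i ^+ 2) * e by rewrite mulr_suml.
rewrite -(ler_pM2r N0) -[X in _ * X](gtr0_norm N0) -normrM key [e * N]mulrC.
apply: (@le_trans _ _ (\sum_i \sum_j `|A i j - A j i| * ((b i ^+ 2 + a j ^+ 2) / 2))).
  apply: le_trans (ler_norm_sum _ _ _) _; apply: ler_sum => i _.
  apply: le_trans (ler_norm_sum _ _ _) _; apply: ler_sum => j _.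
  have -> : b i * (A i j - A j i) * a j = (A i j - A j i) * (b i * a j) by ring.
  by rewrite normrM ler_wpM2l.
pose D i := \sum_j `|A i j - A j i|.
have -> : \sum_i \sum_j `|A i j - A j i| * ((b i ^+ 2 + a j ^+ 2) / 2)
   = \sum_i (D i * (b i ^+ 2 / 2) + D i * (a i ^+ 2 / 2)).
  rewrite big_split /=.
  (* The absolute antisymmetric part is a symmetric matrix, so its column sums are its row sums. *)
  have -> : \sum_i D i * (a i ^+ 2 / 2) = \sum_i \sum_j `|A i j - A j i| * (a j ^+ 2 / 2).
    rewrite exchange_big /=; apply: eq_bigr => i _; rewrite mulr_suml.
    by apply: eq_bigr => j _; rewrite distrC.
  rewrite -big_split; apply: eq_bigr => i _ /=.
  rewrite mulr_suml -big_split; apply: eq_bigr => j _ /=; ring.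
rewrite e0; apply: ler_sum => i _.
have := rA i; rewrite -/(D i) => hD.
have h1 : D i * (b i ^+ 2 / 2) <= e * (b i ^+ 2 / 2).
  by rewrite ler_wpM2r // divr_ge0 // sqr_ge0.
have h2 : D i * (a i ^+ 2 / 2) <= e * (a i ^+ 2 / 2).
  by rewrite ler_wpM2r // divr_ge0 // sqr_ge0.
have D0 : 0 <= D i by rewrite sumr_ge0.
have h3 : 0 <= e * a i ^+ 2 by rewrite mulr_ge0 ?sqr_ge0 //; lra.
have h4 : 0 <= e * b i ^+ 2 by rewrite mulr_ge0 ?sqr_ge0 //; lra.
lra.
Qed.

End spectrum.

(** The Lipschitz bound for the k-th power on the disc of radius C; for k = 0 the factor k makes the
    truncated exponent harmless. *)
Lemma normc_pow_diff (z : R[i]) C k : normc z <= C ->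
  normc (z ^+ k - cplx (complex.Re z) ^+ k) <= k%:R * C ^+ k.-1 * `|complex.Im z|.
Proof.
move=> zC; have C0 : 0 <= C by apply: le_trans (normc_ge0 z) zC.
have xC : normc (cplx (complex.Re z)) <= C by rewrite normc_real; apply: le_trans (ge_Re_normc z) zC.
have dz : normc (z - cplx (complex.Re z)) = `|complex.Im z|.
  by case: z {zC xC} => x y /=; rewrite subrr subr0 expr0n add0r sqrtr_sqr.
have powC (w : R[i]) m : normc w <= C -> normc (w ^+ m) <= C ^+ m.
  move=> wC; elim: m => [|m IH]; first by rewrite !expr0 normc1.
  by rewrite !exprS normcM; apply: ler_pM => //; apply: normc_ge0.
elim: k => [|k IH]; first by rewrite !expr0 subrr normc0 !mul0r.
have -> : z ^+ k.+1 - cplx (complex.Re z) ^+ k.+1 =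
   z * (z ^+ k - cplx (complex.Re z) ^+ k) + (z - cplx (complex.Re z)) * cplx (complex.Re z) ^+ k.
  by rewrite !exprS; ring.
apply: le_trans (le_normcD _ _) _; rewrite !normcM dz.
have h1 : normc z * normc (z ^+ k - cplx (complex.Re z) ^+ k) <= C * (k%:R * C ^+ k.-1 * `|complex.Im z|).
  by apply: ler_pM => //; apply: normc_ge0.
have h2 : `|complex.Im z| * normc (cplx (complex.Re z) ^+ k) <= `|complex.Im z| * C ^+ k.
  by rewrite ler_wpM2l // powC.
have E : C * (k%:R * C ^+ k.-1 * `|complex.Im z|) = k%:R * C ^+ k * `|complex.Im z|.
  by case: (k) => [|m]; rewrite ?mul0r ?mulr0 //= exprS; ring.
rewrite E in h1; apply: le_trans (lerD h1 h2) _.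
by rewrite -natr1 le_eqVlt; apply/orP; left; apply/eqP => /=; ring.
Qed.

(** * Bernstein polynomials *)

(* The Bernstein polynomial of the values f 0, ..., f n, through its de Casteljau recursion. *)
Fixpoint bern (n : nat) (f : nat -> R) : {poly R} :=
  match n with
  | 0%N => (f 0%N)%:P
  | n'.+1 => (1 - 'X) * bern n' f + 'X * bern n' (f \o succn)
  end.

Lemma bernS n f u : (bern n.+1 f).[u] = (1 - u) * (bern n f).[u] + u * (bern n (f \o succn)).[u].
Proof. by rewrite /= !hornerE. Qed.

Lemma bern_ext n f g u : (forall k, f k = g k) -> (bern n f).[u] = (bern n g).[u].
Proof.
elim: n f g => [|n IH] f g fg; first by rewrite /= !hornerE.
by rewrite !bernS (IH f g) // (IH (f \o succn) (g \o succn)) // => k; apply: fg.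
Qed.

Lemma bern_le n f g u : 0 <= u <= 1 -> (forall k, (k <= n)%N -> f k <= g k) ->
  (bern n f).[u] <= (bern n g).[u].
Proof.
move=> hu; elim: n f g => [|n IH] f g fg; first by rewrite /= !hornerE fg.
rewrite !bernS; apply: lerD; apply: ler_wpM2l; try lra.
  by apply: IH => k hk; apply: fg; lia.
by apply: IH => k hk; apply: fg; lia.
Qed.

Lemma bern_lin n a b f g u :
  (bern n (fun k => a * f k + b * g k)).[u] = a * (bern n f).[u] + b * (bern n g).[u].
Proof.
elim: n f g => [|n IH] f g; first by rewrite /= !hornerE.
rewrite !bernS IH (IH (f \o succn) (g \o succn)); ring.
Qed.

Lemma bern_1 n u : (bern n (fun=> 1)).[u] = 1.
Proof.
elim: n => [|n IH]; first by rewrite /= !hornerE.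
by rewrite bernS !IH; ring.
Qed.

Lemma bern_id n u : (bern n (fun k => k%:R)).[u] = n%:R * u.
Proof.
elim: n => [|n IH]; first by rewrite /= hornerC; ring.
rewrite bernS IH (@bern_ext _ _ (fun k => 1 * k%:R + 1 * 1)); last first.
  by move=> k /=; rewrite -natr1; ring.
by rewrite bern_lin bern_1 IH -natr1; ring.
Qed.

Lemma bern_sqr n u : (bern n (fun k => k%:R ^+ 2)).[u] = n%:R * u * (1 - u) + n%:R ^+ 2 * u ^+ 2.
Proof.
elim: n => [|n IH]; first by rewrite /= hornerC; ring.
rewrite bernS IH (@bern_ext _ _ (fun k => 1 * k%:R ^+ 2 + 1 * (2 * k%:R + 1 * 1))); last first.
  by move=> k /=; rewrite -natr1; ring.
by rewrite !bern_lin bern_1 bern_id IH -natr1; ring.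
Qed.

Lemma bern_var n u : (0 < n)%N -> (bern n (fun k => (u - k%:R / n%:R) ^+ 2)).[u] = u * (1 - u) / n%:R.
Proof.
move=> n0; have nn : n%:R != 0 :> R by rewrite pnatr_eq0; lia.
rewrite (@bern_ext _ _ (fun k => u ^+ 2 * 1 + 1 * ((- 2 * u / n%:R) * k%:R + (n%:R^-1 ^+ 2) * k%:R ^+ 2))).
  by rewrite !bern_lin bern_1 bern_id bern_sqr; field.
by move=> k; field.
Qed.

(** The oscillation of f is dominated by e/2 plus a multiple of (u - v)^2; the operator is monotone
    and linear, so the error is at most e/2 plus that multiple of the variance u (1 - u)/n. *)
Lemma bernstein (f : R -> R) M e : 0 < e ->
  (forall u, 0 <= u <= 1 -> `|f u| <= M) ->
  (forall e, 0 < e -> exists2 d, 0 < d & forall u v, 0 <= u <= 1 -> 0 <= v <= 1 ->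
     `|u - v| <= d -> `|f u - f v| <= e) ->
  exists p : {poly R}, forall u, 0 <= u <= 1 -> `|f u - p.[u]| <= e.
Proof.
move=> e0 fM fu; have e20 : 0 < e / 2 by lra.
have [d d0 hd] := fu _ e20.
have M0 : 0 <= M by apply: le_trans (fM 0 _); rewrite ?normr_ge0 ?lexx ?ler01.
pose K := 2 * M / d ^+ 2.
have K0 : 0 <= K by rewrite divr_ge0 ?exprn_ge0 ?mulr_ge0 // ltW.
have quad u v : 0 <= u <= 1 -> 0 <= v <= 1 -> `|f u - f v| <= e / 2 + K * (u - v) ^+ 2.
  move=> hu hv; have [h|h] := leP `|u - v| d.
    by apply: le_trans (hd u v hu hv h) _; rewrite lerDl mulr_ge0 ?sqr_ge0.
  apply: (@le_trans _ _ (2 * M)).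
    by apply: le_trans (ler_normB _ _) _; have := fM u hu; have := fM v hv; lra.
  have : 2 * M <= K * (u - v) ^+ 2.
    rewrite /K -mulrA ler_peMr ?mulr_ge0 // mulrC ler_pdivlMr ?exprn_gt0 // mul1r.
    rewrite -[X in _ <= X]real_normK ?num_real //.
    by apply: lerXn2r; rewrite ?nnegrE; [exact: ltW|exact: normr_ge0|exact: ltW].
  lra.
pose n := (Num.truncn (2 * K / e)).+1.
have n0 : 0 < n%:R :> R by rewrite ltr0n.
have hn : 2 * K / e < n%:R by exact: truncnS_gt.
exists (bern n (fun k => f (k%:R / n%:R))) => u hu.
have kn k : (k <= n)%N -> 0 <= (k%:R / n%:R : R) <= 1.
  by move=> hk; rewrite divr_ge0 //= ler_pdivrMr // mul1r ler_nat.
have var := @bern_var n u isT.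
have v1 : u * (1 - u) / n%:R <= n%:R^-1.
  rewrite -[X in _ <= X]mul1r; apply: ler_wpM2r; first by rewrite invr_ge0 ltW.
  by rewrite -[X in _ <= X]mulr1; apply: ler_pM; lra.
have Kn : K * (u * (1 - u) / n%:R) <= e / 2.
  apply: le_trans (ler_wpM2l K0 v1) _; rewrite ler_pdivrMr //.
  move: hn; rewrite ltr_pdivrMr // => hn; lra.
have up : (bern n (fun k => f (k%:R / n%:R))).[u] <= f u + e.
  apply: (@le_trans _ _ (bern n (fun k => (f u + e / 2) * 1 + K * (u - k%:R / n%:R) ^+ 2)).[u]).
    apply: bern_le => // k /kn hk; have := quad _ _ hu hk.
    by rewrite ler_norml => /andP[h1 h2]; lra.
  by rewrite bern_lin bern_1 var; lra.
have lo : f u - e <= (bern n (fun k => f (k%:R / n%:R))).[u].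
  apply: (@le_trans _ _ (bern n (fun k => (f u - e / 2) * 1 + (- K) * (u - k%:R / n%:R) ^+ 2)).[u]).
    by rewrite bern_lin bern_1 var; lra.
  apply: bern_le => // k /kn hk; have := quad _ _ hu hk.
  by rewrite ler_norml => /andP[h1 h2]; lra.
by rewrite ler_norml; apply/andP; split; lra.
Qed.

Lemma weierstrass (f : R -> R) C M e : 0 < e -> 0 < C ->
  (forall x, - C <= x <= C -> `|f x| <= M) ->
  (forall e, 0 < e -> exists2 d, 0 < d & forall x y, - C <= x <= C -> - C <= y <= C ->
     `|x - y| <= d -> `|f x - f y| <= e) ->
  exists p : {poly R}, forall x, - C <= x <= C -> `|f x - p.[x]| <= e.
Proof.
move=> e0 C0 fM fu.
have rng u : 0 <= u <= 1 -> - C <= 2 * C * u - C <= C.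
  move=> /andP[u0 u1]; have h1 : 0 <= C * u by rewrite mulr_ge0 // ltW.
  have h2 : C * u <= C by rewrite ler_piMr // ltW.
  by apply/andP; split; lra.
have [|e' e'0|p hp] := @bernstein (fun u => f (2 * C * u - C)) M e e0.
- by move=> u /rng; apply: fM.
- have [d d0 hd] := fu e' e'0; exists (d / (2 * C)); first by rewrite divr_gt0 // mulr_gt0.
  move=> u v hu hv huv; apply: hd; [exact: rng|exact: rng|].
  have -> : 2 * C * u - C - (2 * C * v - C) = (2 * C) * (u - v) by ring.
  rewrite normrM gtr0_norm ?mulr_gt0 // mulrC -ler_pdivlMr ?mulr_gt0 //.
- exists (p \Po ((2 * C)^-1 *: 'X + (2^-1)%:P)) => x /andP[x1 x2].
  rewrite horner_comp !hornerE.
  have hu : 0 <= (2 * C)^-1 * x + 2^-1 <= 1.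
    have C2 : 0 < 2 * C by rewrite mulr_gt0.
    have h1 : - 2^-1 <= (2 * C)^-1 * x by rewrite mulrC ler_pdivlMr //; lra.
    have h2 : (2 * C)^-1 * x <= 2^-1 by rewrite mulrC ler_pdivrMr //; lra.
    by apply/andP; split; lra.
  have := hp _ hu; have -> // : 2 * C * ((2 * C)^-1 * x + 2^-1) - C = x.
  by field; apply: lt0r_neq0.
Qed.

(** * Eigenvalue distribution *)

Lemma cabsE (z : R[i]) : cabs z = normc z.
Proof. by case: z => a b; rewrite /cabs RsqrtE. Qed.

Lemma normc_le (z : R[i]) : normc z <= `|complex.Re z| + `|complex.Im z|.
Proof.
case: z => a b; have {1}-> : Complex a b = cplx a + Complex 0 b.
  by apply/eqP; rewrite eq_complex /= addr0 add0r !eqxx.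
by apply: le_trans (le_normcD _ _) _; rewrite normc_real lerD2l /= expr0n add0r sqrtr_sqr.
Qed.

Definition rcontinuous (phi : R[i] -> R) : Prop := forall (z : R[i]) (e : R), 0 < e ->
  exists2 d : R, 0 < d & forall w, normc (w - z) < d -> `|phi w - phi z| < e.

Lemma rcontinuous_tube phi (C e : R) : rcontinuous phi -> 0 < e ->
  exists2 d : R, 0 < d & forall x y u : R, - C <= x <= C -> - C <= u <= C -> `|x - u| <= d -> `|y| <= d ->
    `|phi (Complex x y) - phi (cplx u)| <= e.
Proof.
move=> cphi e0; have /RltP e0' := e0.
have c2 x : (- C <= x <= C)%coqR -> continuity_2d_pt (fun x y => phi (Complex x y)) x 0.
  move=> _ eps; have /RltP eps0 := cond_pos eps.
  have [d d0 hd] := cphi (cplx x) eps eps0.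
  have d20 : 0 < d / 2 by lra.
  have /RltP d20' := d20.
  exists (mkposreal _ d20') => u v /RltP hu /RltP hv; apply/RltP; rewrite !RabsE in hu hv *.
  apply: hd; apply: le_lt_trans (normc_le _) _ => /=.
  rewrite /= RminusE in hu; rewrite /= RminusE subr0 in hv; rewrite subr0; lra.
have [[d d0' hd]] := @uniform_continuity_2d_1d (fun x y => phi (Complex x y)) (- C) C 0 c2 (mkposreal _ e0').

have d0 : 0 < d by exact/RltP.
rewrite /= in hd.
have d2 : d / 2 < d by lra.
exists (d / 2) => [|x y u hx hu xu hy]; first by lra.
have cv (a : R) : - C <= a <= C -> (- C <= a <= C)%coqR by move=> /andP[/RleP ? /RleP ?].
have := @hd u 0 x y (cv _ hu) _ (cv _ hx) _ _; rewrite RabsE /= => h.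
apply: ltW; apply/RltP; apply: h.
- by rewrite Rminus_0_l Rplus_0_l; split; apply/RleP; rewrite ?RoppE; lra.
- rewrite Rminus_0_l Rplus_0_l.
  by move: hy; rewrite ler_norml => /andP[h1 h2]; split; apply/RleP; rewrite ?RoppE; lra.
- by apply/RltP; rewrite ?RminusE; exact: le_lt_trans xu d2.
Qed.

Lemma conv_sum (I : Type) (r : seq I) (c : I -> R) (u : I -> nat -> R) (l : I -> R) :
  (forall i, conv (u i) (l i)) ->
  conv (fun n => \sum_(i <- r) c i * u i n) (\sum_(i <- r) c i * l i).
Proof.
move=> h; elim: r => [|i r IH] e e0.
  by exists 0%N => n _; rewrite !big_nil subrr normr0 ltW.
have c0 : 0 < `|c i| + 1 by rewrite ltr_wpDl.
have e1 : 0 < e / 2 / (`|c i| + 1) by rewrite !divr_gt0.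
have e2 : 0 < e / 2 by lra.
apply: ev_imp (ev_and (IH _ e2) (h i _ e1)) => n [h1 h2]; rewrite !big_cons.
have -> : c i * u i n + \sum_(j <- r) c j * u j n - (c i * l i + \sum_(j <- r) c j * l j) =
  c i * (u i n - l i) + (\sum_(j <- r) c j * u j n - \sum_(j <- r) c j * l j) by ring.
apply: le_trans (ler_normD _ _) _; rewrite normrM.
have h3 : `|c i| * `|u i n - l i| <= (`|c i| + 1) * (e / 2 / (`|c i| + 1)).
  by apply: ler_pM => //; rewrite lerDl.
have E : (`|c i| + 1) * (e / 2 / (`|c i| + 1)) = e / 2 by field; apply: lt0r_neq0.
lra.
Qed.

Lemma Re_sum (I : Type) (r : seq I) (f : I -> R[i]) :
  complex.Re (\sum_(i <- r) f i) = \sum_(i <- r) complex.Re (f i).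
Proof. by rewrite (big_morph (@complex.Re R) (id1 := 0) (op1 := +%R)) // => -[? ?] [? ?]. Qed.

Lemma Re_sub (z w : R[i]) : complex.Re (z - w) = complex.Re z - complex.Re w.
Proof. by case: z w => [? ?] [? ?]. Qed.

Lemma cplx_exp (x : R) k : cplx x ^+ k = cplx (x ^+ k).
Proof. by rewrite -[cplx x]/(real_complex R x) -rmorphXn. Qed.

Section spectral_limit.
Variables m2 m1 : nat -> nat.
Hypothesis m1oo : forall N, ev (fun n => (N <= m1 n)%N).
Hypothesis m2oo : forall N, ev (fun n => (N <= m2 n)%N).
Variables (A : forall n, 'M[R]_(m2 n * m1 n)) (g : R -> R -> R).
Hypothesis atA : at2 A g.
Hypothesis bg : buc g.
Hypothesis asymA : forall e, 0 < e -> ev (fun n => forall i, \sum_j `|A n i j - A n j i| <= e).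
Variable lam : nat -> seq R[i].
Hypothesis lamA : forall n, eigenvalue_list (A n) (lam n).

Let d n := (m2 n * m1 n)%N.

Lemma buc_exp f k : buc f -> buc (fun x y => f x y ^+ k).
Proof.
move=> bf; elim: k => [|k IH]; first exact: buc_const.
have -> : (fun x y => f x y ^+ k.+1) = (fun x y => (f x y * f x y ^+ k)%coqR).
  by apply: functional_extensionality => x;
     apply: functional_extensionality => y; rewrite exprS.
exact: buc_mul.
Qed.

Lemma poly_moment (p : {poly R}) :
  conv (fun n => (d n)%:R^-1 * \sum_(z <- lam n) \sum_(k < size p) p`_k * complex.Re (z ^+ k))
       (mean2 (fun t1 t2 => p.[g t1 t2])).
Proof.
have [_ E] := @buc_sum _ (index_enum 'I_(size p)) (fun k => p`_k) (fun k t1 t2 => g t1 t2 ^+ k) (fun k => buc_exp k bg).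
have -> : mean2 (fun t1 t2 => p.[g t1 t2]) = \sum_(k < size p) p`_k * mean2 (fun t1 t2 => g t1 t2 ^+ k).
  by rewrite -E; apply: mean2_ext => x y; rewrite horner_coef.
have := @conv_sum _ (index_enum 'I_(size p)) (fun k => p`_k) _ _
  (fun k => trace_limit m1oo m2oo (at2_exp k atA) (buc_exp k bg)).
move=> h e e0; apply: ev_imp (h e e0) => n.
suff -> : (d n)%:R^-1 * \sum_(z <- lam n) \sum_(k < size p) p`_k * complex.Re (z ^+ k) =
  \sum_(k < size p) p`_k * ((m2 n * m1 n)%N%:R^-1 * \tr (A n ^+ k)) by [].
rewrite exchange_big mulr_sumr; apply: eq_bigr => k _ /=.
rewrite -mulr_sumr mulrCA; congr (_ * (_ * _)).
by rewrite -Re_sum (eigenvalue_list_trace (lamA n)).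
Qed.

(** Five errors of e/5: moving z to Re z in [phi], replacing [phi] by p at Re z, replacing powers of
    Re z by Re(z^k), the limit of the moments of p, and replacing p by [phi] under the mean. *)
Lemma spectral_limit phi : rcontinuous phi ->
  conv (fun n => (d n)%:R^-1 * \sum_(z <- lam n) phi z) (mean2 (fun t1 t2 => phi (cplx (g t1 t2)))).
Proof.
move=> cphi e e0; have [C0 [w [C00 gC0 bA _]]] := atA.
pose C := C0 + 1; have Cp : 0 < C by rewrite /C; lra.
have e1 : 0 < e / 5 by lra.
have [dl dl0 hdl] := rcontinuous_tube C cphi e1.
pose f x := phi (cplx x).
have fu e' : 0 < e' -> exists2 d, 0 < d & forall x y, - C <= x <= C -> - C <= y <= C ->
    `|x - y| <= d -> `|f x - f y| <= e'.
  move=> e'0; have [d' d'0 hd'] := rcontinuous_tube C cphi e'0.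
  by exists d' => // x y hx hy xy; apply: hd' => //; rewrite normr0 ltW.
have cf x : continuous f x.
  apply: continuous_of_unif => e' /RltP e'0.
  have [d' d'0 hd'] := cphi (cplx x) e' e'0.
  have d20 : 0 < d' / 2 by lra.
  exists (d' / 2); first exact/RltP.
  move=> u /RleP; rewrite RabsE RminusE => hu; apply/RleP; rewrite RabsE RminusE.
  apply/ltW/hd'; have -> : cplx u - cplx x = cplx (u - x).
    by apply/eqP; rewrite eq_complex /= subrr !eqxx.
  by rewrite normc_real; lra.
have bfg : buc (fun t1 t2 => f (g t1 t2)) by apply: buc_comp.
have [M hM] : exists M, forall x, - C <= x <= C -> `|f x| <= M.
  have [[M hM] _] := @buc_comp f (fun x _ => Rmax (- C) (Rmin C x)) cf (buc_clamp C).
  exists M => x /andP[/RleP h1 /RleP h2]; have /RleP := hM x 0; rewrite RabsE.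
  by rewrite Rmin_right // Rmax_right.
have [p hp] := weierstrass e1 Cp hM fu.
(* The total cost, per unit of imaginary part, of exchanging powers of Re z and real parts of
   powers. *)
pose K := \sum_(k < size p) `|p`_k| * (k%:R * C ^+ k.-1).
have K0 : 0 <= K by rewrite sumr_ge0 // => k _; rewrite !mulr_ge0 ?exprn_ge0 // ltW.
pose e2 := Order.min dl (e / 5 / (K + 1)).
have K1 : 0 < K + 1 by lra.
have e20 : 0 < e2 by rewrite lt_min dl0 divr_gt0.
have e2d : e2 <= dl by rewrite ge_min lexx.
have e2K : e2 * (K + 1) <= e / 5 by rewrite -ler_pdivlMr // ge_min lexx orbT.
have gC x y : - C <= g x y <= C.
  by have := gC0 x y; rewrite ler_norml => /andP[h1 h2]; apply/andP; rewrite /C; split; lra.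
have bpg : buc (fun t1 t2 => p.[g t1 t2]).
  have [E _] := @buc_sum _ (index_enum 'I_(size p)) (fun k => p`_k) (fun k t1 t2 => g t1 t2 ^+ k) (fun k => buc_exp k bg).
  have -> : (fun t1 t2 => p.[g t1 t2]) = (fun x y => \sum_(k < size p) p`_k * g x y ^+ k).
    by apply: functional_extensionality => x;
       apply: functional_extensionality => y; rewrite horner_coef.
  exact: E.
have last_term : `|mean2 (fun t1 t2 => p.[g t1 t2]) - mean2 (fun t1 t2 => f (g t1 t2))| <= e / 5.
  have bn := buc_scal (-1) bfg.
  rewrite -[X in _ - X]mul1r -mulNr -(mean2_scal _ bfg) -(mean2_add bpg bn).
  apply: mean2_bound; first exact: (buc_add bpg bn).
  by move=> x y; rewrite mulN1r distrC; apply: hp.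
apply: ev_imp (ev_and (ev_and bA (asymA e20)) (ev_and (poly_moment p e1) (ev_and (m1oo 1) (m2oo 1)))).
move=> n [[[_ rA] hasym] [hpm [h1 h2]]].
have d0 : 0 < (d n)%:R :> R by rewrite ltr0n /d muln_gt0 h2 h1.
have zC z : z \in lam n -> normc z <= C.
  by move=> hz; apply: le_trans (eigenvalue_bound (lamA n) rA hz) _; rewrite /C; lra.
have zR z : z \in lam n -> - C <= complex.Re z <= C.
  by move=> hz; rewrite -ler_norml; apply: le_trans (ge_Re_normc z) (zC z hz).
have zI z : z \in lam n -> `|complex.Im z| <= e2.
  by move=> hz; apply: (eigenvalue_Im (lamA n) hasym).
have step z : z \in lam n ->
    `|phi z - \sum_(k < size p) p`_k * complex.Re (z ^+ k)| <= e / 5 + e / 5 + e / 5.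
  move=> hz.
  have s1 : `|phi z - f (complex.Re z)| <= e / 5.
    have := hdl (complex.Re z) (complex.Im z) (complex.Re z) (zR z hz) (zR z hz).
    rewrite subrr normr0 => h; have -> : z = Complex (complex.Re z) (complex.Im z) by case: (z).
    by apply: h; [exact: ltW|apply: le_trans (zI z hz) e2d].
  have s2 := hp _ (zR z hz).
  have s3 : `|p.[complex.Re z] - \sum_(k < size p) p`_k * complex.Re (z ^+ k)| <= e / 5.
    rewrite horner_coef -sumrB; apply: le_trans (ler_norm_sum _ _ _) _.
    apply: (@le_trans _ _ (\sum_(k < size p) `|p`_k| * (k%:R * C ^+ k.-1) * e2)).
      apply: ler_sum => k _; rewrite -mulrBr normrM -mulrA ler_wpM2l //.
      have -> : complex.Re z ^+ k - complex.Re (z ^+ k) = - complex.Re (z ^+ k - cplx (complex.Re z) ^+ k).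
        by rewrite Re_sub cplx_exp /=; ring.
      rewrite normrN; apply: le_trans (ge_Re_normc _) _.
      apply: le_trans (normc_pow_diff k (zC z hz)) _.
      by rewrite ler_wpM2l ?zI // mulr_ge0 // exprn_ge0 // ltW.
    rewrite -mulr_suml -/K; apply: le_trans _ e2K; rewrite mulrC ler_wpM2l ?(ltW e20) //; lra.
  set Q := \sum_(k < size p) _ in s3 *.
  have -> : phi z - Q = (phi z - f (complex.Re z)) + (f (complex.Re z) - p.[complex.Re z]) + (p.[complex.Re z] - Q) by ring.
  apply: le_trans (ler_normD _ _) _; apply: lerD => //.
  by apply: le_trans (ler_normD _ _) _; apply: lerD.
have avg : `|(d n)%:R^-1 * \sum_(z <- lam n) phi z -
    (d n)%:R^-1 * \sum_(z <- lam n) \sum_(k < size p) p`_k * complex.Re (z ^+ k)| <= e / 5 + e / 5 + e / 5.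
  rewrite -mulrBr -sumrB normrM gtr0_norm ?invr_gt0 // mulrC ler_pdivrMr //.
  apply: le_trans (ler_norm_sum _ _ _) _.
  have -> : (e / 5 + e / 5 + e / 5) * (d n)%:R = \sum_(z <- lam n) (e / 5 + e / 5 + e / 5).
    by rewrite big_const_seq count_predT (eigenvalue_list_size (lamA n)) iter_addr_0 mulr_natr.
  by rewrite !big_seq; apply: ler_sum => z hz; apply: step.
set a := _ * \sum_(z <- lam n) phi z in avg *.
set b := _ * \sum_(z <- lam n) _ in avg hpm.
have -> : a - mean2 (fun t1 t2 => phi (cplx (g t1 t2))) = (a - b) + (b - mean2 (fun t1 t2 => p.[g t1 t2]))
   + (mean2 (fun t1 t2 => p.[g t1 t2]) - mean2 (fun t1 t2 => f (g t1 t2))) by rewrite /f; ring.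
apply: le_trans (ler_normD _ _) _; apply: le_trans (lerD (ler_normD _ _) (lexx _)) _.
lra.
Qed.
End spectral_limit.

(** * The Galerkin matrices *)

Lemma conv_const l : conv (fun _ => l) l.
Proof. by move=> e e0; exists 0%N => n _; rewrite subrr normr0 ltW. Qed.

Lemma ev_ge_archi (x : R) : ev (fun n => x <= n%:R).
Proof.
exists (Num.bound `|x|) => n hn; apply: le_trans (ler_norm _) _.
by apply: le_trans (ltW (archi_boundP (normr_ge0 x))) _; rewrite ler_nat.
Qed.

Lemma conv_div_nat c (k : nat -> nat) : (forall n, (n <= k n)%N) -> conv (fun n => c / (k n)%:R) 0.
Proof.
move=> hk e e0; apply: ev_imp (ev_and (ev_ge_archi (`|c| / e)) (ev_ge_archi 1)) => n [h h1].
have n0 : 0 < (k n)%:R :> R by apply: lt_le_trans ltr01 (le_trans h1 _); rewrite ler_nat.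
rewrite subr0 normrM normfV (gtr0_norm n0) ler_pdivrMr // mulrC -ler_pdivrMr //.
by apply: le_trans h _; rewrite ler_nat.
Qed.

Lemma n2of_oo nu : 0 < nu -> forall N, ev (fun n => (N <= n2of nu n)%N).
Proof.
move=> nu0 N; apply: ev_imp (ev_ge_archi ((N%:R + 1) / nu)) => n; rewrite ler_pdivrMr // mulrC => h.
have hr : N%:R + 1 <= nu * n%:R + 2^-1 by apply: le_trans h _; rewrite lerDl invr_ge0.
rewrite /n2of; set u := up _.
have h1 : nu * n%:R + 2^-1 < IZR u by apply/RltP; case: (archimed (nu * n%:R + 2^-1)).
have : (IZR (Z.of_nat N) < IZR (Z.sub u 1))%coqR.
  apply/RltP; rewrite minus_IZR -INR_IZR_INZ INRE RminusE ltrBrDr.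
  exact: le_lt_trans hr h1.
by move=> /lt_IZR; lia.
Qed.

Lemma mdim_oo p N : ev (fun n => (N <= mdim n p)%N).
Proof. by exists (N + 2)%N => n; rewrite /mdim; lia. Qed.

Lemma INR_succ_sub p k : (k <= p)%N -> (INR p + 1 - INR k)%coqR = (p.+1 - k)%N%:R.
Proof. by move=> kp; rewrite !INRE RplusE RminusE natrB ?(leq_trans kp) // -natr1. Qed.

Lemma hsymE p t : hsym p t = cos_series p (symM p) t.
Proof.
rewrite /hsym /cos_series /symM INR_succ_sub // subn0; congr (_ + _ * _).
by apply: eq_big_nat => k /andP[_ kp]; rewrite INR_succ_sub //; lia.
Qed.

Lemma fsymE p t : Defs.fsym p t = cos_series p (symK p) t.
Proof.
have E : \sum_(1 <= k < p.+1) symK p k * cos (k%:R * t) =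
    - \sum_(1 <= k < p.+1) Derive_n (cardB (2 * p + 1)) 2 ((p.+1 - k)%N%:R) * cos (k%:R * t).
  rewrite -sumrN; apply: eq_big_nat => k /andP[_ kp].
  by rewrite /symK INR_succ_sub ?RoppE ?mulNr //; lia.
by rewrite /Defs.fsym /cos_series E mulrN /symK INR_succ_sub // subn0.
Qed.

Lemma buc_ext f g : (forall x y, f x y = g x y) -> buc f -> buc g.
Proof.
move=> fg; congr buc; apply: functional_extensionality => x.
exact: functional_extensionality.
Qed.

Lemma buc_cos_series a b p c : buc (fun x y => cos_series p c (a * x + b * y)).
Proof.
apply: (@buc_ext (fun x y => c 0%N + 2 * \sum_(1 <= k < p.+1) c k * cos (k%:R * a * x + k%:R * b * y))).
  move=> x y; rewrite /cos_series; congr (_ + _ * _); apply: eq_bigr => k _.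
  by congr (_ * cos _); ring.
apply: (buc_add (buc_const _)); apply: buc_scal.
by have [] := @buc_sum _ (index_iota 1 p.+1) c _ (fun k => buc_cos (k%:R * a) (k%:R * b)).
Qed.

Lemma buc_gsym p1 p2 nu : buc (gsym p1 p2 nu).
Proof.
have b1 p c : buc (fun x y => cos_series p c x).
  by apply: buc_ext (buc_cos_series 1 0 p c) => x y; congr cos_series; ring.
have b2 p c : buc (fun x y => cos_series p c y).
  by apply: buc_ext (buc_cos_series 0 1 p c) => x y; congr cos_series; ring.
apply: (@buc_ext (fun x y => nu^-1 * (cos_series p2 (symM p2) x * cos_series p1 (symK p1) y)
  + nu * (cos_series p2 (symK p2) x * cos_series p1 (symM p1) y))).
  by move=> x y; rewrite /gsym !hsymE !fsymE !mulrA.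
by apply: buc_add; apply: buc_scal; apply: buc_mul.
Qed.

Lemma bb1_widen m (X : forall n, 'M[R]_(m n)) C D w : C <= D -> bb1 X C w -> bb1 X D w.
Proof.
by move=> CD; apply: ev_imp => n [h1 h2]; split=> // i; apply: le_trans CD.
Qed.

Lemma bb1_eq m (X Y : forall n, 'M[R]_(m n)) C w :
  ev (fun n => X n = Y n) -> bb1 X C w -> bb1 Y C w.
Proof. by move=> e b; apply: ev_imp (ev_and e b) => n [->]. Qed.

Lemma lim1_eq m (X Y : forall n, 'M[R]_(m n)) s w :
  ev (fun n => X n = Y n) -> lim1 X s w -> lim1 Y s w.
Proof. by move=> h l e e0; apply: ev_imp (ev_and h (l e e0)) => n [->]. Qed.

(** H carries no symbol, as its coefficient vanishes in the limit; its transpose is bounded too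
    because the antisymmetric part of the matrix involves both. *)
Definition galerkin_limit (m : nat -> nat) (M K H : forall n, 'M[R]_(m n)) (h f : R -> R) : Prop :=
  exists C w, [/\ 0 <= C, forall t, `|h t| <= C /\ `|f t| <= C,
    [/\ bb1 M C w, bb1 K C w, bb1 H C w & bb1 (fun n => (H n)^T) C w],
    lim1 M h w & lim1 K f w].

Lemma galerkin_limit_comp m M K H h f (k : nat -> nat) : (forall N, ev (fun n => (N <= k n)%N)) ->
  @galerkin_limit m M K H h f ->
  @galerkin_limit (fun n => m (k n)) (fun n => M (k n)) (fun n => K (k n)) (fun n => H (k n)) h f.
Proof.
move=> hk [C [w [C0 hC [b1 b2 b3 b4] l1 l2]]]; exists C, w; split=> //.
- by split; [exact: ev_comp hk b1|exact: ev_comp hk b2|exact: ev_comp hk b3|exact: ev_comp hk b4].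
- by move=> e e0; exact: ev_comp hk (l1 e e0).
- by move=> e e0; exact: ev_comp hk (l2 e e0).
Qed.

Lemma banded_tr p E : banded p E -> banded p (fun n i j => E n j i).
Proof.
move=> [C [n0 h]]; exists C, n0 => n hn; have [h1 h2] := h n hn; split=> i j //.
by rewrite addnC => hij; apply: h1.
Qed.

Lemma GB_galerkin_limit Q a p : 0 < a -> (0 < p)%N ->
  galerkin_limit (fun n => Mmx Q a n p) (fun n => Kmx Q a n p) (fun n => Hmx Q a n p) (hsym p) (Defs.fsym p).
Proof.
move=> /RltP a0 p0; have [nd hd] := entry_Derive Q a0 p0.
have eM : ev (fun n => entry_mx p (entryM Q a p) n = Mmx Q a n p).
  by exists 0%N => n _; apply/matrixP => i j; rewrite !mxE /entryM INRE.
(* For K and H the identification holds only from the threshold of [entry_Derive] on. *)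
have eK : ev (fun n => entry_mx p (entryK Q a p) n = Kmx Q a n p).
  exists nd => n /hd h; apply/matrixP => i j; rewrite !mxE; have [<- _] := h i.+2 j.+2.
  by rewrite INRE.
have eH : ev (fun n => entry_mx p (entryH Q a p) n = Hmx Q a n p).
  by exists nd => n /hd h; apply/matrixP => i j; rewrite !mxE; have [_ <-] := h i.+2 j.+2.
have eHT : ev (fun n => entry_mx p (fun n i j => entryH Q a p n j i) n = (Hmx Q a n p)^T).
  exists nd => n /hd h; apply/matrixP => i j; rewrite !mxE; have [_ <-] := h j.+2 i.+2 => //.
have BM := @entryM_banded Q a p a0 p0; have BK := @entryK_banded Q a p a0 p0.
have BH := @entryH_banded Q a p a0 p0.
have [C1 C10 b1] := banded_bb1 BM; have [C2 C20 b2] := banded_bb1 BK.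
have [C3 C30 b3] := banded_bb1 BH; have [C4 C40 b4] := banded_bb1 (banded_tr BH).
pose S (c : nat -> R) : R := `|c 0%N| + 2 * \sum_(1 <= k < p.+1) `|c k|.
have S0 c : 0 <= S c by rewrite addr_ge0 // mulr_ge0 // sumr_ge0.
pose C := C1 + C2 + C3 + C4 + S (symM p) + S (symK p).
have := S0 (symM p); have := S0 (symK p) => sK sM.
have pw : (p <= p.*2.+1)%N by lia.
exists C, p.*2.+1; split.
- by rewrite /C; lra.
- move=> t; rewrite hsymE fsymE; split; apply: le_trans (cos_series_bound _ _ _) _;
  rewrite -/(S _) /C; lra.
- split.
  + by apply: bb1_widen (bb1_eq eM (b1 _ pw)); rewrite /C; lra.
  + by apply: bb1_widen (bb1_eq eK (b2 _ pw)); rewrite /C; lra.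
  + by apply: bb1_widen (bb1_eq eH (b3 _ pw)); rewrite /C; lra.
  + by apply: bb1_widen (bb1_eq eHT (b4 _ pw)); rewrite /C; lra.
- have -> : hsym p = cos_series p (symM p).
    by apply: functional_extensionality => t; rewrite hsymE.
  by apply: lim1_eq eM _; apply: toeplitz_lim1 => //; apply: entryM_limit.
- have -> : Defs.fsym p = cos_series p (symK p).
    by apply: functional_extensionality => t; rewrite fsymE.
  by apply: lim1_eq eK _; apply: toeplitz_lim1 => //; apply: entryK_limit.
Qed.

Lemma Re_rcontinuous F : ccontinuous F -> rcontinuous (fun z => complex.Re (F z)).
Proof.
move=> cF z e e0; have [d [d0 hd]] := cF z e e0; exists d => // w hw.
rewrite -Re_sub; apply: le_lt_trans (ge_Re_normc _) _.
by rewrite -cabsE; apply: hd; rewrite cabsE.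
Qed.

Lemma ge_Im_normc (z : R[i]) : `|complex.Im z| <= normc z.
Proof.
case: z => a b /=; rewrite -sqrtr_sqr ler_wsqrtr // lerDr; exact: sqr_ge0.
Qed.

Lemma Im_sub (z w : R[i]) : complex.Im (z - w) = complex.Im z - complex.Im w.
Proof. by case: z w => [? ?] [? ?]. Qed.

Lemma Im_rcontinuous F : ccontinuous F -> rcontinuous (fun z => complex.Im (F z)).
Proof.
move=> cF z e e0; have [d [d0 hd]] := cF z e e0; exists d => // w hw.
rewrite -Im_sub; apply: le_lt_trans (ge_Im_normc _) _.
by rewrite -cabsE; apply: hd; rewrite cabsE.
Qed.

Lemma conv_is_lim_seq u (l : R) : conv u l -> is_lim_seq u l.
Proof.
move=> h; apply/is_lim_seq_spec => -[eps eps0]; have e0 : 0 < eps by exact/RltP.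
have e20 : 0 < eps / 2 by rewrite divr_gt0.
have e2 : eps / 2 < eps by lra.
have [N hN] := h (eps / 2) e20; exists N => n /ssrnat.leP hn; apply/RltP; rewrite RabsE RminusE.
exact: le_lt_trans (hN n hn) e2.
Qed.

Section galerkin.
Variables (m2 m1 : nat -> nat).
Variables (M1 K1 H1 : forall n, 'M[R]_(m1 n)) (M2 K2 H2 : forall n, 'M[R]_(m2 n)).
Variables (h1 f1 h2 f2 : R -> R).
Hypothesis lim_1 : galerkin_limit M1 K1 H1 h1 f1.
Hypothesis lim_2 : galerkin_limit M2 K2 H2 h2 f2.
Variables (x y : R) (c1 c2 c3 : nat -> R).
Hypotheses (c1_0 : conv c1 0) (c2_0 : conv c2 0) (c3_0 : conv c3 0).

Let A n : 'M[R]_(m2 n * m1 n) := x *: (M2 n *t K1 n) + y *: (K2 n *t M1 n)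
  + c1 n *: (M2 n *t H1 n) + c2 n *: (H2 n *t M1 n) + c3 n *: (M2 n *t M1 n).

Lemma at2_galerkin : at2 A (fun t1 t2 => x * (h2 t1 * f1 t2) + y * (f2 t1 * h1 t2)).
Proof.
have [C [w [C0 hC [bM1 bK1 bH1 _] lM1 lK1]]] := lim_1.
have [D [v [D0 hD [bM2 bK2 bH2 _] lM2 lK2]]] := lim_2.
have -> : (fun t1 t2 => x * (h2 t1 * f1 t2) + y * (f2 t1 * h1 t2)) =
  (fun t1 t2 => x * (h2 t1 * f1 t2) + y * (f2 t1 * h1 t2) + 0 + 0 + 0).
  by do 2!apply: functional_extensionality => ?; rewrite !addr0.
have CD : 0 <= D * C by rewrite mulr_ge0.
have TK := at2_tens D0 C0 (fun t => (hD t).1) (fun t => (hC t).2) bM2 bK1 lM2 lK1.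
have TM := at2_tens D0 C0 (fun t => (hD t).2) (fun t => (hC t).1) bK2 bM1 lK2 lM1.
have V1 := at2_vanish CD (bb2_tens D0 C0 bM2 bH1) c1_0.
have V2 := at2_vanish CD (bb2_tens D0 C0 bH2 bM1) c2_0.
have V3 := at2_vanish CD (bb2_tens D0 C0 bM2 bM1) c3_0.
have S := at2_add (at2_scale (@conv_const x) TK) (at2_scale (@conv_const y) TM).
exact: (at2_add (at2_add (at2_add S V1) V2) V3).
Qed.

Hypotheses (M1s : forall n, (M1 n)^T = M1 n) (K1s : forall n, (K1 n)^T = K1 n).
Hypotheses (M2s : forall n, (M2 n)^T = M2 n) (K2s : forall n, (K2 n)^T = K2 n).

(* The diffusion and reaction parts are symmetric, so only the advection terms contribute. *)
Lemma asym_galerkin e : 0 < e -> ev (fun n => forall i, \sum_j `|A n i j - A n j i| <= e).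
Proof.
move=> e0.
have [C [w [C0 _ [bM1 _ bH1 bT1] _ _]]] := lim_1.
have [D [v [D0 _ [bM2 _ bH2 bT2] _ _]]] := lim_2.
have CD : 0 <= D * C by rewrite mulr_ge0.
have CD1 : 0 < D * C + 1 by rewrite ltr_wpDl.
(* Two advection terms and their transposes give four row sums, each at most D C; the added 1 avoids
   dividing by 0. *)
pose d := e / 4 / (D * C + 1).
have d0 : 0 < d by rewrite !divr_gt0.
have dE : d * (D * C) <= e / 4.
  apply: (@le_trans _ _ (d * (D * C + 1))); last by rewrite divfK ?lt0r_neq0.
  by rewrite ler_wpM2l ?(ltW d0) // lerDl.
have := ev_and (ev_and (c1_0 d0) (c2_0 d0)) (ev_and (ev_and (bb2_tens D0 C0 bM2 bH1) (bb2_tens D0 C0 bM2 bT1))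
  (ev_and (bb2_tens D0 C0 bH2 bM1) (bb2_tens D0 C0 bT2 bM1))).
apply: ev_imp => n [[]]; rewrite !subr0 => hc1 hc2 [[[_ r1] [_ r2]] [[_ r3] [_ r4]]] i.
have E j : A n i j - A n j i =
    c1 n * ((M2 n *t H1 n) i j - (M2 n *t (H1 n)^T) i j) + c2 n * ((H2 n *t M1 n) i j - ((H2 n)^T *t M1 n) i j).
  have T (X : 'M[R]_(m2 n)) (Y : 'M[R]_(m1 n)) : (X *t Y) j i = (X^T *t Y^T) i j.
    by rewrite -trmx_tens [RHS]mxE.
  have P (X Y : 'M[R]_(m2 n * m1 n)) k l : (X + Y) k l = X k l + Y k l by rewrite mxE.
  have Z c (X : 'M[R]_(m2 n * m1 n)) k l : (c *: X) k l = c * X k l by rewrite mxE.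
  rewrite /A !P !Z !T M1s M2s K1s K2s; ring.
apply: (@le_trans _ _ (\sum_j (d * `|(M2 n *t H1 n) i j| + d * `|(M2 n *t (H1 n)^T) i j|
    + d * `|(H2 n *t M1 n) i j| + d * `|((H2 n)^T *t M1 n) i j|))).
  apply: ler_sum => j _; rewrite E.
  have B a b c : `|c| <= d -> `|c * (a - b)| <= d * `|a| + d * `|b|.
    move=> hc; rewrite normrM -mulrDr; apply: ler_pM => //; exact: ler_normB.
  by apply: le_trans (ler_normD _ _) _; rewrite -addrA; apply: lerD; apply: B.
have S (Z : 'M[R]_(m2 n * m1 n)) : \sum_j `|Z i j| <= D * C -> \sum_j d * `|Z i j| <= e / 4.
  by move=> hZ; rewrite -mulr_sumr; apply: le_trans dE; rewrite ler_wpM2l // ltW.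
rewrite !big_split /=.
have := S _ (r1 i); have := S _ (r2 i); have := S _ (r3 i); have := S _ (r4 i); lra.
Qed.
End galerkin.

Lemma Mmx_sym Q a n p : (Mmx Q a n p)^T = Mmx Q a n p.
Proof. by apply/matrixP => i j; rewrite !mxE; congr (_ * _); apply: RInt_ext => z _; rewrite mulrC. Qed.

Lemma Kmx_sym Q a n p : (Kmx Q a n p)^T = Kmx Q a n p.
Proof. by apply/matrixP => i j; rewrite !mxE; congr (_ * _); apply: RInt_ext => z _; rewrite mulrC. Qed.

Theorem theorem18 (p1 p2 : nat) (a1 a2 : R) (Q : gbkind) (b1 b2 g nu : R) :
  (1 <= p1)%N -> (1 <= p2)%N -> 0 < a1 -> 0 < a2 -> 0 <= g -> 0 < nu ->
  eig_distributed (Amx Q p1 p2 a1 a2 b1 b2 g nu) (gsym p1 p2 nu).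
Proof.
move=> p10 p20 a10 a20 _ nu0 lam hlam F cF _.
have noo := n2of_oo nu0.
have m1oo : forall N, ev (fun n => (N <= mdim n p1)%N) := mdim_oo p1.
have m2oo N : ev (fun n => (N <= mdim (n2of nu n) p2)%N) by apply: ev_comp noo (mdim_oo p2 N).
have L1 := GB_galerkin_limit Q a10 p10.
have L2 := galerkin_limit_comp noo (GB_galerkin_limit Q a20 p20).
have c1_0 : conv (fun n => b1 / (nu * n%:R)) 0.
  have := @conv_div_nat (b1 / nu) id (fun n => leqnn n).
  by congr conv; apply: functional_extensionality => n; rewrite invfM mulrA.
have c2_0 : conv (fun n => b2 / n%:R) 0 := @conv_div_nat b2 id (fun n => leqnn n).
have c3_0 : conv (fun n => g / (nu * n%:R ^+ 2)) 0.
  have sq n : (n <= n ^ 2)%N by rewrite expnS expn1; case: n => // n; rewrite leq_pmulr.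
  have := @conv_div_nat (g / nu) _ sq.
  congr conv; apply: functional_extensionality => n.
  by rewrite natrX (invfM nu) mulrA.
(* The second space is the left tensor factor, which is why the first frequency goes with p2 in
   [gsym]. *)
have at_A : at2 (Amx Q p1 p2 a1 a2 b1 b2 g nu) (gsym p1 p2 nu).
  have := at2_galerkin L1 L2 nu^-1 nu c1_0 c2_0 c3_0.
  congr at2; do 2!apply: functional_extensionality => ?.
  by rewrite /gsym !mulrA.
have as_A e : 0 < e -> ev (fun n => forall i, \sum_j
    `|Amx Q p1 p2 a1 a2 b1 b2 g nu n i j - Amx Q p1 p2 a1 a2 b1 b2 g nu n j i| <= e).
  by apply: (asym_galerkin L1 L2 nu^-1 nu _ c1_0 c2_0) => n; rewrite ?Mmx_sym ?Kmx_sym.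
have S := spectral_limit m1oo m2oo at_A (buc_gsym p1 p2 nu) as_A hlam.
by split; apply: conv_is_lim_seq; [exact: S (Re_rcontinuous cF)|exact: S (Im_rcontinuous cF)].
Qed.
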